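(* Let $n\ge1$ and let $\gamma_n: K(\mathcal O^n)\to{}^{\mathbb Z}V_{\rm sp}^{\otimes n}$ be the isomorphism of abelian groups $[M(a_1,\dots,a_n)]\mapsto v_{a_1}\otimes\cdots\otimes v_{a_n}$ ($(a_1,\dots,a_n)\in[0,7]^n$). For $1\le i\le3$ and $2\le j\le3$ define functors $\mathcal O^n\to\mathcal O^n$ by $$\mathcal H_i^+=\bigoplus_{[\mathbf d]\in\widetilde{\mathbf D},\ {\rm sgn}(c_i(\mathbf d))\in\{0,1\}}\mathcal H_i^{{\rm sgn}(c_i(\mathbf d))}([\mathbf d]),\qquad \mathcal H_i^-=\bigoplus_{[\mathbf d]\in\widetilde{\mathbf D},\ {\rm sgn}(c_i(\mathbf d))=-1}\mathcal H_i^{{\rm sgn}(c_i(\mathbf d))}([\mathbf d]),$$ $$\mathcal E_1^\pm=\bigoplus_{[\mathbf d]\in\widetilde{\mathbf D}}\mathcal E_1^\pm([\mathbf d]),\quad \mathcal F_1^\pm=\bigoplus_{[\mathbf d]\in\widetilde{\mathbf D}}\mathcal F_1^\pm([\mathbf d]),\quad \mathcal E_j=\bigoplus_{[\mathbf d]\in\widetilde{\mathbf D}}\mathcal E_j([\mathbf d]),\quad \mathcal F_j=\bigoplus_{[\mathbf d]\in\widetilde{\mathbf D}}\mathcal F_j([\mathbf d]).$$ Then these functors are exact and, as maps $K(\mathcal O^n)\to{}^{\mathbb Z}V_{\rm sp}^{\otimes n}$: (1) for $1\le i\le3$, $\ \gamma_n\circ([\mathcal H_i^+]-[\mathcal H_i^-])=h_i\circ\gamma_n$;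 (2)(a) $\gamma_n\circ([\mathcal E_1^+]-[\mathcal E_1^-])=e_1\circ\gamma_n$; (b) for $i=2,3$, $\ \gamma_n\circ[\mathcal E_i]=e_i\circ\gamma_n$; (3)(a) $\gamma_n\circ([\mathcal F_1^+]-[\mathcal F_1^-])=f_1\circ\gamma_n$; (b) for $i=2,3$, $\ \gamma_n\circ[\mathcal F_i]=f_i\circ\gamma_n$.
   Context: **Spin representation.** $U(\mathfrak{so}(7,\mathbb C))$ is generated by $h_i,e_i,f_i$ ($1\le i\le3$) with the Serre relations for the Cartan matrix $(a_{i,j})=\begin{pmatrix}2&-1&0\\-1&2&-1\\0&-2&2\end{pmatrix}$ (so $h_ie_j-e_jh_i=a_{i,j}e_j$). $V_{\rm sp}=\bigoplus_{i=0}^7\mathbb Cv_i$ is the spin representation: $h_1v_k=v_k$ for $k=4,5$, $h_1v_k=-v_k$ for $k=2,3$; $h_2v_k=v_k$ for $k=2,6$, $h_2v_k=-v_k$ for $k=1,5$; $h_3v_k=v_k$ for $k$ odd, $h_3v_k=-v_k$ for $k$ even; $e_1v_3=v_5$, $e_1v_2=v_4$; $e_2v_5=v_6$, $e_2v_1=v_2$; $e_3v_6=v_7$, $e_3v_4=v_5$, $e_3v_2=v_3$, $e_3v_0=v_1$; $f_1v_5=v_3$, $f_1v_4=v_2$; $f_2v_6=v_5$, $f_2v_2=v_1$; $f_3v_7=v_6$, $f_3v_5=v_4$, $f_3v_3=v_2$, $f_3v_1=v_0$; all other actions of generators on basis vectors are zero. $V_{\rm sp}^{\otimes n}$ is its $n$-th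 tensor power (Lie algebra elements act by the Leibniz rule). **Category $\mathcal O$.** Everything is over $\mathbb C$. Fix the standard triangular decomposition $\mathfrak{gl}_n=\mathfrak n_+\oplus\mathfrak h\oplus\mathfrak n_-$; $\varepsilon_1,\dots,\varepsilon_n$ is the standard basis of $\mathfrak h^*$, positive roots $\varepsilon_i-\varepsilon_j$ ($i<j$), $\rho$ the half-sum of positive roots. $\mathcal O(\mathfrak{gl}_n)$ is the BGG category; $\theta_\lambda$ is the central character of the Verma module of highest weight $\lambda$; $\mathcal O_\theta(\mathfrak{gl}_n)$ is the full subcategory of modules on which every $z-\theta(z)$, $z\in Z(U(\mathfrak{gl}_n))$, acts locally nilpotently; $\mathrm{proj}_\theta$ is the functor taking the $\theta$-component summand. $F_V=V\otimes-$ for a finite-dimensional module $V$. $[0,7]=\{0,\dots,7\}$; for $(a_1,\dots,a_n)\in[0,7]^n$, $M(a_1,\dots,a_n)$ is the Verma module of highest weight $\sum_m a_m\varepsilon_m-\rho$. $K(\cdot)$ is the Grothendieck group; $[M]$, $[F]$ denote the class of an object and the homomorphism induced by an exact functor. **Index set.** $\mathbf D$ is the set of 8-tuples $\mathbf d=(d_0,\dots,d_7)$ of nonnegative integers with $\sum d_k=n$. $\mathbf d\sim\mathbf d'$ iff the quantities $d_7+d_6+d_5+d_4-d_3-d_2-d_1-d_0$, $d_7+d_6-d_5-d_4+d_3+d_2-d_1-d_0$, $d_7-d_6+d_5-d_4+d_3-d_2+d_1-d_0$ agree for $\mathbf d,\mathbf d'$ (the same formula defines $\sim$ on integer 8-tuples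 with sum $n$); $[\mathbf d]$ is the class, $\widetilde{\mathbf D}$ the set of classes of elements of $\mathbf D$. ${}^{\mathbb Z}V_{\rm sp}^{\otimes n}$ is the $\mathbb Z$-span of all $v_{a_1}\otimes\cdots\otimes v_{a_n}$, $(a_1,\dots,a_n)\in[0,7]^n$. For $\mathbf d\in\mathbf D$, $\lambda_{\mathbf d}=\sum_{i=0}^7\sum_{j=1}^{d_i}i\,\varepsilon_{d_0+\cdots+d_{i-1}+j}$, $\theta_{\mathbf d}=\theta_{\lambda_{\mathbf d}-\rho}$, $\mathcal O_{\mathbf d}=\mathcal O_{\theta_{\mathbf d}}(\mathfrak{gl}_n)$; for $\mathbf d\notin\mathbf D$, $\mathcal O_{\mathbf d}$ is the trivial (zero) subcategory. $\mathcal O_{[\mathbf d]}=\bigoplus_{\mathbf d'\in[\mathbf d]}\mathcal O_{\mathbf d'}$, $\mathcal O^n=\bigoplus_{[\mathbf d]\in\widetilde{\mathbf D}}\mathcal O_{[\mathbf d]}$. For a class containing no element of $\mathbf D$, the corresponding category is zero. $\mathbf d_i^j$ denotes $\mathbf d$ with $1$ subtracted from $d_i$ and $1$ added to $d_j$. A direct sum of functors defined on the summands $\mathcal O_{\mathbf d'}$ (or $\mathcal O_{[\mathbf d]}$) means the functor acting by the given functor on each summand. **Functors.** $c_1(\mathbf d)=d_5+d_4-d_3-d_2$, $c_2(\mathbf d)=d_6-d_5+d_2-d_1$, $c_3(\mathbf d)=d_7-d_6+d_5-d_4+d_3-d_2+d_1-d_0$ (these depend only on $[\mathbf d]$); ${\rm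 sgn}\in\{1,0,-1\}$ is the sign. $\mathcal H_i^{{\rm sgn}(c_i(\mathbf d))}([\mathbf d])=({\rm Id}_{\mathcal O_{[\mathbf d]}})^{\oplus|c_i(\mathbf d)|}$. $L_n$ is the $n$-dimensional fundamental representation of $\mathfrak{gl}_n$ (weights $\varepsilon_1,\dots,\varepsilon_n$), $L_n^*$ its dual; $Sym^2$, $Alt^2$ are the symmetric and alternating squares. For $\mathbf d\in\mathbf D$ define functors $\mathcal O_{\mathbf d}\to\mathcal O_{\mathbf d_i^j}$ (zero if $\mathbf d_i^j\notin\mathbf D$): - $\mathcal E_1^{+2}(\mathbf d)=\mathrm{proj}_{\theta_{\mathbf d_2^4}}\circ F_{Sym^2(L_n)}$, $\mathcal E_1^{-2}(\mathbf d)=\mathrm{proj}_{\theta_{\mathbf d_2^4}}\circ F_{Alt^2(L_n)}$, $\mathcal E_1^{+3}(\mathbf d)=\mathrm{proj}_{\theta_{\mathbf d_3^5}}\circ F_{Sym^2(L_n)}$, $\mathcal E_1^{-3}(\mathbf d)=\mathrm{proj}_{\theta_{\mathbf d_3^5}}\circ F_{Alt^2(L_n)}$; - $\mathcal E_2^k(\mathbf d)=\mathrm{proj}_{\theta_{\mathbf d_k^{k+1}}}\circ F_{L_n}$ for $k=1,5$; $\mathcal E_3^k(\mathbf d)=\mathrm{proj}_{\theta_{\mathbf d_k^{k+1}}}\circ F_{L_n}$ for $k=0,2,4,6$; - $\mathcal F_1^{+4}(\mathbf d)=\mathrm{proj}_{\theta_{\mathbf d_4^2}}\circ F_{Sym^2(L_n^*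 )}$, $\mathcal F_1^{-4}(\mathbf d)=\mathrm{proj}_{\theta_{\mathbf d_4^2}}\circ F_{Alt^2(L_n^* )}$, $\mathcal F_1^{+5}(\mathbf d)=\mathrm{proj}_{\theta_{\mathbf d_5^3}}\circ F_{Sym^2(L_n^* )}$, $\mathcal F_1^{-5}(\mathbf d)=\mathrm{proj}_{\theta_{\mathbf d_5^3}}\circ F_{Alt^2(L_n^* )}$; - $\mathcal F_2^k(\mathbf d)=\mathrm{proj}_{\theta_{\mathbf d_k^{k-1}}}\circ F_{L_n^*}$ for $k=2,6$; $\mathcal F_3^k(\mathbf d)=\mathrm{proj}_{\theta_{\mathbf d_k^{k-1}}}\circ F_{L_n^*}$ for $k=1,3,5,7$. For $[\mathbf d]\in\widetilde{\mathbf D}$: $\mathcal E_1^{\pm}([\mathbf d])=\bigoplus_{\mathbf d'\in[\mathbf d]}(\mathcal E_1^{\pm2}(\mathbf d')\oplus\mathcal E_1^{\pm3}(\mathbf d')):\mathcal O_{[\mathbf d]}\to\mathcal O_{[\mathbf d_3^5]}=\mathcal O_{[\mathbf d_2^4]}$; $\mathcal E_2([\mathbf d])=\bigoplus_{\mathbf d'\in[\mathbf d]}(\mathcal E_2^1(\mathbf d')\oplus\mathcal E_2^5(\mathbf d')):\mathcal O_{[\mathbf d]}\to\mathcal O_{[\mathbf d_1^2]}=\mathcal O_{[\mathbf d_5^6]}$; $\mathcal E_3([\mathbf d])=\bigoplus_{\mathbf d'\in[\mathbf d]}(\mathcal E_3^0(\mathbf d')\oplus\mathcal E_3^2(\mathbf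 d')\oplus\mathcal E_3^4(\mathbf d')\oplus\mathcal E_3^6(\mathbf d')):\mathcal O_{[\mathbf d]}\to\mathcal O_{[\mathbf d_0^1]}=\mathcal O_{[\mathbf d_2^3]}=\mathcal O_{[\mathbf d_4^5]}=\mathcal O_{[\mathbf d_6^7]}$; $\mathcal F_1^{\pm}([\mathbf d])=\bigoplus_{\mathbf d'\in[\mathbf d]}(\mathcal F_1^{\pm4}(\mathbf d')\oplus\mathcal F_1^{\pm5}(\mathbf d')):\mathcal O_{[\mathbf d]}\to\mathcal O_{[\mathbf d_4^2]}=\mathcal O_{[\mathbf d_5^3]}$; $\mathcal F_2([\mathbf d])=\bigoplus_{\mathbf d'\in[\mathbf d]}(\mathcal F_2^2(\mathbf d')\oplus\mathcal F_2^6(\mathbf d')):\mathcal O_{[\mathbf d]}\to\mathcal O_{[\mathbf d_2^1]}=\mathcal O_{[\mathbf d_6^5]}$; $\mathcal F_3([\mathbf d])=\bigoplus_{\mathbf d'\in[\mathbf d]}(\mathcal F_3^1(\mathbf d')\oplus\mathcal F_3^3(\mathbf d')\oplus\mathcal F_3^5(\mathbf d')\oplus\mathcal F_3^7(\mathbf d')):\mathcal O_{[\mathbf d]}\to\mathcal O_{[\mathbf d_1^0]}=\mathcal O_{[\mathbf d_3^2]}=\mathcal O_{[\mathbf d_5^4]}=\mathcal O_{[\mathbf d_7^6]}$. *)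

(* Defs.v *)
From HB Require Import structures.
From mathcomp Require Import all_boot all_order all_algebra.
From mathcomp Require Import generic_quotient ring_quotient.
From mathcomp Require Import boolp classical_sets reals.
From mathcomp.real_closed Require Export complex.
From mathcomp Require Import zify.

Set Implicit Arguments.
Unset Strict Implicit.
Unset Printing Implicit Defensive.

Import Order.TTheory GRing.Theory Num.Theory.
Local Open Scope ring_scope.
Local Open Scope quotient_scope.

(* Everything is developed over a field C, instantiated by R[i], R : realType, *)
(* in the theorem; gl_n is 'M[C]_n with bracket x *m y - y *m x, its standard  *)
(* Cartan subalgebra is the diagonal matrices and n_+ the strictly upper       *)
(* triangular ones.                                                            *)

(* U(gl_n): the associative algebra presented by the generators iota x,   *)
(* x : 'M_n, linear in x, with iota [x,y] = iota x iota y - iota y iota x.     *)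
Section Enveloping.
Variables (C : fieldType) (n : nat).

Inductive uterm :=
| Uscal of C
| Ugen of 'M[C]_n
| Uadd of uterm & uterm
| Umul of uterm & uterm.

Definition Uopp t := Umul (Uscal (-1)) t.

Inductive ueq : uterm -> uterm -> Prop :=
| ueq_refl t : ueq t t
| ueq_sym t u : ueq t u -> ueq u t
| ueq_trans t u v : ueq t u -> ueq u v -> ueq t v
| ueq_add t t' u u' : ueq t t' -> ueq u u' -> ueq (Uadd t u) (Uadd t' u')
| ueq_mul t t' u u' : ueq t t' -> ueq u u' -> ueq (Umul t u) (Umul t' u')
| ueq_addA t u v : ueq (Uadd t (Uadd u v)) (Uadd (Uadd t u) v)
| ueq_addC t u : ueq (Uadd t u) (Uadd u t)
| ueq_add0 t : ueq (Uadd (Uscal 0) t) t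
| ueq_addN t : ueq (Uadd (Uopp t) t) (Uscal 0)
| ueq_mulA t u v : ueq (Umul t (Umul u v)) (Umul (Umul t u) v)
| ueq_mul1l t : ueq (Umul (Uscal 1) t) t
| ueq_mulDl t u v : ueq (Umul (Uadd t u) v) (Uadd (Umul t v) (Umul u v))
| ueq_mulDr t u v : ueq (Umul v (Uadd t u)) (Uadd (Umul v t) (Umul v u))
| ueq_scalD a b : ueq (Uscal (a + b)) (Uadd (Uscal a) (Uscal b))
| ueq_scalM a b : ueq (Uscal (a * b)) (Umul (Uscal a) (Uscal b))
| ueq_scalC a t : ueq (Umul (Uscal a) t) (Umul t (Uscal a))
| ueq_gen a x y :
    ueq (Ugen (a *: x + y)) (Uadd (Umul (Uscal a) (Ugen x)) (Ugen y))
| ueq_bracket x y :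
    ueq (Ugen (x *m y - y *m x))
        (Uadd (Umul (Ugen x) (Ugen y)) (Uopp (Umul (Ugen y) (Ugen x)))).

HB.instance Definition _ := gen_eqMixin uterm.
HB.instance Definition _ := gen_choiceMixin uterm.

Definition ueqb : rel uterm := fun t u => `[< ueq t u >].

Lemma ueqb_equiv : equiv_class_of ueqb.
Proof.
split=> [t|t u|u t v] /=.
- by apply/asboolP; exact: ueq_refl.
- by apply/asboolP/asboolP; exact: ueq_sym.
- by move=> /asboolP tu /asboolP uv; apply/asboolP; exact: ueq_trans tu uv.
Qed.
Canonical ueqb_equivRel := EquivRelPack ueqb_equiv.

Definition Ualg := {eq_quot ueqb}.
HB.instance Definition _ := Choice.on Ualg.
HB.instance Definition _ := EqQuotient.on Ualg.

Lemma UalgP t u : ueq t u <-> \pi_Ualg t = \pi_Ualg u.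
Proof.
split; first by move=> tu; apply/eqmodP/asboolP.
by move=> /eqmodP/asboolP.
Qed.

Lemma repr_ueq t : ueq (repr (\pi_Ualg t)) t.
Proof. by apply/UalgP; rewrite reprK. Qed.

Definition ualg_add (a b : Ualg) : Ualg := \pi_Ualg (Uadd (repr a) (repr b)).
Definition ualg_mul (a b : Ualg) : Ualg := \pi_Ualg (Umul (repr a) (repr b)).
Definition ualg_opp (a : Ualg) : Ualg := \pi_Ualg (Uopp (repr a)).
Definition ualg_scal (c : C) : Ualg := \pi_Ualg (Uscal c).

Lemma pi_add t u : ualg_add (\pi_Ualg t) (\pi_Ualg u) = \pi_Ualg (Uadd t u).
Proof. by apply/UalgP; apply: ueq_add; exact: repr_ueq. Qed.

Lemma pi_mul t u : ualg_mul (\pi_Ualg t) (\pi_Ualg u) = \pi_Ualg (Umul t u).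
Proof. by apply/UalgP; apply: ueq_mul; exact: repr_ueq. Qed.

Lemma pi_opp t : ualg_opp (\pi_Ualg t) = \pi_Ualg (Uopp t).
Proof. by apply/UalgP; apply: ueq_mul; [exact: ueq_refl|exact: repr_ueq]. Qed.

Let ualg_ind (P : Ualg -> Prop) : (forall t, P (\pi_Ualg t)) -> forall a, P a.
Proof. by move=> H a; rewrite -[a]reprK. Qed.

Fact ualg_addA : associative ualg_add.
Proof.
elim/ualg_ind=> t; elim/ualg_ind=> u; elim/ualg_ind=> v.
by rewrite !pi_add; apply/UalgP; exact: ueq_addA.
Qed.
Fact ualg_addC : commutative ualg_add.
Proof.
elim/ualg_ind=> t; elim/ualg_ind=> u.
by rewrite !pi_add; apply/UalgP; exact: ueq_addC.
Qed.
Fact ualg_add0 : left_id (ualg_scal 0) ualg_add.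
Proof.
by elim/ualg_ind=> t; rewrite pi_add; apply/UalgP; exact: ueq_add0.
Qed.
Fact ualg_addN : left_inverse (ualg_scal 0) ualg_opp ualg_add.
Proof.
by elim/ualg_ind=> t; rewrite pi_opp pi_add; apply/UalgP; exact: ueq_addN.
Qed.
HB.instance Definition _ :=
  GRing.isZmodule.Build Ualg ualg_addA ualg_addC ualg_add0 ualg_addN.

Fact ualg_mulA : associative ualg_mul.
Proof.
elim/ualg_ind=> t; elim/ualg_ind=> u; elim/ualg_ind=> v.
by rewrite !pi_mul; apply/UalgP; exact: ueq_mulA.
Qed.
Fact ualg_mul1l : left_id (ualg_scal 1) ualg_mul.
Proof.
by elim/ualg_ind=> t; rewrite pi_mul; apply/UalgP; exact: ueq_mul1l.
Qed.
Fact ualg_mul1r : right_id (ualg_scal 1) ualg_mul.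
Proof.
elim/ualg_ind=> t; rewrite pi_mul; apply/UalgP.
exact: ueq_trans (ueq_sym (ueq_scalC _ _)) (ueq_mul1l _).
Qed.
Fact ualg_mulDl : left_distributive ualg_mul ualg_add.
Proof.
elim/ualg_ind=> t; elim/ualg_ind=> u; elim/ualg_ind=> v.
by rewrite !(pi_add, pi_mul); apply/UalgP; exact: ueq_mulDl.
Qed.
Fact ualg_mulDr : right_distributive ualg_mul ualg_add.
Proof.
elim/ualg_ind=> t; elim/ualg_ind=> u; elim/ualg_ind=> v.
by rewrite !(pi_add, pi_mul); apply/UalgP; exact: ueq_mulDr.
Qed.

Fixpoint uaug (t : uterm) : C :=
  match t with
  | Uscal c => c
  | Ugen _ => 0
  | Uadd t u => uaug t + uaug u
  | Umul t u => uaug t * uaug u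
  end.

Lemma ueq_uaug t u : ueq t u -> uaug t = uaug u.
Proof.
elim=> //= *; do ?congruence.
- by rewrite addrA.
- by rewrite addrC.
- by rewrite add0r.
- by rewrite mulN1r addNr.
- by rewrite mulrA.
- by rewrite mul1r.
- by rewrite mulrDl.
- by rewrite mulrDr.
- by rewrite mulrC.
- by rewrite mulr0 addr0.
- by rewrite !mulr0 addr0.
Qed.

Fact ualg_1neq0 : ualg_scal 1 != ualg_scal 0.
Proof. by apply/eqP => /UalgP/ueq_uaug /= /eqP; rewrite oner_eq0. Qed.

HB.instance Definition _ := GRing.Zmodule_isNzRing.Build Ualg
  ualg_mulA ualg_mul1l ualg_mul1r ualg_mulDl ualg_mulDr ualg_1neq0.

Fact ualg_scalM a b : ualg_scal (a * b) = ualg_scal a * ualg_scal b.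
Proof.
by rewrite [RHS]pi_mul; apply/UalgP; exact: ueq_scalM.
Qed.
Fact ualg_scalD a b : ualg_scal (a + b) = ualg_scal a + ualg_scal b.
Proof.
by rewrite [RHS]pi_add; apply/UalgP; exact: ueq_scalD.
Qed.
Fact ualg_scalC a (u : Ualg) : ualg_scal a * u = u * ualg_scal a.
Proof.
elim/ualg_ind: u => u; rewrite [LHS]pi_mul [RHS]pi_mul.
by apply/UalgP; exact: ueq_scalC.
Qed.

Definition ualg_scale (c : C) (u : Ualg) : Ualg := ualg_scal c * u.

Fact ualg_scaleA a b v :
  ualg_scale a (ualg_scale b v) = ualg_scale (a * b) v.
Proof. by rewrite /ualg_scale ualg_scalM mulrA. Qed.
Fact ualg_scale1 : left_id 1 ualg_scale.
Proof. by move=> v; rewrite /ualg_scale -[ualg_scal 1]/(1 : Ualg) mul1r. Qed.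
Fact ualg_scaleDr : right_distributive ualg_scale +%R.
Proof. by move=> a u v; rewrite /ualg_scale mulrDr. Qed.
Fact ualg_scaleDl v : {morph ualg_scale^~ v : a b / a + b >-> a + b}.
Proof. by move=> a b; rewrite /ualg_scale ualg_scalD mulrDl. Qed.
HB.instance Definition _ := GRing.Zmodule_isLmodule.Build C Ualg
  ualg_scaleA ualg_scale1 ualg_scaleDr ualg_scaleDl.

Fact ualg_scaleAl (a : C) (u v : Ualg) : a *: (u * v) = (a *: u) * v.
Proof. by rewrite /GRing.scale /= /ualg_scale mulrA. Qed.
HB.instance Definition _ := GRing.Lmodule_isLalgebra.Build C Ualg ualg_scaleAl.

Fact ualg_scaleAr (a : C) (u v : Ualg) : a *: (u * v) = u * (a *: v).
Proof.
by rewrite /GRing.scale /= /ualg_scale !mulrA ualg_scalC.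
Qed.
HB.instance Definition _ := GRing.Lalgebra_isAlgebra.Build C Ualg ualg_scaleAr.

Definition iota_U (x : 'M[C]_n) : Ualg := \pi_Ualg (Ugen x).

Fact iota_U_linear : linear iota_U.
Proof.
move=> a x y; rewrite [in RHS]/GRing.scale /= /ualg_scale.
rewrite [_ * _]pi_mul [RHS]pi_add; apply/UalgP; exact: ueq_gen.
Qed.
HB.instance Definition _ := GRing.isLinear.Build C 'M[C]_n Ualg *:%R iota_U
  iota_U_linear.

Lemma iota_U_bracket x y :
  iota_U (x *m y - y *m x) = iota_U x * iota_U y - iota_U y * iota_U x.
Proof.
have piM a b : iota_U a * iota_U b = \pi_Ualg (Umul (Ugen a) (Ugen b)).
  exact: pi_mul.
rewrite !piM [X in _ = _ + X]pi_opp [RHS]pi_add.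
by apply/UalgP; exact: ueq_bracket.
Qed.

Definition Ucentral (z : Ualg) : Prop := forall u : Ualg, z * u = u * z.

End Enveloping.

Section Modules.
Variables (C : fieldType) (n : nat).

Record rep (W : lmodType C) := Rep {
  ract :> 'M[C]_n -> W -> W;
  ract_linl : forall a x y w, ract (a *: x + y) w = a *: ract x w + ract y w;
  ract_linr : forall x a v w, ract x (a *: v + w) = a *: ract x v + ract x w;
  ract_bracket : forall x y w,
    ract (x *m y - y *m x) w = ract x (ract y w) - ract y (ract x w) }.

Record glmod := GlMod { car :> lmodType C; glrep : rep car }.

Definition gact (M : glmod) (x : 'M[C]_n) (m : M) : M := glrep M x m.

Record glhom (M N : glmod) := GlHom {
  hfun :> {linear M -> N};
  hequiv : forall x m, hfun (gact x m) = gact x (hfun m) }.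

(* The action of U(gl_n) on a module, through a representative. *)
Fixpoint ueval (M : glmod) (t : uterm C n) (m : M) : M :=
  match t with
  | Uscal c => c *: m
  | Ugen x => gact x m
  | Uadd t u => ueval t m + ueval u m
  | Umul t u => ueval t (ueval u m)
  end.

Definition uact (M : glmod) (u : Ualg C n) (m : M) : M := ueval (repr u) m.

Lemma ueval_lin (M : glmod) t a (m m' : M) :
  ueval t (a *: m + m') = a *: ueval t m + ueval t m'.
Proof.
elim: t m m' => [c|x|t iht u ihu|t iht u ihu] m m' /=.
- by rewrite scalerDr !scalerA mulrC.
- exact: ract_linr.
- by rewrite iht ihu scalerDr !addrA; congr (_ + _); rewrite addrAC.
- by rewrite ihu iht.
Qed.

Lemma uevalZ (M : glmod) t a (m : M) : ueval t (a *: m) = a *: ueval t m.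
Proof.
have := ueval_lin t a m 0; have := ueval_lin t (-1) (0 : M) 0.
by rewrite scaleN1r addr0 oppr0 scaleN1r addNr addr0 => ->; rewrite addr0.
Qed.

Lemma uevalD (M : glmod) t (m m' : M) :
  ueval t (m + m') = ueval t m + ueval t m'.
Proof. by have := ueval_lin t 1 m m'; rewrite !scale1r. Qed.

Lemma ueq_ueval (M : glmod) t u : ueq t u -> forall m : M, ueval t m = ueval u m.
Proof.
elim=> //=.
- by move=> t1 t2 t3 _ e1 _ e2 m; rewrite e1.
- by move=> t1 t2 u1 u2 _ e1 _ e2 m; rewrite e1 e2.
- by move=> t1 t2 u1 u2 _ e1 _ e2 m; rewrite e1 e2.
- by move=> *; rewrite addrA.
- by move=> *; rewrite addrC.
- by move=> *; rewrite scale0r add0r.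
- by move=> *; rewrite scaleN1r addNr scale0r.
- by move=> *; rewrite scale1r.
- by move=> t1 t2 u1 m; rewrite uevalD.
- by move=> *; rewrite scalerDl.
- by move=> *; rewrite scalerA.
- by move=> *; rewrite uevalZ.
- by move=> *; rewrite /gact ract_linl.
- by move=> *; rewrite /gact ract_bracket scaleN1r.
Qed.

Lemma uact_pi (M : glmod) t (m : M) : uact (\pi_(Ualg C n) t) m = ueval t m.
Proof. exact/ueq_ueval/repr_ueq. Qed.

Lemma uact_iota (M : glmod) x (m : M) : uact (iota_U x) m = gact x m.
Proof. exact: uact_pi. Qed.

Lemma uact1 (M : glmod) (m : M) : uact 1 m = m.
Proof. by rewrite uact_pi /= scale1r. Qed.

Lemma uactD (M : glmod) a b (m : M) : uact (a + b) m = uact a m + uact b m.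
Proof. by rewrite uact_pi. Qed.

Lemma uactM (M : glmod) a b (m : M) : uact (a * b) m = uact a (uact b m).
Proof. by rewrite uact_pi. Qed.

Lemma uactZ (M : glmod) c a (m : M) : uact (c *: a) m = c *: uact a m.
Proof. by rewrite [c *: a]/GRing.scale /= /ualg_scale uactM uact_pi. Qed.

Lemma uact_linr (M : glmod) a c (m m' : M) :
  uact a (c *: m + m') = c *: uact a m + uact a m'.
Proof. exact: ueval_lin. Qed.

Lemma uact0r (M : glmod) a : uact a (0 : M) = 0.
Proof. by have := uact_linr a (-1) (0 : M) 0; rewrite !scaleN1r oppr0 addr0 addNr. Qed.

Lemma gact0r (M : glmod) x : gact x (0 : M) = 0.
Proof. by rewrite -uact_iota uact0r. Qed.

Definition hom_id (M : glmod) : glhom M M := @GlHom M M idfun (fun _ _ => erefl).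

Fact hom_comp_equiv (M N P : glmod) (g : glhom N P) (f : glhom M N) x m :
  (g \o f) (gact x m) = gact x ((g \o f) m).
Proof. by rewrite /= !hequiv. Qed.
Definition hom_comp (M N P : glmod) (g : glhom N P) (f : glhom M N) :
  glhom M P := @GlHom M P (g \o f) (hom_comp_equiv g f).

Fact zero_rep_lin (a : C) : (0 : 'rV[C]_0) = a *: 0 + 0.
Proof. by rewrite scaler0 addr0. Qed.
Fact zero_rep_br : (0 : 'rV[C]_0) = 0 - 0.
Proof. by rewrite subr0. Qed.
Definition zero_mod : glmod :=
  GlMod (@Rep 'rV[C]_0 (fun _ _ => 0)
    (fun a _ _ _ => zero_rep_lin a) (fun _ a _ _ => zero_rep_lin a)
    (fun _ _ _ => zero_rep_br)).

Section DirectSum.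
Variables M N : glmod.
Definition dsum_act (x : 'M[C]_n) (p : (M * N)%type) : (M * N)%type :=
  (gact x p.1, gact x p.2).
Fact dsum_linl a x y w :
  dsum_act (a *: x + y) w = a *: dsum_act x w + dsum_act y w.
Proof. by congr pair; exact: ract_linl. Qed.
Fact dsum_linr x a v w :
  dsum_act x (a *: v + w) = a *: dsum_act x v + dsum_act x w.
Proof. by congr pair; exact: ract_linr. Qed.
Fact dsum_br x y w : dsum_act (x *m y - y *m x) w
  = dsum_act x (dsum_act y w) - dsum_act y (dsum_act x w).
Proof. by congr pair; exact: ract_bracket. Qed.
Definition dsum : glmod := GlMod (Rep dsum_linl dsum_linr dsum_br).
End DirectSum.

Section DirectSumMap.
Variables (M N M' N' : glmod) (f : glhom M M') (g : glhom N N').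
Definition dsum_fun (p : dsum M N) : dsum M' N' := (f p.1, g p.2).
Fact dsum_fun_linear : linear dsum_fun.
Proof. by move=> a p q; congr pair; rewrite linearP. Qed.
HB.instance Definition _ :=
  GRing.isLinear.Build C (dsum M N) (dsum M' N') *:%R dsum_fun dsum_fun_linear.
Fact dsum_fun_equiv x p : dsum_fun (gact x p) = gact x (dsum_fun p).
Proof. by congr pair; rewrite /= hequiv. Qed.
Definition dsum_map : glhom (dsum M N) (dsum M' N') := GlHom dsum_fun_equiv.
End DirectSumMap.

Section Copies.
Variables (k : nat) (M : glmod).
Definition copies_act (x : 'M[C]_n) (f : {ffun 'I_k -> M}) : {ffun 'I_k -> M} :=
  [ffun i => gact x (f i)].
Fact copies_linl a x y w :
  copies_act (a *: x + y) w = a *: copies_act x w + copies_act y w.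
Proof. by apply/ffunP=> i; rewrite !ffunE; exact: ract_linl. Qed.
Fact copies_linr x a v w :
  copies_act x (a *: v + w) = a *: copies_act x v + copies_act x w.
Proof. by apply/ffunP=> i; rewrite !ffunE; exact: ract_linr. Qed.
Fact copies_br x y w : copies_act (x *m y - y *m x) w
  = copies_act x (copies_act y w) - copies_act y (copies_act x w).
Proof. by apply/ffunP=> i; rewrite !ffunE; exact: ract_bracket. Qed.
Definition copies : glmod := GlMod (Rep copies_linl copies_linr copies_br).
End Copies.

Section CopiesMap.
Variables (k : nat) (M N : glmod) (f : glhom M N).
Definition copies_fun (p : copies k M) : copies k N := [ffun i => f (p i)].
Fact copies_fun_linear : linear copies_fun.
Proof. by move=> a p q; apply/ffunP=> i; rewrite !ffunE linearP. Qed.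
HB.instance Definition _ := GRing.isLinear.Build C (copies k M) (copies k N)
  *:%R copies_fun copies_fun_linear.
Fact copies_fun_equiv x p : copies_fun (gact x p) = gact x (copies_fun p).
Proof. by apply/ffunP=> i; rewrite !ffunE hequiv. Qed.
Definition copies_map : glhom (copies k M) (copies k N) :=
  GlHom copies_fun_equiv.
End CopiesMap.

Fact tens_aux (M : zmodType) (a b p q s t : M) :
  a - b + (s - t) = a + p + q + s - (b + q + p + t).
Proof.
have -> : a + p + q + s = (p + q) + (a + s).
  by rewrite -(addrA a) (addrC a) -(addrA _ a).
have -> : b + q + p + t = (p + q) + (b + t).
  by rewrite -(addrA b) (addrC b) (addrC q) -(addrA _ b).
by rewrite opprD [RHS]addrACA subrr add0r opprD addrACA.
Qed.

(* V (x) M for V finite-dimensional with basis b_i = (vbasis {:V})`_i: the     *)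
(* function f stands for \sum_i b_i (x) f i.                                   *)
Section Tensor.
Variables (V : vectType C) (rV : rep V).
Notation k := (\dim {:V}).
Notation b := (vbasis {:V}).

Definition rcoef (x : 'M[C]_n) (j i : 'I_k) : C := coord b j (rV x b`_i).

Fact ract_coord x v : rV x v = \sum_i coord b i v *: rV x b`_i.
Proof.
have rsum (I : finType) (c : I -> C) (w : I -> V) :
    rV x (\sum_i c i *: w i) = \sum_i c i *: rV x (w i).
  have r0 : rV x 0 = 0.
    have := ract_linr rV x (-1) 0 0.
    by rewrite !scaleN1r oppr0 addr0 addNr.
  apply: (big_ind2 (fun p q => rV x p = q)) => //.
  - move=> p p' q q' <- <-.
    by have := ract_linr rV x 1 p q; rewrite !scale1r.
  - by move=> i _; have := ract_linr rV x (c i) (w i) 0; rewrite !addr0 r0 addr0.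
by rewrite {1}[v](coord_vbasis (memvf v)) rsum.
Qed.

Fact rcoefM x y (j i : 'I_k) :
  coord b j (rV x (rV y b`_i)) = \sum_l rcoef x j l * rcoef y l i.
Proof.
rewrite ract_coord linear_sum; apply: eq_bigr => l _.
by rewrite linearZ /= mulrC.
Qed.

Variable M : glmod.

Definition tens_act (x : 'M[C]_n) (f : {ffun 'I_k -> M}) : {ffun 'I_k -> M} :=
  [ffun j => gact x (f j) + \sum_i rcoef x j i *: f i].

Fact tens_linl a x y w :
  tens_act (a *: x + y) w = a *: tens_act x w + tens_act y w.
Proof.
apply/ffunP=> j; rewrite !ffunE [gact _ _]ract_linl -!/(gact _ _).
rewrite (eq_bigr (fun i => a *: (rcoef x j i *: w i) + rcoef y j i *: w i)).
  rewrite big_split /= -scaler_sumr [in RHS]scalerDr -!addrA; congr (_ + _).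
  by rewrite addrCA.
by move=> i _; rewrite /rcoef ract_linl linearP scalerDl scalerA.
Qed.
Fact tens_linr x a v w :
  tens_act x (a *: v + w) = a *: tens_act x v + tens_act x w.
Proof.
apply/ffunP=> j; rewrite !ffunE [gact _ _]ract_linr -!/(gact _ _).
rewrite (eq_bigr (fun i => a *: (rcoef x j i *: v i) + rcoef x j i *: w i)).
  rewrite big_split /= -scaler_sumr [in RHS]scalerDr -!addrA; congr (_ + _).
  by rewrite addrCA.
by move=> i _; rewrite !ffunE scalerDr !scalerA mulrC.
Qed.
Fact tens_br x y w : tens_act (x *m y - y *m x) w
  = tens_act x (tens_act y w) - tens_act y (tens_act x w).
Proof.
have gsum z (c : 'I_k -> C) :
    gact z (\sum_i c i *: w i) = \sum_i c i *: gact z (w i).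
  apply: (big_ind2 (fun p q => gact z p = q)); first exact: gact0r.
  - move=> p p' q q' <- <-.
    by have := ract_linr (glrep M) z 1 p q; rewrite !scale1r.
  - move=> i _; have := ract_linr (glrep M) z (c i) (w i) 0.
    by rewrite !addr0 -!/(gact _ _) gact0r addr0.
have gD z (p q : M) : gact z (p + q) = gact z p + gact z q.
  by have := ract_linr (glrep M) z 1 p q; rewrite !scale1r.
have expand z t j : tens_act z (tens_act t w) j =
    gact z (gact t (w j)) + \sum_i rcoef t j i *: gact z (w i)
    + \sum_i rcoef z j i *: gact t (w i)
    + \sum_i (\sum_l rcoef z j l * rcoef t l i) *: w i.
  rewrite !ffunE gD gsum -!addrA; congr (_ + (_ + _)).
  rewrite (eq_bigr (fun i => rcoef z j i *: gact t (w i)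
      + rcoef z j i *: \sum_l rcoef t i l *: w l)); last first.
    by move=> i _; rewrite ffunE scalerDr.
  rewrite big_split /=; congr (_ + _).
  under eq_bigr do rewrite scaler_sumr.
  rewrite exchange_big /=; apply: eq_bigr => i _; rewrite scaler_suml.
  by apply: eq_bigr => l _; rewrite scalerA.
apply/ffunP=> j.
have sE (p q : {ffun 'I_k -> M}) : (p - q) j = p j - q j by rewrite !ffunE.
rewrite sE !expand ffunE [gact (_ - _) _]ract_bracket -!/(gact _ _).
rewrite (eq_bigr (fun i => (\sum_l rcoef x j l * rcoef y l i) *: w i
    - (\sum_l rcoef y j l * rcoef x l i) *: w i)); last first.
  move=> i _; rewrite -!rcoefM -scalerBl; congr (_ *: _).
  by rewrite /rcoef ract_bracket linearB.
rewrite sumrB; exact: tens_aux.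
Qed.
Definition tens : glmod := GlMod (Rep tens_linl tens_linr tens_br).
End Tensor.
End Modules.

Section TensorMap.
Variables (C : fieldType) (n : nat) (V : vectType C) (rV : rep n V).
Variables (M N : glmod C n) (f : glhom M N).
Definition tens_fun (p : tens rV M) : tens rV N := [ffun i => f (p i)].
Fact tens_fun_linear : linear tens_fun.
Proof. by move=> a p q; apply/ffunP=> i; rewrite !ffunE linearP. Qed.
HB.instance Definition _ := GRing.isLinear.Build C (tens rV M) (tens rV N)
  *:%R tens_fun tens_fun_linear.
Fact tens_fun_equiv x p : tens_fun (gact x p) = gact x (tens_fun p).
Proof.
apply/ffunP=> j; rewrite !ffunE linearD hequiv linear_sum /=.
by congr (_ + _); apply: eq_bigr => i _; rewrite linearZ ffunE.
Qed.
Definition tens_map : glhom (tens rV M) (tens rV N) := GlHom tens_fun_equiv.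
End TensorMap.

Section FiniteDimensional.
Variables (C : fieldType) (n : nat).

(* Matrix representations, acting on column vectors. *)
Record mxrep (k : nat) := MxRep {
  rmx :> 'M[C]_n -> 'M[C]_k;
  rmx_lin : linear rmx;
  rmx_br : forall x y, rmx (x *m y - y *m x) = rmx x *m rmx y - rmx y *m rmx x }.

Definition L_mxrep : mxrep n :=
  @MxRep n id (fun _ _ _ => erefl) (fun _ _ => erefl).

Section Square.
Variables (k : nat) (r : mxrep k).

Definition dual_mx (x : 'M[C]_n) : 'M[C]_k := - (r x)^T.
Fact dual_lin : linear dual_mx.
Proof.
by move=> a x y; rewrite /dual_mx rmx_lin linearP /= opprD scalerN.
Qed.
Fact dual_br x y :
  dual_mx (x *m y - y *m x) = dual_mx x *m dual_mx y - dual_mx y *m dual_mx x.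
Proof.
rewrite /dual_mx rmx_br !mulmxN !mulNmx !opprK linearB /= !trmx_mul.
by rewrite opprB.
Qed.
Definition dual_mxrep : mxrep k := MxRep dual_lin dual_br.

Fact col_linl a x y (v : 'cV[C]_k) :
  r (a *: x + y) *m v = a *: (r x *m v) + r y *m v.
Proof. by rewrite rmx_lin mulmxDl scalemxAl. Qed.
Fact col_linr x a (v w : 'cV[C]_k) :
  r x *m (a *: v + w) = a *: (r x *m v) + r x *m w.
Proof. by rewrite mulmxDr scalemxAr. Qed.
Fact col_br x y (v : 'cV[C]_k) :
  r (x *m y - y *m x) *m v = r x *m (r y *m v) - r y *m (r x *m v).
Proof. by rewrite rmx_br mulmxBl !mulmxA. Qed.
Definition col_rep : rep n 'cV[C]_k := Rep col_linl col_linr col_br.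

(* The tensor square, with v (x) w encoded as the matrix v *m w^T: the swap    *)
(* is then transposition.                                                      *)
Definition sq_act (x : 'M[C]_n) (A : 'M[C]_k) : 'M[C]_k :=
  r x *m A + A *m (r x)^T.
Fact sq_linl a x y A : sq_act (a *: x + y) A = a *: sq_act x A + sq_act y A.
Proof.
rewrite /sq_act rmx_lin linearP /= mulmxDl mulmxDr scalerDr.
by rewrite -scalemxAl -scalemxAr addrACA.
Qed.
Fact sq_linr x a A B : sq_act x (a *: A + B) = a *: sq_act x A + sq_act x B.
Proof.
rewrite /sq_act mulmxDl mulmxDr scalerDr.
by rewrite -scalemxAl -scalemxAr addrACA.
Qed.
Fact sq_br x y A :
  sq_act (x *m y - y *m x) A = sq_act x (sq_act y A) - sq_act y (sq_act x A).
Proof.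
rewrite /sq_act rmx_br linearB /= !trmx_mul mulmxBl mulmxBr !mulmxDr !mulmxDl.
rewrite !mulmxA.
set a := _ *m r y *m A; set b := _ *m r x *m A.
set c := A *m _ *m _; set d := A *m _ *m _.
set p := r x *m A *m _; set q := r y *m A *m _.
by have := tens_aux a b p q c d; rewrite !addrA => ->.
Qed.

Fact sq_tr x A : (sq_act x A)^T = sq_act x A^T.
Proof. by rewrite /sq_act linearD /= !trmx_mul trmxK addrC. Qed.

Definition sym_space : {vspace 'M[C]_k} := fixedSpace (linfun trmx).
Definition alt_space : {vspace 'M[C]_k} := fixedSpace (linfun (-%R \o trmx)).

Lemma mem_symP A : reflect (A^T = A) (A \in sym_space).
Proof. by apply: (iffP fixedSpaceP); rewrite lfunE. Qed.
Lemma mem_altP A : reflect (A^T = - A) (A \in alt_space).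
Proof.
apply: (iffP fixedSpaceP); rewrite lfunE /=; last by move=> ->; rewrite opprK.
by move=> {2}<-; rewrite opprK.
Qed.
End Square.

Section SubRep.
Variables (V : vectType C) (r : rep n V) (U : {vspace V}).
Hypothesis stabU : forall x v, v \in U -> r x v \in U.

Definition subrep_act (x : 'M[C]_n) (u : subvs_of U) : subvs_of U :=
  vsproj U (r x (vsval u)).
Fact subrep_actE x u : vsval (subrep_act x u) = r x (vsval u).
Proof. by rewrite /subrep_act vsprojK // stabU // subvsP. Qed.
Fact subrep_linl a x y u :
  subrep_act (a *: x + y) u = a *: subrep_act x u + subrep_act y u.
Proof. by apply: val_inj; rewrite linearP /= !subrep_actE ract_linl. Qed.
Fact subrep_linr x a u v :
  subrep_act x (a *: u + v) = a *: subrep_act x u + subrep_act x v.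
Proof. by apply: val_inj; rewrite linearP /= !subrep_actE linearP ract_linr. Qed.
Fact subrep_br x y u : subrep_act (x *m y - y *m x) u
  = subrep_act x (subrep_act y u) - subrep_act y (subrep_act x u).
Proof. by apply: val_inj; rewrite linearB /= !subrep_actE ract_bracket. Qed.
Definition subrep : rep n (subvs_of U) :=
  Rep subrep_linl subrep_linr subrep_br.
End SubRep.

Section SymAlt.
Variables (k : nat) (r : mxrep k).
Definition sq_rep : rep n 'M[C]_k := Rep (sq_linl r) (sq_linr r) (sq_br r).

Fact sym_stable x A : A \in sym_space k -> sq_rep x A \in sym_space k.
Proof. by move=> /mem_symP AT; apply/mem_symP; rewrite sq_tr AT. Qed.
Fact alt_stable x A : A \in alt_space k -> sq_rep x A \in alt_space k.
Proof.
move=> /mem_altP AT; apply/mem_altP; rewrite sq_tr AT.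
by rewrite /= /sq_act mulmxN mulNmx opprD.
Qed.
Definition Sym2 : rep n (subvs_of (sym_space k)) := subrep sym_stable.
Definition Alt2 : rep n (subvs_of (alt_space k)) := subrep alt_stable.
End SymAlt.

End FiniteDimensional.

Section SubQuotient.
Variables (C : fieldType) (n : nat) (M : glmod C n).

Record submodule := SubModule {
  subP : {pred M};
  sub_closed : submod_closed subP;
  sub_stable : forall x m, m \in subP -> gact x m \in subP }.

Variable S : submodule.

HB.instance Definition _ := GRing.isSubmodClosed.Build C M (subP S)
  (sub_closed S).

Record sub_car := SubCar { sub_val : M; sub_valP : sub_val \in subP S }.
HB.instance Definition _ := [isSub for sub_val].
HB.instance Definition _ := [Choice of sub_car by <:].
HB.instance Definition _ := [SubChoice_isSubLmodule of sub_car by <:].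

Definition sub_act (x : 'M[C]_n) (m : sub_car) : sub_car :=
  SubCar (sub_stable x (sub_valP m)).
Fact sub_linl a x y m : sub_act (a *: x + y) m = a *: sub_act x m + sub_act y m.
Proof. by apply: val_inj; rewrite linearP /=; exact: ract_linl. Qed.
Fact sub_linr x a m m' :
  sub_act x (a *: m + m') = a *: sub_act x m + sub_act x m'.
Proof.
apply: val_inj; rewrite linearP /=; rewrite -[RHS]ract_linr.
by congr (glrep M x _); exact: linearP.
Qed.
Fact sub_br x y m : sub_act (x *m y - y *m x) m
  = sub_act x (sub_act y m) - sub_act y (sub_act x m).
Proof. by apply: val_inj; rewrite linearB /=; exact: ract_bracket. Qed.
Definition sub_mod : glmod C n := GlMod (Rep sub_linl sub_linr sub_br).

Definition quot_car := Quotient.quot (subP S).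
HB.instance Definition _ := GRing.Zmodule.on quot_car.
HB.instance Definition _ := EqQuotient.on quot_car.

Lemma quotP (m m' : M) :
  (\pi_quot_car m = \pi_quot_car m') <-> m - m' \in subP S.
Proof. by rewrite Quotient.idealrBE; split=> [->|/eqP]. Qed.

Lemma pi_quotD (m m' : M) :
  \pi_quot_car (m + m') = \pi_quot_car m + \pi_quot_car m'.
Proof. exact: Quotient.pi_add. Qed.

Lemma repr_quot (m : M) : repr (\pi_quot_car m) - m \in subP S.
Proof. by apply/quotP; rewrite reprK. Qed.

Definition quot_scale (c : C) (q : quot_car) : quot_car :=
  \pi_quot_car (c *: repr q).
Lemma pi_quotZ c m : quot_scale c (\pi_quot_car m) = \pi_quot_car (c *: m).
Proof. by apply/quotP; rewrite -scalerBr rpredZ // repr_quot. Qed.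

Let quot_ind (P : quot_car -> Prop) :
  (forall m, P (\pi_quot_car m)) -> forall q, P q.
Proof. by move=> H q; rewrite -[q]reprK. Qed.

Fact quot_scaleA a b v : quot_scale a (quot_scale b v) = quot_scale (a * b) v.
Proof. by elim/quot_ind: v => v; rewrite !pi_quotZ scalerA. Qed.
Fact quot_scale1 : left_id 1 quot_scale.
Proof. by elim/quot_ind=> v; rewrite pi_quotZ scale1r. Qed.
Fact quot_scaleDr : right_distributive quot_scale +%R.
Proof.
move=> a; elim/quot_ind=> u; elim/quot_ind=> v.
by rewrite -pi_quotD !pi_quotZ scalerDr pi_quotD.
Qed.
Fact quot_scaleDl v : {morph quot_scale^~ v : a b / a + b >-> a + b}.
Proof.
by move=> a b; elim/quot_ind: v => v; rewrite !pi_quotZ scalerDl pi_quotD.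
Qed.
HB.instance Definition _ := GRing.Zmodule_isLmodule.Build C quot_car
  quot_scaleA quot_scale1 quot_scaleDr quot_scaleDl.

Definition quot_act (x : 'M[C]_n) (q : quot_car) : quot_car :=
  \pi_quot_car (gact x (repr q)).
Lemma pi_quot_act x m : quot_act x (\pi_quot_car m) = \pi_quot_car (gact x m).
Proof.
apply/quotP.
have -> : gact x (repr (\pi_quot_car m)) - gact x m =
    gact x (repr (\pi_quot_car m) - m).
  have := ract_linr (glrep M) x (-1) m (repr (\pi_quot_car m)).
  by rewrite !scaleN1r ![- _ + _]addrC.
exact/sub_stable/repr_quot.
Qed.
Let piZ c m : \pi_quot_car (c *: m) = c *: \pi_quot_car m.
Proof. exact: esym (pi_quotZ c m). Qed.

Fact quot_linl a x y q :
  quot_act (a *: x + y) q = a *: quot_act x q + quot_act y q.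
Proof.
elim/quot_ind: q => m; rewrite !pi_quot_act -piZ -pi_quotD.
by rewrite /gact ract_linl.
Qed.
Fact quot_linr x a q q' :
  quot_act x (a *: q + q') = a *: quot_act x q + quot_act x q'.
Proof.
elim/quot_ind: q => m; elim/quot_ind: q' => m'.
rewrite -piZ -pi_quotD !pi_quot_act -piZ -pi_quotD.
by rewrite /gact ract_linr.
Qed.
Fact quot_br x y q : quot_act (x *m y - y *m x) q
  = quot_act x (quot_act y q) - quot_act y (quot_act x q).
Proof.
elim/quot_ind: q => m; rewrite !pi_quot_act.
have piN m' : \pi_quot_car (- m') = - \pi_quot_car m'.
  exact: Quotient.pi_opp.
rewrite -piN -pi_quotD.
by rewrite /gact ract_bracket.
Qed.
Definition quot_mod : glmod C n := GlMod (Rep quot_linl quot_linr quot_br).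

End SubQuotient.

(* A weight la is the row vector of the values la(E_ii). *)
Section Verma.
Variables (C : fieldType) (n : nat).
Notation U := (Ualg C n).

Fact reg_linl a (x y : 'M[C]_n) (w : U) :
  iota_U (a *: x + y) * w = a *: (iota_U x * w) + iota_U y * w.
Proof. by rewrite linearP mulrDl scalerAl. Qed.
Fact reg_linr (x : 'M[C]_n) a (v w : U) :
  iota_U x * (a *: v + w) = a *: (iota_U x * v) + iota_U x * w.
Proof. by rewrite mulrDr scalerAr. Qed.
Fact reg_br (x y : 'M[C]_n) (w : U) :
  iota_U (x *m y - y *m x) * w = iota_U x * (iota_U y * w) -
                                iota_U y * (iota_U x * w).
Proof. by rewrite iota_U_bracket mulrBl !mulrA. Qed.
Definition regular_mod : glmod C n := GlMod (Rep reg_linl reg_linr reg_br).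

Variable la : 'rV[C]_n.

(* The left ideal generated by n_+ and the h - la(h), h in the Cartan.         *)
Definition verma_ideal : {pred U} := fun u => `[<
  exists (a : 'I_n -> 'I_n -> U) (b : 'I_n -> U),
    u = \sum_(i < n) \sum_(j < n | (i < j)%N) a i j * iota_U (delta_mx i j)
      + \sum_(i < n) b i * (iota_U (delta_mx i i) - (la 0 i)%:A) >].

Fact verma_ideal_mul c u : u \in verma_ideal -> c * u \in verma_ideal.
Proof.
move=> /asboolP [a [b ->]]; apply/asboolP.
exists (fun i j => c * a i j), (fun i => c * b i).
rewrite mulrDr !mulr_sumr; congr (_ + _); apply: eq_bigr => i _.
  by rewrite mulr_sumr; apply: eq_bigr => j _; rewrite mulrA.
by rewrite mulrA.
Qed.

Fact verma_ideal_closed : submod_closed (verma_ideal : {pred regular_mod}).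
Proof.
split.
  apply/asboolP; exists (fun _ _ => 0), (fun _ => 0).
  rewrite big1 ?add0r ?big1 // => i _; rewrite ?mul0r //.
  by rewrite big1 // => j _; rewrite mul0r.
move=> c u v uJ /asboolP [a' [b' ->]].
have : c%:A * u \in verma_ideal by exact: verma_ideal_mul.
rewrite mulr_algl => /asboolP [a [b ->]]; apply/asboolP.
exists (fun i j => a i j + a' i j), (fun i => b i + b' i).
rewrite addrACA; congr (_ + _); rewrite -big_split; apply: eq_bigr => i _ /=.
  by rewrite -big_split; apply: eq_bigr => j _; rewrite mulrDl.
by rewrite mulrDl.
Qed.

Definition verma : glmod C n :=
  quot_mod (SubModule verma_ideal_closed
    (fun x m mJ => verma_ideal_mul (iota_U x) mJ)).

(* The scalar by which z acts; only meaningful on central z.                   *)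
Definition central_char (z : U) : C :=
  xget 0 [set c : C | forall m : verma, uact z m = c *: m]%classic.

End Verma.

Section Component.
Variables (C : fieldType) (n : nat).
Notation U := (Ualg C n).

Lemma hom_uact (M N : glmod C n) (f : glhom M N) u m :
  f (uact u m) = uact u (f m).
Proof.
rewrite /uact; elim: (repr u) m => //= [c|x|t iht v ihv|t iht v ihv] m.
- by rewrite linearZ.
- by rewrite hequiv.
- by rewrite linearD iht ihv.
- by rewrite iht ihv.
Qed.

Variable th : U -> C.

Definition loc_nilp (M : glmod C n) (m : M) : Prop :=
  forall z : U, Ucentral z -> exists k, uact ((z - (th z)%:A) ^+ k) m = 0.

Variable M : glmod C n.
Definition comp_pred : {pred M} := fun m => `[< loc_nilp m >].

Fact comp_closed : submod_closed comp_pred.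
Proof.
split; first by apply/asboolP => z _; exists 0%N; rewrite uact0r.
move=> c m m' /asboolP hm /asboolP hm'; apply/asboolP => z zc.
have [k hk] := hm z zc; have [l hl] := hm' z zc; exists (k + l)%N.
by rewrite uact_linr {1}addnC !exprD !uactM hk hl !uact0r scaler0 addr0.
Qed.

Fact comp_stable x m : m \in comp_pred -> gact x m \in comp_pred.
Proof.
move=> /asboolP hm; apply/asboolP => z zc; have [k hk] := hm z zc; exists k.
rewrite -uact_iota -uactM.
have xz : GRing.comm (iota_U x) (z - (th z)%:A).
  by rewrite /GRing.comm mulrBl mulrBr zc mulr_algl mulr_algr.
by rewrite -(commrX k xz) uactM hk uact0r.
Qed.

Definition comp_sub : submodule M := SubModule comp_closed comp_stable.
Definition proj_mod : glmod C n := sub_mod comp_sub.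
End Component.

Section ComponentMap.
Variables (C : fieldType) (n : nat) (th : Ualg C n -> C).
Variables (M N : glmod C n) (f : glhom M N).

Fact comp_map_proof (m : proj_mod th M) : f (val m) \in @comp_pred C n th N.
Proof.
apply/asboolP => z zc; have /asboolP/(_ z zc) [k hk] := valP m.
by exists k; rewrite -hom_uact hk linear0.
Qed.
Definition comp_fun (m : proj_mod th M) : proj_mod th N :=
  @SubCar C n N (comp_sub th N) (f (val m)) (comp_map_proof m).
Fact comp_fun_linear : linear comp_fun.
Proof. by move=> a m m'; apply: val_inj; rewrite /= !linearP. Qed.
HB.instance Definition _ := GRing.isLinear.Build C (proj_mod th M)
  (proj_mod th N) *:%R comp_fun comp_fun_linear.
Fact comp_fun_equiv x m : comp_fun (gact x m) = gact x (comp_fun m).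
Proof. by apply: val_inj; rewrite /= hequiv. Qed.
Definition proj_map : glhom (proj_mod th M) (proj_mod th N) :=
  GlHom comp_fun_equiv.
End ComponentMap.

Section CategoryO.
Variables (C : fieldType) (n : nat).

Definition weight_vector (M : glmod C n) (m : M) : Prop :=
  exists mu : 'rV[C]_n, forall i, gact (delta_mx i i) m = mu 0 i *: m.

Definition fin_gen (M : glmod C n) : Prop :=
  exists s : seq M, forall m : M, exists u : nat -> Ualg C n,
    m = \sum_(i < size s) uact (u i) s`_i.

Definition h_semisimple (M : glmod C n) : Prop :=
  forall m : M, exists s : seq M,
    (forall v, v \in s -> weight_vector v) /\ m = \sum_(v <- s) v.

(* U(n_+) m is finite-dimensional, U(n_+) being spanned by the products of     *)
(* the e_ij, i < j.                                                            *)
Definition n_locally_finite (M : glmod C n) : Prop :=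
  forall m : M, exists s : seq M, forall w : seq ('I_n * 'I_n),
    all (fun p : 'I_n * 'I_n => (p.1 < p.2)%N) w -> exists c : nat -> C,
      uact (\prod_(p <- w) iota_U (delta_mx p.1 p.2)) m
        = \sum_(i < size s) c i *: s`_i.

Definition inO (M : glmod C n) : Prop :=
  [/\ fin_gen M, h_semisimple M & n_locally_finite M].

Definition inO_char (th : Ualg C n -> C) (M : glmod C n) : Prop :=
  inO M /\ forall m : M, loc_nilp th m.

End CategoryO.

Section Functors.
Variables (C : fieldType) (n : nat).
Notation glmod := (glmod C n).

Lemma glhomP (M N : glmod) (f g : glhom M N) : f =1 g -> f = g.
Proof.
case: f g => [[f F] hf] [[g G] hg] /= /funext fg.
move: F hf; rewrite fg => F hf.
have FG : F = G.
  case: F G {hf hg} => [[F1] [F2]] [[G1] [G2]].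
  by rewrite (Prop_irrelevance F1 G1) (Prop_irrelevance F2 G2).
by move: hf; rewrite FG => hf; rewrite (Prop_irrelevance hf hg).
Qed.

Record gfun := GFun {
  gobj :> glmod -> glmod;
  gmap : forall M N, glhom M N -> glhom (gobj M) (gobj N);
  gmap_id : forall M, gmap (hom_id M) = hom_id (gobj M);
  gmap_comp : forall M N P (g : glhom N P) (f : glhom M N),
    gmap (hom_comp g f) = hom_comp (gmap g) (gmap f) }.

Definition F_zero : gfun.
Proof.
refine (@GFun (fun _ => zero_mod C n) (fun _ _ _ => hom_id _) _ _).
- by [].
- by move=> *; apply: glhomP.
Defined.

Fact F_copies_id k (M : glmod) : copies_map k (hom_id M) = hom_id (copies k M).
Proof. by apply: glhomP => m; apply/ffunP=> i; rewrite ffunE. Qed.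
Fact F_copies_comp k (M N P : glmod) (g : glhom N P) (f : glhom M N) :
  copies_map k (hom_comp g f) = hom_comp (copies_map k g) (copies_map k f).
Proof. by apply: glhomP => m; apply/ffunP=> i; rewrite !ffunE. Qed.
Definition F_copies k : gfun := GFun (@F_copies_id k) (@F_copies_comp k).

Section FTensor.
Variables (V : vectType C) (rV : rep n V).
Fact F_tens_id (M : glmod) : tens_map rV (hom_id M) = hom_id (tens rV M).
Proof. by apply: glhomP => m; apply/ffunP=> i; rewrite ffunE. Qed.
Fact F_tens_comp (M N P : glmod) (g : glhom N P) (f : glhom M N) :
  tens_map rV (hom_comp g f) = hom_comp (tens_map rV g) (tens_map rV f).
Proof. by apply: glhomP => m; apply/ffunP=> i; rewrite !ffunE. Qed.
Definition F_tens : gfun := GFun F_tens_id F_tens_comp.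
End FTensor.

Section FProj.
Variable th : Ualg C n -> C.
Fact F_proj_id (M : glmod) : proj_map th (hom_id M) = hom_id (proj_mod th M).
Proof. by apply: glhomP => m; exact: val_inj. Qed.
Fact F_proj_comp (M N P : glmod) (g : glhom N P) (f : glhom M N) :
  proj_map th (hom_comp g f) = hom_comp (proj_map th g) (proj_map th f).
Proof. by apply: glhomP => m; exact: val_inj. Qed.
Definition F_proj : gfun := GFun F_proj_id F_proj_comp.
End FProj.

Section FComp.
Variables G F : gfun.
Fact F_comp_id (M : glmod) : gmap G (gmap F (hom_id M)) = hom_id (G (F M)).
Proof. by rewrite !gmap_id. Qed.
Fact F_comp_comp (M N P : glmod) (g : glhom N P) (f : glhom M N) :
  gmap G (gmap F (hom_comp g f))
    = hom_comp (gmap G (gmap F g)) (gmap G (gmap F f)).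
Proof. by rewrite !gmap_comp. Qed.
Definition F_comp : gfun := @GFun (fun M => G (F M))
  (fun M N f => gmap G (gmap F f)) F_comp_id F_comp_comp.
End FComp.

End Functors.

(* Integer 8-tuples; d_i^j is [shift d i j].                                   *)
Definition idx := {ffun 'I_8 -> int}.

Definition entry (d : idx) (k : nat) : int := d (inord k).

Definition shift (d : idx) (i j : nat) : idx :=
  [ffun k : 'I_8 => d k - (k == i :> nat)%:Z + (k == j :> nat)%:Z].

Definition inD (n : nat) (d : idx) : bool :=
  [forall k, 0 <= d k] && (\sum_k d k == n%:Z).

Definition c_ (i : nat) (d : idx) : int :=
  let d_ (k : nat) := entry d k in
  match i with
  | 1%N => d_ 5%N + d_ 4%N - d_ 3%N - d_ 2%N
  | 2%N => d_ 6%N - d_ 5%N + d_ 2%N - d_ 1%N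
  | 3%N => d_ 7%N - d_ 6%N + d_ 5%N - d_ 4%N + d_ 3%N - d_ 2%N + d_ 1%N - d_ 0%N
  | _ => 0
  end.

Definition sim (d d' : idx) : Prop :=
  let q1 d := let d_ (k : nat) := entry d k in
    d_ 7%N + d_ 6%N + d_ 5%N + d_ 4%N - d_ 3%N - d_ 2%N - d_ 1%N - d_ 0%N in
  let q2 d := let d_ (k : nat) := entry d k in
    d_ 7%N + d_ 6%N - d_ 5%N - d_ 4%N + d_ 3%N + d_ 2%N - d_ 1%N - d_ 0%N in
  let q3 d := let d_ (k : nat) := entry d k in
    d_ 7%N - d_ 6%N + d_ 5%N - d_ 4%N + d_ 3%N - d_ 2%N + d_ 1%N - d_ 0%N in
  [/\ q1 d = q1 d', q2 d = q2 d' & q3 d = q3 d'].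

Lemma c_sim i d d' : sim d d' -> c_ i d = c_ i d'.
Proof.
by case=> h1 h2 h3; case: i => [|[|[|[|i]]]] //; rewrite /c_; lia.
Qed.

Section CategoryOn.
Variables (C : fieldType) (n : nat).
Notation glmod := (glmod C n).
Notation gfun := (gfun C n).

(* eps p is epsilon_{p+1}: indices start at 0.                                 *)
Definition eps (p : nat) : 'rV[C]_n := \row_m (m == p :> nat)%:R.

Definition rho : 'rV[C]_n :=
  2^-1 *: \sum_(i < n) \sum_(j < n | (i < j)%N) (eps i - eps j).

Definition lambda_ (d : idx) : 'rV[C]_n :=
  \sum_(i < 8) \sum_(j < `|d i|%N)
    (i : nat)%:R *: eps (\sum_(k < 8 | (k < i)%N) `|d k| + j)%N.

Definition theta_ (d : idx) : Ualg C n -> C := central_char (lambda_ d - rho).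

Definition inO_ (d : idx) (M : glmod) : Prop :=
  if inD n d then inO_char (theta_ d) M else forall m : M, m = 0.

(* An object of O^n is the family of its components in the O_d; it vanishes    *)
(* outside D. As D is the disjoint union of its ~-classes, summing first over  *)
(* the d' in [d] and then over the classes [d] amounts to summing over D: O^n  *)
(* and the functors below are indexed by D directly (for H_i([d]), defined on  *)
(* O_[d] from |c_i(d)|, this uses c_sim).                                      *)
Definition family := idx -> glmod.
Definition famhom (M N : family) := forall d, glhom (M d) (N d).
Definition inOn (M : family) : Prop := forall d, inO_ d (M d).

Record On := OnObj { ofam :> family; ofamP : inOn ofam }.

Definition ses (A B D : family) (f : famhom A B) (g : famhom B D) : Prop :=
  forall d, [/\ injective (f d), (forall x, exists y, g d y = x)
    & forall y, g d y = 0 <-> exists x, f d x = y].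

Record famfun := FamFun {
  fobj :> family -> family;
  fmap : forall M N, famhom M N -> famhom (fobj M) (fobj N);
  fmap_id : forall M d, fmap (fun d => hom_id (M d)) d = hom_id (fobj M d);
  fmap_comp : forall M N P (g : famhom N P) (f : famhom M N) d,
    fmap (fun d => hom_comp (g d) (f d)) d = hom_comp (fmap g d) (fmap f d) }.

(* Restricts to an exact functor O^n -> O^n (which is a full subcategory).     *)
Record exact_On (F : famfun) : Prop := ExactOn {
  On_stable : forall M, inOn M -> inOn (F M);
  On_exact : forall (A B D : On) (f : famhom A B) (g : famhom B D),
    ses f g -> ses (fmap F f) (fmap F g) }.

(* The direct sum of functors G d from the d-component to the s-component,     *)
(* where d = src s is the only index contributing to s.                        *)
Section Collect.
Variables (src : idx -> idx) (G : idx -> gfun).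
Definition collect_obj (M : family) : family := fun s => G (src s) (M (src s)).
Definition collect_map M N (f : famhom M N) :
  famhom (collect_obj M) (collect_obj N) := fun s => gmap (G (src s)) (f (src s)).
Definition collect : famfun :=
  @FamFun collect_obj collect_map
    (fun M s => gmap_id (G (src s)) (M (src s)))
    (fun M N P g f s => gmap_comp (G (src s)) (g (src s)) (f (src s))).
End Collect.

Section FamSum.
Variables F G : famfun.
Definition famsum_obj (M : family) : family := fun s => dsum (F M s) (G M s).
Definition famsum_map M N (f : famhom M N) :
  famhom (famsum_obj M) (famsum_obj N) := fun s => dsum_map (fmap F f s) (fmap G f s).
Fact famsum_id M s :
  famsum_map (fun d => hom_id (M d)) s = hom_id (famsum_obj M s).
Proof. by apply: glhomP => -[x y]; congr pair; rewrite /= fmap_id. Qed.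
Fact famsum_comp M N P (g : famhom N P) (f : famhom M N) s :
  famsum_map (fun d => hom_comp (g d) (f d)) s
    = hom_comp (famsum_map g s) (famsum_map f s).
Proof. by apply: glhomP => -[x y]; congr pair; rewrite /= fmap_comp. Qed.
Definition famsum : famfun := FamFun famsum_id famsum_comp.
End FamSum.

(* The functor O_d -> O_{d_i^j}, proj o F_V.                                   *)
Definition translation (V : vectType C) (rV : rep n V) (i j : nat) (d : idx) :
    gfun :=
  if inD n (shift d i j)
  then F_comp (F_proj (theta_ (shift d i j))) (F_tens rV)
  else F_zero C n.

Definition translations (V : vectType C) (rV : rep n V) (i j : nat) : famfun :=
  collect (fun s => shift s j i) (translation rV i j).

Notation L := (L_mxrep C n).
Notation Ldual := (dual_mxrep L).

Definition H_plus (i : nat) : famfun :=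
  collect id (fun d => if sgz (c_ i d) \in [:: 0; 1 : int]
                       then F_copies C n `|c_ i d|%N else F_zero C n).
Definition H_minus (i : nat) : famfun :=
  collect id (fun d => if sgz (c_ i d) == -1
                       then F_copies C n `|c_ i d|%N else F_zero C n).

Definition E1_plus : famfun :=
  famsum (translations (Sym2 L) 2 4) (translations (Sym2 L) 3 5).
Definition E1_minus : famfun :=
  famsum (translations (Alt2 L) 2 4) (translations (Alt2 L) 3 5).
Definition E2 : famfun :=
  famsum (translations (col_rep L) 1 2) (translations (col_rep L) 5 6).
Definition E3 : famfun :=
  famsum (famsum (translations (col_rep L) 0 1) (translations (col_rep L) 2 3))
         (famsum (translations (col_rep L) 4 5) (translations (col_rep L) 6 7)).

Definition F1_plus : famfun :=
  famsum (translations (Sym2 Ldual) 4 2) (translations (Sym2 Ldual) 5 3).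
Definition F1_minus : famfun :=
  famsum (translations (Alt2 Ldual) 4 2) (translations (Alt2 Ldual) 5 3).
Definition F2 : famfun :=
  famsum (translations (col_rep Ldual) 2 1) (translations (col_rep Ldual) 6 5).
Definition F3 : famfun :=
  famsum
    (famsum (translations (col_rep Ldual) 1 0) (translations (col_rep Ldual) 3 2))
    (famsum (translations (col_rep Ldual) 5 4) (translations (col_rep Ldual) 7 6)).

(* M(a_1,...,a_n), concentrated in the component of the content of a.          *)
Definition content (a : {ffun 'I_n -> 'I_8}) : idx :=
  [ffun k => #|[set m | a m == k]|%:Z].

Definition verma_fam (a : {ffun 'I_n -> 'I_8}) : family := fun d =>
  if d == content a
  then verma (\sum_m (a m : nat)%:R *: eps m - rho)
  else zero_mod C n.

(* The Grothendieck group K(O^n): generators the objects of O^n,          *)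
(* relations [B] = [A] + [D] for 0 -> A -> B -> D -> 0 exact.                  *)
Inductive kterm :=
| K0 | Kgen of On | Kadd_ of kterm & kterm | Kopp_ of kterm.

Inductive keq : kterm -> kterm -> Prop :=
| keq_refl t : keq t t
| keq_sym t u : keq t u -> keq u t
| keq_trans t u v : keq t u -> keq u v -> keq t v
| keq_add t t' u u' : keq t t' -> keq u u' -> keq (Kadd_ t u) (Kadd_ t' u')
| keq_opp t t' : keq t t' -> keq (Kopp_ t) (Kopp_ t')
| keq_addA t u v : keq (Kadd_ t (Kadd_ u v)) (Kadd_ (Kadd_ t u) v)
| keq_addC t u : keq (Kadd_ t u) (Kadd_ u t)
| keq_add0 t : keq (Kadd_ K0 t) t
| keq_addN t : keq (Kadd_ (Kopp_ t) t) K0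
| keq_ses (A B D : On) (f : famhom A B) (g : famhom B D) :
    ses f g -> keq (Kgen B) (Kadd_ (Kgen A) (Kgen D)).

(* Not a quotient type of the library: kterm lives in a universe above that of *)
(* lmodType, too large for choiceType and zmodType.                            *)
Definition KOn := {c : kterm -> Prop | exists t, c = keq t}.

Definition Kcl (t : kterm) : KOn := exist _ (keq t) (ex_intro _ t erefl).
Definition Krepr (x : KOn) : kterm := projT1 (cid (proj2_sig x)).

Definition Kadd (x y : KOn) : KOn := Kcl (Kadd_ (Krepr x) (Krepr y)).
Definition Kopp (x : KOn) : KOn := Kcl (Kopp_ (Krepr x)).
Definition Ksub (x y : KOn) : KOn := Kadd x (Kopp y).
Definition Kclass (M : On) : KOn := Kcl (Kgen M).

Lemma KOn_eq (x y : KOn) : sval x = sval y -> x = y.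
Proof.
case: x y => [x hx] [y hy] /= xy; move: hx; rewrite xy => hx.
by rewrite (Prop_irrelevance hx hy).
Qed.

Lemma KclP t u : Kcl t = Kcl u <-> keq t u.
Proof.
split=> [[] e|tu].
  by have := keq_refl u; rewrite -e.
apply: KOn_eq; apply/funext => v; apply/propext.
by split=> h; [exact: keq_trans (keq_sym tu) h|exact: keq_trans tu h].
Qed.

Lemma KreprK x : Kcl (Krepr x) = x.
Proof.
apply: KOn_eq; rewrite /= /Krepr.
by case: cid => t /= ->.
Qed.

Lemma Kcl_add t u : Kadd (Kcl t) (Kcl u) = Kcl (Kadd_ t u).
Proof. by apply/KclP; apply: keq_add; apply/KclP; exact: KreprK. Qed.

Lemma Kcl_opp t : Kopp (Kcl t) = Kcl (Kopp_ t).
Proof. by apply/KclP; apply: keq_opp; apply/KclP; exact: KreprK. Qed.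

(* The endomorphism [F] of K(O^n) induced by an exact functor F.               *)
Section Kmap.
Variables (F : famfun) (exF : exact_On F).

Definition On_map (M : On) : On := OnObj (On_stable exF (ofamP M)).

Fixpoint kterm_map (t : kterm) : kterm :=
  match t with
  | K0 => K0
  | Kgen M => Kgen (On_map M)
  | Kadd_ t u => Kadd_ (kterm_map t) (kterm_map u)
  | Kopp_ t => Kopp_ (kterm_map t)
  end.

Lemma keq_map t u : keq t u -> keq (kterm_map t) (kterm_map u).
Proof.
elim=> /=.
- by move=> *; exact: keq_refl.
- by move=> ? ? _; exact: keq_sym.
- by move=> ? v ? _ h _; exact: keq_trans h.
- by move=> ? ? ? ? _ h _; exact: keq_add.
- by move=> ? ? _; exact: keq_opp.
- by move=> *; exact: keq_addA.
- by move=> *; exact: keq_addC.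
- by move=> *; exact: keq_add0.
- by move=> *; exact: keq_addN.
- move=> A B D f g fg.
  exact: (@keq_ses (On_map A) (On_map B) (On_map D) _ _ (On_exact exF fg)).
Qed.

Definition Kmap (x : KOn) : KOn := Kcl (kterm_map (Krepr x)).

Lemma Kmap_cl t : Kmap (Kcl t) = Kcl (kterm_map t).
Proof. by apply/KclP/keq_map/KclP/KreprK. Qed.

Lemma Kmap_class M : Kmap (Kclass M) = Kclass (On_map M).
Proof. exact: Kmap_cl. Qed.

Lemma Kmap_add x y : Kmap (Kadd x y) = Kadd (Kmap x) (Kmap y).
Proof.
by rewrite -[x]KreprK -[y]KreprK Kcl_add !Kmap_cl Kcl_add.
Qed.
End Kmap.

(* Matrices act on the basis by X v_k = \sum_j X j k v_j.                      *)
Definition arrows (s : seq (nat * nat)) : 'M[C]_8 :=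
  \matrix_(j, k) (((k : nat), (j : nat)) \in s)%:R.

Definition signs (p m : seq nat) : 'M[C]_8 :=
  \matrix_(j, k) if j == k then ((k : nat) \in p)%:R - ((k : nat) \in m)%:R
                 else 0.

Definition spin_h (i : nat) : 'M[C]_8 :=
  match i with
  | 1%N => signs [:: 4; 5]%N [:: 2; 3]%N
  | 2%N => signs [:: 2; 6]%N [:: 1; 5]%N
  | 3%N => signs [:: 1; 3; 5; 7]%N [:: 0; 2; 4; 6]%N
  | _ => 0
  end.

Definition spin_e (i : nat) : 'M[C]_8 :=
  match i with
  | 1%N => arrows [:: (3, 5); (2, 4)]%N
  | 2%N => arrows [:: (5, 6); (1, 2)]%N
  | 3%N => arrows [:: (6, 7); (4, 5); (2, 3); (0, 1)]%N
  | _ => 0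
  end.

Definition spin_f (i : nat) : 'M[C]_8 :=
  match i with
  | 1%N => arrows [:: (5, 3); (4, 2)]%N
  | 2%N => arrows [:: (6, 5); (2, 1)]%N
  | 3%N => arrows [:: (7, 6); (5, 4); (3, 2); (1, 0)]%N
  | _ => 0
  end.

(* V_sp^{(x) n}, in coordinates on the basis v_a = v_{a_1} (x) ... (x) v_{a_n}. *)
Definition Vsp_tens := {ffun {ffun 'I_n -> 'I_8} -> C^o}.

Definition vten (a : {ffun 'I_n -> 'I_8}) : Vsp_tens := [ffun b => (b == a)%:R].

Definition tset (a : {ffun 'I_n -> 'I_8}) (m : 'I_n) (j : 'I_8) :
  {ffun 'I_n -> 'I_8} := [ffun m' => if m' == m then j else a m'].

Definition leibniz (X : 'M[C]_8) (t : Vsp_tens) : Vsp_tens :=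
  \sum_a t a *: \sum_(m < n) \sum_(j < 8) X j (a m) *: vten (tset a m j).

Definition Z_span (t : Vsp_tens) : Prop :=
  exists z : {ffun 'I_n -> 'I_8} -> int, t = \sum_a (z a)%:~R *: vten a.

(* gamma is the isomorphism K(O^n) -> ^Z V_sp^{(x) n}, [M(a)] |-> v_a.          *)
Record is_gamma (gamma : KOn -> Vsp_tens) : Prop := IsGamma {
  gamma_add : forall x y, gamma (Kadd x y) = gamma x + gamma y;
  gamma_inj : injective gamma;
  gamma_im : forall t, Z_span t <-> exists x, gamma x = t;
  gamma_verma : forall a (Ma : inOn (verma_fam a)),
    gamma (Kclass (OnObj Ma)) = vten a }.

End CategoryOn.

(* Main.v *)
Require Import Defs.
From HB Require Import structures.
From mathcomp Require Import all_boot all_order all_algebra.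
From mathcomp Require Import generic_quotient.
From mathcomp Require Import boolp classical_sets reals.
From mathcomp.real_closed Require Import complex.
From mathcomp Require Import perm mpoly zify ring.
Set Implicit Arguments.
Unset Strict Implicit.
Unset Printing Implicit Defensive.
Import Order.TTheory GRing.Theory Num.Theory.
Local Open Scope ring_scope.
Local Open Scope quotient_scope.

(* Since K(O^n) is generated by the classes of the Verma modules M(a), it is    *)
(* enough to compute [F M(a)] for each functor F.  The PBW theorem, obtained by *)
(* letting gl_n act on polynomials in its matrix entries, shows that            *)
(* V (x) M(a) has a filtration whose subquotients are the Verma modules         *)
(* M(la_a + nu), nu running over the weights of V with multiplicity; the        *)
(* projection onto a block is exact and selects those with the right central    *)
(* character.  In Sym^2 - Alt^2 the weights eps_i + eps_j with i <> j cancel,   *)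
(* so that only the terms la_a + c eps_m matter, and for these the eigenvalue   *)
(* of the Casimir element already separates the central characters.  That the   *)
(* surviving ones do have the required character follows from the singular      *)
(* vectors f^k v of Verma modules, which link a to its sorted rearrangement.    *)
(* Objects of O are controlled by finite lists of weight vectors generating     *)
(* them, each of which is a highest weight vector modulo its successors.        *)

(** Both sides of every identity are additive on K(O^n), and [gamma] is injective with image the
    integral span of the v_a, so by [leibniz_ext] it is enough to compare them on the classes of the
    M(a). For the translation functors this means finding the class of the block component of V ⊗
    M(a).

    Order a weight basis e_i of V so that raising operators lead to later vectors. Then e_i ⊗ v is a
    highest weight vector modulo the later ones, and V ⊗ M(la) gets a filtration with subquotients
    generated by highest weight vectors of weights la + wt(e_i). These are full Verma modules
    because V ⊗ M(la) is free over U(n_-) on the e_i ⊗ v ([tens_free]). This freeness rests on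
    [verma_free] and, through it, on the PBW theorem [pbw_free]. Hence [tens_verma_additive]: every
    additive function on O sees V ⊗ M(la) as the sum of the M(la + wt(e_i)).

    The projection to a block is such an operation because it is exact on O. By [inO_tri] a module
    of O is generated by a finite triangular list of weight vectors, so finitely many central
    characters matter, and a single central element acts as the projector ([block_projector]).

    It remains to see which subquotients survive. For L_n and its dual, and for the difference of
    Sym^2 and Alt^2 ([sym_alt_additive]), only the weights c eps_m contribute. In coordinates
    centred at -rho, adding c eps_m changes the Casimir value by 2 c a_m + c^2 ([cas_shift]), so the
    Casimir recovers a_m: in the translation from k to k' = k + c only the places with a_m = k can
    survive. They do, because the new tuple has the target content and the character of M(b) depends
    only on the content of b ([chi_content]). That invariance comes from the singular vectors f^k v,
    which realise exchanges of adjacent entries ([chi_reflection]). The outcome, the sum of v_a with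
    a_m = k replaced by k', is the Leibniz action of the arrow from v_k to v_k'. For the functors
    H_i the count is direct: c_i of the content is the sum of the h_i-eigenvalues of the tensor
    factors. *)

Section Span.
Variables (C : fieldType) (V : lmodType C).

Inductive lspan (P : V -> Prop) : V -> Prop :=
| lspan0 : lspan P 0
| lspanS c p v : P p -> lspan P v -> lspan P (c *: p + v).

Lemma lspan_in (P : V -> Prop) p : P p -> lspan P p.
Proof. by move=> Pp; rewrite -[p]addr0 -[p]scale1r; apply: lspanS Pp (lspan0 _). Qed.

Lemma lspanD P u v : lspan P u -> lspan P v -> lspan P (u + v).
Proof.
by elim=> [|c p w Pp _ IH] Pv; rewrite ?add0r // -addrA; apply/lspanS/IH.
Qed.

Lemma lspanZ P c v : lspan P v -> lspan P (c *: v).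
Proof.
elim=> [|d p w Pp _ IH]; rewrite ?scaler0 ?scalerDr ?scalerA; first exact: lspan0.
exact: lspanS.
Qed.

Lemma lspanN P v : lspan P v -> lspan P (- v).
Proof. by rewrite -scaleN1r; apply: lspanZ. Qed.

Lemma lspanB P u v : lspan P u -> lspan P v -> lspan P (u - v).
Proof. by move=> Pu /lspanN; apply: lspanD. Qed.

Lemma lspan_sum P (I : Type) (r : seq I) (Q : pred I) F :
  (forall i, Q i -> lspan P (F i)) -> lspan P (\sum_(i <- r | Q i) F i).
Proof. by move=> PF; apply: big_ind => //; [exact: lspan0 | exact: lspanD]. Qed.

Lemma lspan_bind (P Q : V -> Prop) v :
  (forall p, P p -> lspan Q p) -> lspan P v -> lspan Q v.
Proof.
move=> PQ; elim=> [|c p w /PQ Pp _ IH]; first exact: lspan0.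
exact/lspanD/IH/lspanZ.
Qed.

Lemma lspan_sub (P Q : V -> Prop) v :
  (forall p, P p -> Q p) -> lspan P v -> lspan Q v.
Proof. by move=> PQ; apply: lspan_bind => p /PQ/lspan_in. Qed.

Definition free_on (T : eqType) (Q : pred T) (Y : T -> V) : Prop :=
  forall (ws : seq T) (c : T -> C), uniq ws -> all Q ws ->
    \sum_(w <- ws) c w *: Y w = 0 -> forall w, w \in ws -> c w = 0.

Definition fam_span (T : eqType) (Q : pred T) (Y : T -> V) : V -> Prop :=
  lspan (fun p => exists2 w, Q w & p = Y w).

Lemma fam_span_in (T : eqType) (Q : pred T) (Y : T -> V) w :
  Q w -> fam_span Q Y (Y w).
Proof. by move=> Qw; apply: lspan_in; exists w. Qed.

Lemma fam_span_sub (T : eqType) (Q Q' : pred T) (Y : T -> V) v :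
  subpred Q Q' -> fam_span Q Y v -> fam_span Q' Y v.
Proof. by move=> QQ; apply: lspan_sub => p [w /QQ Qw ->]; exists w. Qed.

Lemma fam_spanP (T : eqType) (Q : pred T) (Y : T -> V) v : fam_span Q Y v ->
  exists ws c, [/\ uniq ws, all Q ws & v = \sum_(w <- ws) c w *: Y w].
Proof.
elim=> [|d p u [w Qw ->] _ [ws [c [uws Qws ->]]]].
  by exists [::], (fun=> 0); split; rewrite ?big_nil.
have [wws|wws] := boolP (w \in ws); last first.
  exists (w :: ws), (fun x => if x == w then d else c x).
  split; rewrite /= ?wws ?Qw // big_cons eqxx; congr (_ *: _ + _).
  by apply: eq_big_seq => x xws; case: eqP => // xw; rewrite -xw xws in wws.
exists ws, (fun x => (if x == w then d else 0) + c x); split=> //.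
under [in RHS]eq_bigr do rewrite scalerDl.
rewrite big_split /=; congr (_ + _).
rewrite (bigD1_seq w) //= eqxx big1 ?addr0 // => x /negbTE ->.
exact: scale0r.
Qed.

(** Subtracting the two expressions gives one relation over a disjoint union of indices, whose
    coefficients all vanish. In this way low words are separated from the Verma ideal, and one layer
    of a flag from those below it. *)
Lemma free_disjoint (T : eqType) (Q Q1 Q2 : pred T) (Y : T -> V) v :
  free_on Q Y -> subpred Q1 Q -> subpred Q2 Q -> (forall w, Q1 w -> Q2 w -> False) ->
  fam_span Q1 Y v -> fam_span Q2 Y v -> v = 0.
Proof.
move=> Yfree Q1Q Q2Q Q12 /fam_spanP [ws1 [c1 [u1 q1 e1]]] /fam_spanP
  [ws2 [c2 [u2 q2 e2]]].
have disj w : w \in ws1 -> (w \in ws2) = false.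
  move=> w1; apply/negP => w2.
  exact: (Q12 w (allP q1 _ w1) (allP q2 _ w2)).
have := Yfree (ws1 ++ ws2) (fun w => if w \in ws1 then c1 w else - c2 w).
have -> : uniq (ws1 ++ ws2).
  rewrite cat_uniq u1 u2 andbT /=; apply/hasPn => w w2.
  by apply/negP => /disj; rewrite w2.
rewrite all_cat (sub_all Q1Q q1) (sub_all Q2Q q2) => /(_ isT isT).
rewrite big_cat /= (eq_big_seq (fun w => c1 w *: Y w)); last by move=> w /= ->.
rewrite -e1 (eq_big_seq (fun w => - (c2 w *: Y w))) => [|w w2]; last first.
  case: ifP => [/disj|_]; first by rewrite w2.
  by rewrite scaleNr.
rewrite sumrN -e2 subrr => /(_ erefl) c0.
rewrite e1 big1_seq // => w /= w1.
by have := c0 w; rewrite mem_cat w1 /= => -> //; rewrite scale0r.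
Qed.

End Span.

Lemma lspan_map (C : fieldType) (V W : lmodType C) (P : V -> Prop)
    (Q : W -> Prop) (f : V -> W) v : linear f ->
  (forall p, P p -> lspan Q (f p)) -> lspan P v -> lspan Q (f v).
Proof.
move=> lf PQ; have f0 : f 0 = 0.
  by have := lf (-1) 0 0; rewrite !scaleN1r oppr0 addr0 addNr.
elim=> [|c p w Pp _ IH]; first by rewrite f0; exact: lspan0.
by rewrite lf; apply/lspanD/IH/lspanZ/PQ.
Qed.

(** * The Poincare-Birkhoff-Witt theorem *)

(* Straightening: exchanging two adjacent letters only costs shorter words. *)
Section Straighten.
Variables (C : fieldType) (A : algType C) (T : eqType) (P : pred T) (y : T -> A).
Hypothesis y_bracket : forall p q, P p -> P q ->
  fam_span P y (y p * y q - y q * y p).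

Definition word_prod (w : seq T) : A := \prod_(p <- w) y p.
Notation Y := word_prod.

Lemma word_prod_cons p w : Y (p :: w) = y p * Y w.
Proof. exact: big_cons. Qed.

(** Brackets have no constant term, so a correction word is shorter but never empty;
    [verma_ideal_span] depends on this. *)
Definition short (k : nat) (w : seq T) := [&& all P w, (0 < size w)%N & (size w < k)%N].

Lemma short_mull k p v : P p -> fam_span (short k) Y v ->
  fam_span (short k.+1) Y (y p * v).
Proof.
move=> Pp; apply: (lspan_map (f := fun v => y p * v)) => [c u u'|_ [w /and3P[Pw w0 wk] ->]].
  by rewrite mulrDr scalerAr.
apply: lspan_in; exists (p :: w); last by rewrite word_prod_cons.
by rewrite /short /= Pp Pw.
Qed.

Lemma word_prod_move u p v : all P u -> P p -> all P v ->
  fam_span (short (size u + size v).+1) Y (Y (u ++ p :: v) - Y (p :: u ++ v)).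
Proof.
move=> + Pp Pv; elim: u => [_|q u IH /= /andP[Pq Pu]].
  by rewrite subrr; exact: lspan0.
(* Carry p past u first, then past q; the commutator with q puts one letter in the place of two. *)
have -> : Y (q :: u ++ p :: v) - Y (p :: q :: u ++ v) =
    y q * (Y (u ++ p :: v) - Y (p :: u ++ v)) + (y q * y p - y p * y q) * Y (u ++ v).
  by rewrite !word_prod_cons mulrBr mulrBl !mulrA [RHS]addrA subrK.
apply: lspanD; first by rewrite addSn; apply: short_mull => //; exact: IH.
apply: (lspan_map (f := fun x => x * Y (u ++ v)) _ _ (y_bracket Pq Pp)).
  by move=> c a b; rewrite mulrDl scalerAl.
move=> _ [r Pr ->]; apply: lspan_in; exists (r :: u ++ v); last by rewrite word_prod_cons.
by rewrite /short /= Pr all_cat Pu Pv size_cat !addSn !ltnS leqnn.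
Qed.

Lemma word_prod_perm w w' : perm_eq w w' -> all P w ->
  fam_span (short (size w)) Y (Y w - Y w').
Proof.
elim: w w' => [|p w IH] w'.
  by rewrite perm_sym => /perm_nilP -> _; rewrite subrr; exact: lspan0.
move=> pw /= /andP[Pp Pw].
have pw' : p \in w' by rewrite -(perm_mem pw) mem_head.
case/splitPr: pw' pw => u v pw.
have {}pw : perm_eq w (u ++ v).
  by rewrite -(perm_cons p) (perm_trans pw) // perm_catC /= perm_cons perm_catC.
have Puv : all P (u ++ v) by rewrite -(perm_all _ pw).
rewrite -[_ - _](subrKA (Y (p :: u ++ v))); apply: lspanD.
  have -> : Y (p :: w) - Y (p :: u ++ v) = y p * (Y w - Y (u ++ v)).
    by rewrite !word_prod_cons mulrBr.
  by apply: short_mull => //; apply: IH.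
rewrite -[_ - _]opprB; apply: lspanN.
move: Puv; rewrite (perm_size pw) size_cat all_cat => /andP[Pu Pv].
exact: word_prod_move.
Qed.

Variable le : rel T.
Hypothesis le_total : total le.

(** By [word_prod_perm] sorting costs only strictly shorter words, to which induction applies. *)
Lemma straighten w : all P w ->
  fam_span (fun w' => [&& all P w', sorted le w', (size w' <= size w)%N
    & (0 < size w)%N ==> (0 < size w')%N]) Y (Y w).
Proof.
have [k] := ubnP (size w); elim: k w => // k IH w; rewrite ltnS => wk Pw.
have pw : perm_eq w (sort le w) by rewrite perm_sym perm_sort.
rewrite -[Y w](subrK (Y (sort le w))); apply: lspanD.
  apply: lspan_bind (word_prod_perm pw Pw) => _ [u /and3P[Pu u0 uw] ->].
  apply: fam_span_sub (IH u (leq_trans uw wk) Pu) => u' /and4P[-> -> u'u].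
  by rewrite u0 /= => ->; rewrite implybT (leq_trans u'u) // ltnW.
apply: fam_span_in; rewrite -(perm_all _ pw) Pw sort_sorted //= size_sort leqnn.
by rewrite implybb.
Qed.
End Straighten.

(** * Linearity of the actions of gl_n and U(gl_n) *)

Section Action.
Variables (C : fieldType) (n : nat).
Implicit Types (M : glmod C n) (x y : 'M[C]_n).

Lemma gact_linr M x : linear (@gact C n M x).
Proof. by move=> a v w; exact: ract_linr. Qed.
Lemma gact_linl M (m : M) : linear (fun x => gact x m).
Proof. by move=> a x y; exact: ract_linl. Qed.
Lemma gactDr M x (m m' : M) : gact x (m + m') = gact x m + gact x m'.
Proof. by have := gact_linr x 1 m m'; rewrite !scale1r. Qed.
Lemma gactZr M x a (m : M) : gact x (a *: m) = a *: gact x m.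
Proof. by have := gact_linr x a m 0; rewrite gact0r !addr0. Qed.
Lemma gactNr M x (m : M) : gact x (- m) = - gact x m.
Proof. by rewrite -[- m]scaleN1r gactZr scaleN1r. Qed.
Lemma gactBr M x (m m' : M) : gact x (m - m') = gact x m - gact x m'.
Proof. by rewrite gactDr gactNr. Qed.
Lemma gact_sumr M x (I : Type) (r : seq I) (P : pred I) (F : I -> M) :
  gact x (\sum_(i <- r | P i) F i) = \sum_(i <- r | P i) gact x (F i).
Proof. by apply: big_morph => [m m'|]; [exact: gactDr | exact: gact0r]. Qed.
Lemma gactDl M x y (m : M) : gact (x + y) m = gact x m + gact y m.
Proof. by have := gact_linl m 1 x y; rewrite /= !scale1r. Qed.
Lemma gact0l M (m : M) : gact 0 m = 0.
Proof.
by have := gact_linl m (-1) 0 0; rewrite /= !scaleN1r oppr0 addr0 addNr.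
Qed.
Lemma gactZl M a x (m : M) : gact (a *: x) m = a *: gact x m.
Proof. by have := gact_linl m a x 0; rewrite /= gact0l !addr0. Qed.
Lemma gactNl M x (m : M) : gact (- x) m = - gact x m.
Proof. by rewrite -[- x]scaleN1r gactZl scaleN1r. Qed.
Lemma gact_suml M (I : Type) (r : seq I) (P : pred I) (F : I -> 'M[C]_n) (m : M) :
  gact (\sum_(i <- r | P i) F i) m = \sum_(i <- r | P i) gact (F i) m.
Proof.
by apply: (big_morph (fun x => gact x m)) => [x y|]; [exact: gactDl | exact: gact0l].
Qed.
Lemma gact_bracket M x y (m : M) :
  gact x (gact y m) = gact y (gact x m) + gact (x *m y - y *m x) m.
Proof. by rewrite [X in _ + X]ract_bracket addrC subrK. Qed.

Definition letter := ('I_n * 'I_n)%type.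
Definition Em (p : letter) : 'M[C]_n := delta_mx p.1 p.2.

Lemma gact_Em M x (m : M) : gact x m = \sum_p x p.1 p.2 *: gact (Em p) m.
Proof.
rewrite {1}(matrix_sum_delta x) pair_bigA /= gact_suml.
by apply: eq_bigr => p _; rewrite gactZl.
Qed.

Lemma EmE (p q : letter) : Em p q.1 q.2 = (p == q)%:R.
Proof. by rewrite mxE !(eq_sym q.1) !(eq_sym q.2) -xpair_eqE; case: p q => ? ? []. Qed.

Lemma Em_bracket (p q : letter) : Em p *m Em q - Em q *m Em p =
  (p.2 == q.1)%:R *: Em (p.1, q.2) - (q.2 == p.1)%:R *: Em (q.1, p.2).
Proof. by rewrite !mul_delta_mx_cond -!scaler_nat. Qed.

Lemma uact_linl M (m : M) : linear (fun u => uact u m).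
Proof. by move=> a u v; rewrite uactD uactZ. Qed.
Lemma uact0l M (m : M) : uact 0 m = 0.
Proof. by have := uact_linl m (-1) 0 0; rewrite /= !scaleN1r oppr0 addr0 addNr. Qed.
Lemma uactZr M u a (m : M) : uact u (a *: m) = a *: uact u m.
Proof. by have := uact_linr u a m 0; rewrite uact0r !addr0. Qed.
Lemma uactDr M u (m m' : M) : uact u (m + m') = uact u m + uact u m'.
Proof. by have := uact_linr u 1 m m'; rewrite !scale1r. Qed.
Lemma uactN M u (m : M) : uact (- u) m = - uact u m.
Proof. by rewrite -[- u]scaleN1r uactZ scaleN1r. Qed.
Lemma uactB M u v (m : M) : uact (u - v) m = uact u m - uact v m.
Proof. by rewrite uactD uactN. Qed.
Lemma uactNr M u (m : M) : uact u (- m) = - uact u m.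
Proof. by rewrite -[- m]scaleN1r uactZr scaleN1r. Qed.
Lemma uactA M a (m : M) : uact a%:A m = a *: m.
Proof. by rewrite uactZ uact1. Qed.
Lemma uact_suml M (I : Type) (r : seq I) (P : pred I) (F : I -> Ualg C n) (m : M) :
  uact (\sum_(i <- r | P i) F i) m = \sum_(i <- r | P i) uact (F i) m.
Proof.
elim/big_rec2: _ => [|i u v _ <-]; first exact: uact0l.
exact: uactD.
Qed.

Lemma Ualg_ind (P : Ualg C n -> Prop) : (forall a, P a%:A) ->
  (forall x, P (iota_U x)) -> (forall u v, P u -> P v -> P (u + v)) ->
  (forall u v, P u -> P v -> P (u * v)) -> forall u, P u.
Proof.
move=> Pa Px PD PM u; rewrite -[u]reprK; elim: (repr u) => [a|x|t IHt v IHv|t IHt v IHv].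
- by have := Pa a; rewrite /GRing.scale /= /ualg_scale mulr1.
- exact: Px.
- by rewrite -Defs.pi_add; exact: PD.
- by rewrite -Defs.pi_mul; exact: PM.
Qed.

(* The shifts c turn E_ii into E_ii - la_i, which kills the vector of weight la. *)
Definition gen (c : letter -> C) (p : letter) : Ualg C n := iota_U (Em p) - (c p)%:A.

Lemma uact_gen c M p (m : M) : uact (gen c p) m = gact (Em p) m - c p *: m.
Proof. by rewrite uactB uactA uact_iota. Qed.

(** The shifts are central and drop out of commutators. *)
Lemma gen_bracket c p q : gen c p * gen c q - gen c q * gen c p =
  iota_U (Em p *m Em q - Em q *m Em p).
Proof.
rewrite iota_U_bracket /gen; set a := iota_U _; set b := iota_U _.
rewrite !mulrBl !mulrBr !mulr_algl !mulr_algr.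
have cancel (V : zmodType) (A B s t w : V) : A - s - (t - w) - (B - t - (s - w)) = A - B.
  rewrite -[A - s - _]addrA -[B - t - _]addrA -!opprD (addrCA s t).
  by rewrite opprB subrKA.
by rewrite [c q *: (c p)%:A]scalerA (mulrC (c q)) -scalerA cancel.
Qed.

End Action.

(* gl_n acts on polynomial functions on matrices by the vector fields of right  *)
(* translation; the coordinates t_kj are centred at the identity matrix.        *)
Section Polynomial.
Variables (C : fieldType) (n : nat).
Notation letter := (letter n).
Definition npairs := #|{: 'I_n * 'I_n}|.
Notation poly := {mpoly C[npairs]}.
Definition pidx (p : letter) : 'I_npairs := enum_rank p.

Lemma pidx_eq p q : (pidx p == pidx q) = (p == q).
Proof. exact: (inj_eq enum_rank_inj). Qed.

Definition pol_lin (X : 'M[C]_n) (p : letter) : poly :=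
  \sum_i X i p.2 *: 'X_(pidx (p.1, i)).
(** With g = 1 + T, T the matrix of coordinates, this is the p-entry of g X. *)
Definition pol_coef (X : 'M[C]_n) (p : letter) : poly := (X p.1 p.2)%:MP + pol_lin X p.
Definition pol_act (X : 'M[C]_n) (F : poly) : poly :=
  \sum_p pol_coef X p * F^`M(pidx p).

Lemma pol_lin_linear p : linear (pol_lin^~ p).
Proof.
move=> a X Y; rewrite /pol_lin scaler_sumr -big_split /=; apply: eq_bigr => i _.
by rewrite !mxE scalerDl scalerA.
Qed.

Lemma pol_coef_linear p : linear (pol_coef^~ p).
Proof.
move=> a X Y; rewrite /pol_coef pol_lin_linear !mxE mpolyCD mpolyCM mul_mpolyC.
by rewrite scalerDr addrACA.
Qed.

Lemma pol_linl a X Y F : pol_act (a *: X + Y) F = a *: pol_act X F + pol_act Y F.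
Proof.
rewrite /pol_act scaler_sumr -big_split /=; apply: eq_bigr => p _.
by rewrite pol_coef_linear mulrDl scalerAl.
Qed.

Lemma pol_linr X a F G : pol_act X (a *: F + G) = a *: pol_act X F + pol_act X G.
Proof.
rewrite /pol_act scaler_sumr -big_split /=; apply: eq_bigr => p _.
by rewrite mderivD mderivZ mulrDr scalerAr.
Qed.

Lemma mderiv_coef X p q : (pol_coef X q)^`M(pidx p) = ((p.1 == q.1)%:R * X p.2 q.2)%:MP.
Proof.
rewrite mderivD mderivC add0r raddf_sum /=.
under eq_bigr => i _ do rewrite mderivZ mderivX mnm1E pidx_eq.
rewrite (bigD1 p.2) //= big1 ?addr0 => [|i ip].
  have -> : ((q.1, p.2) == p) = (p.1 == q.1).
    by case: p => k m; rewrite xpair_eqE eqxx andbT eq_sym.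
  case: eqP => [<-|_]; last by rewrite scale0r scaler0 mul0r mpolyC0.
  rewrite scale1r mul1r -[RHS]mulr1 mul_mpolyC; congr (_ *: _).
  rewrite -mpolyX0; congr 'X_[_]; apply/mnmP => j; rewrite mnmBE mnm0E.
  by case: p => k m; rewrite subnn.
have /negbTE -> : (q.1, i) != p by apply: contraNneq ip => <-.
by rewrite scale0r scaler0.
Qed.

(** Differentiating g Y in the direction g X gives g X Y: the first-order part of a composite of two
    such fields. *)
Lemma pol_coefM X Y q : \sum_p pol_coef X p * (pol_coef Y q)^`M(pidx p) =
  pol_coef (X *m Y) q.
Proof.
under eq_bigr => p _ do rewrite mderiv_coef.
rewrite (eq_bigr (fun p : letter => pol_coef X (p.1, p.2) *
    ((p.1 == q.1)%:R * Y p.2 q.2)%:MP)); last by case.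
rewrite -(pair_bigA _ (fun k m => pol_coef X (k, m) *
    ((k == q.1)%:R * Y m q.2)%:MP)) /=.
rewrite (bigD1 q.1) //= eqxx [X in _ + X]big1 ?addr0 => [|k /negbTE ->]; last first.
  by apply: big1 => m _; rewrite mul0r mpolyC0 mulr0.
rewrite /pol_coef /pol_lin mxE raddf_sum /=.
under [X in _ = _ + X]eq_bigr do rewrite mxE scaler_suml.
rewrite exchange_big -big_split /=; apply: eq_bigr => m _.
rewrite mul1r mulrDl -mpolyCM; congr (_ + _).
rewrite mulr_suml; apply: eq_bigr => i _.
by rewrite mulrC mul_mpolyC scalerA mulrC.
Qed.

Lemma pol_act_comp X Y F : pol_act X (pol_act Y F) = pol_act (X *m Y) F +
  \sum_p \sum_q pol_coef X p * pol_coef Y q * F^`M(pidx q)^`M(pidx p).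
Proof.
rewrite {1 2}/pol_act.
under eq_bigr => p _.
  rewrite raddf_sum mulr_sumr /=.
  under eq_bigr => q _ do rewrite mderivM mulrDr !mulrA.
  by rewrite big_split /=; over.
rewrite big_split /=; congr (_ + _); rewrite exchange_big /=.
by apply: eq_bigr => q _; rewrite -pol_coefM mulr_suml.
Qed.

(** The second-order part in [pol_act_comp] is symmetric in X and Y because partial derivatives
    commute. *)
Lemma pol_bracket X Y F :
  pol_act (X *m Y - Y *m X) F = pol_act X (pol_act Y F) - pol_act Y (pol_act X F).
Proof.
rewrite !pol_act_comp [X in _ - (_ + X)]exchange_big /=.
under [X in _ - (_ + X)]eq_bigr => p _ do under eq_bigr => q _ do
  rewrite mderiv_comm [pol_coef Y _ * _]mulrC.
rewrite opprD addrACA subrr addr0 -[_ - Y *m X]addrC -scaleN1r pol_linl scaleN1r.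
by rewrite addrC.
Qed.

Definition pol_mod : glmod C n := GlMod (Rep pol_linl pol_linr pol_bracket).

(** The k-th power of the maximal ideal at the identity matrix. *)
Definition order_ge (k : nat) : pol_mod -> Prop :=
  fam_span (fun m : 'X_{1..npairs} => (k <= mdeg m)%N) (fun m => 'X_[m] : poly).

Lemma order_ge_const k F : (0 < k)%N -> order_ge k F -> (F : poly)@_0 = 0.
Proof.
move=> k0; elim=> [|c _ v [m km ->] _ IH]; first by rewrite mcoeff0.
rewrite mcoeffD mcoeffZ mcoeffX IH addr0.
by case: eqP km => [->|_]; rewrite ?mulr0 // mdeg0 leqNgt k0.
Qed.

Lemma order_ge_sub k l F : (l <= k)%N -> order_ge k F -> order_ge l F.
Proof. by move=> lk; apply: fam_span_sub => m; apply: leq_trans. Qed.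

Lemma mdeg_subU (s : 'X_{1..npairs}) j : s j != 0%N -> mdeg s = (mdeg (s - U_(j))).+1.
Proof.
move=> sj; rewrite -{1}[s](@submK _ U_(j)%MM) ?mdegD ?mdeg1 ?addn1 //.
by rewrite lep1mP.
Qed.

(** At the identity E_p is the constant field d/dt_p; the rest of the field multiplies each
    derivative by a linear form and so preserves degrees. *)
Lemma pol_act_X p (s : 'X_{1..npairs}) :
  order_ge (mdeg s) (gact (Em C p) ('X_[s] : pol_mod)
    - (s (pidx p))%:R *: 'X_[s - U_(pidx p)]).
Proof.
have -> : gact (Em C p) ('X_[s] : pol_mod) =
    \sum_q (p == q)%:R *: ('X_[s])^`M(pidx q) + \sum_q pol_lin (Em C p) q * ('X_[s])^`M(pidx q).
  rewrite -big_split /=; apply: eq_bigr => q _.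
  by rewrite /pol_coef EmE mulrDl mul_mpolyC.
rewrite (bigD1 p) //= eqxx scale1r big1 ?addr0 => [|q]; last first.
  by rewrite eq_sym => /negbTE ->; rewrite scale0r.
rewrite mderivX addrAC subrr add0r; apply: lspan_sum => q _.
rewrite mderivX; have [->|sq] := eqVneq (s (pidx q)) 0%N.
  by rewrite scale0r mulr0; exact: lspan0.
rewrite /pol_lin mulr_suml; apply: lspan_sum => i _.
rewrite -scalerAr -scalerAl; apply/lspanZ/lspanZ; rewrite -mpolyXD.
by apply: fam_span_in; rewrite mdegD mdeg1 add1n -mdeg_subU.
Qed.

Lemma order_ge_X k (s : 'X_{1..npairs}) : (k <= mdeg s)%N -> order_ge k ('X_[s] : poly).
Proof. by move=> ks; apply: fam_span_in. Qed.

Lemma order_ge_gen c p k F : order_ge k.+1 F -> order_ge k (uact (gen c p) F).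
Proof.
move=> Fk; rewrite uact_gen; apply: lspanB; last first.
  by apply/lspanZ/(order_ge_sub (leqnSn k) Fk).
apply: (lspan_map (gact_linr (M := pol_mod) (Em C p)) _ Fk) => _ [s ks ->].
rewrite -[gact _ _](subrK ((s (pidx p))%:R *: 'X_[s - U_(pidx p)] : pol_mod)).
apply: lspanD; first by apply: order_ge_sub (pol_act_X p s); apply: ltnW.
have [->|sp] := eqVneq (s (pidx p)) 0%N; first by rewrite scale0r; exact: lspan0.
by apply/lspanZ/order_ge_X; rewrite -ltnS -mdeg_subU.
Qed.

Lemma order_ge_word c w k F : (size w <= k)%N -> order_ge k F ->
  order_ge (k - size w) (uact (word_prod (gen c) w) F).
Proof.
elim: w => [|p w IH] /= wk Fk; first by rewrite subn0 /word_prod big_nil uact1.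
rewrite word_prod_cons uactM; apply: order_ge_gen; rewrite -subSn //.
by rewrite subSS; apply/IH/Fk/ltnW.
Qed.

(** Elements of U(gl_n) as distributions supported at the identity, evaluated on monomials. *)
Definition pairing (u : Ualg C n) (s : 'X_{1..npairs}) : C := (uact u ('X_[s] : pol_mod) : poly)@_0.

Lemma pairing_linear s a u v : pairing (a *: u + v) s = a * pairing u s + pairing v s.
Proof. by rewrite /pairing uact_linl mcoeffD mcoeffZ. Qed.

Lemma pairing_small c w s : (size w < mdeg s)%N -> pairing (word_prod (gen c) w) s = 0.
Proof.
move=> ws; apply: (@order_ge_const (mdeg s - size w)); first by rewrite subn_gt0.
by apply: order_ge_word; [exact: ltnW | exact: order_ge_X].
Qed.

Hypothesis char0 : forall k, (k%:R == 0 :> C) = (k == 0)%N.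

(** To leading order each letter is a partial derivative, so the value is a product of factorials
    when w uses each p exactly s_p times, and 0 otherwise. Characteristic 0 keeps the product
    nonzero. *)
Lemma pairing_eq c w s : size w = mdeg s ->
  (pairing (word_prod (gen c) w) s != 0) = [forall p, s (pidx p) == count_mem p w].
Proof.
elim/last_ind: w s => [|w p IH] s ws.
  have /eqP s0 : s == 0%MM by rewrite -mdeg_eq0 -ws.
  rewrite /pairing /word_prod big_nil uact1 s0 mpolyX0 mcoeff1 eqxx oner_eq0 /=.
  by apply/esym/forallP => q; rewrite mnm0E.
move: ws; rewrite size_rcons => ws.
rewrite /pairing /word_prod big_rcons /= uactM -/(word_prod _ _).
set F := uact (gen c p) _.
have : order_ge (mdeg s) (F - (s (pidx p))%:R *: ('X_[s - U_(pidx p)] : pol_mod)).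
  rewrite /F uact_gen addrAC; apply: lspanB; first exact: pol_act_X.
  by apply/lspanZ/order_ge_X.
move=> /(order_ge_word c (w := w)); rewrite -ws => /(_ (leqnSn _)).
move=> /order_ge_const; rewrite subSnn => /(_ isT).
rewrite uactDr uactNr uactZr mcoeffB mcoeffZ => /eqP; rewrite subr_eq0 => /eqP ->.
have [sp|sp] := eqVneq (s (pidx p)) 0%N.
  rewrite sp mul0r eqxx; apply/esym/forallP => /(_ p).
  by rewrite sp -cats1 count_cat /= eqxx addn1.
rewrite mulf_eq0 char0 (negbTE sp) /=.
rewrite [LHS]IH; last by have := mdeg_subU sp; rewrite -ws => -[].
apply: eq_forallb => q; rewrite mnmBE mnm1E pidx_eq -cats1 count_cat /= addn0.
have [pq|_] := eqVneq p q; last by rewrite subn0 addn0.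
by rewrite -pq addn1 -[in RHS](prednK (n := s (pidx p))) ?lt0n // eqSS subn1.
Qed.
Definition low (p : letter) : bool := (p.2 < p.1)%N.
(** Low letters come first, so a sorted word is a word in n_- followed by one in the Borel
    subalgebra. *)
Definition key (p : letter) : nat := if low p then pidx p : nat else (npairs + pidx p)%N.
Definition wle (p q : letter) : bool := (key p <= key q)%N.

Lemma wle_total : total wle. Proof. by move=> p q; exact: leq_total. Qed.
Lemma wle_trans : transitive wle. Proof. by move=> p q r; exact: leq_trans. Qed.
Lemma wle_anti : antisymmetric wle.
Proof.
move=> p q; rewrite /wle -eqn_leq /key => /eqP e; apply/eqP; rewrite -pidx_eq; apply/eqP/val_inj.
have := ltn_ord (pidx p); have := ltn_ord (pidx q).
by move: e; do 2!case: ifP => _ /=; lia.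
Qed.

Definition content_mon (w : seq letter) : 'X_{1..npairs} :=
  [multinom count_mem (enum_val i : letter) w | i < npairs].

Lemma content_monE w p : content_mon w (pidx p) = count_mem p w.
Proof. by rewrite mnmE enum_rankK. Qed.

Lemma mdeg_content w : mdeg (content_mon w) = size w.
Proof.
rewrite mdegE (reindex pidx) /=; last exact/onW_bij/enum_rank_bij.
under eq_bigr do rewrite content_monE.
elim: w => [|q w IH] /=; first by rewrite big1.
rewrite big_split /= IH (bigD1 q) //= eqxx big1 // => p.
by rewrite eq_sym => /negbTE ->.
Qed.

(** Words are triangular against the monomials of their contents: shorter words pair to 0 with the
    content of w, and among words of the same length only rearrangements of w do not. A sorted word
    has no other sorted rearrangement, so coefficients vanish from the longest words downwards. *)
Theorem pbw_free c : free_on (sorted wle) (word_prod (gen c) : _ -> Ualg C n).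
Proof.
move=> ws a uws /allP sws sum0.
(* Here d exceeds the gap between the length of w and the maximal length; induction on d treats the
   longest words first. *)
suff h d : forall w, w \in ws -> (\max_(w <- ws) size w < size w + d)%N -> a w = 0.
  by move=> w /(h (\max_(w <- ws) size w).+1); apply; rewrite addnS ltnS leq_addl.
elim: d => [|d IH] w wws.
  by rewrite addn0 ltnNge (leq_bigmax_seq (F := size)).
move=> wd; have : pairing (\sum_(w <- ws) a w *: word_prod (gen c) w) (content_mon w) = 0.
  by rewrite sum0 /pairing uact0l mcoeff0.
have -> : pairing (\sum_(w <- ws) a w *: word_prod (gen c) w) (content_mon w) =
    \sum_(v <- ws) a v * pairing (word_prod (gen c) v) (content_mon w).
  elim/big_rec2: _ => [|v x u _ <-]; first by rewrite /pairing uact0l mcoeff0.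
  exact: pairing_linear.
rewrite (bigD1_seq w) //= big1_seq ?addr0 => [|v /andP[vw vws]].
  move/eqP; rewrite mulf_eq0 => /orP[/eqP//|].
  suff /negbTE -> : pairing (word_prod (gen c) w) (content_mon w) != 0 by [].
  by rewrite pairing_eq ?mdeg_content //; apply/forallP => p; rewrite content_monE.
have [vs|vs|vs] := ltngtP (size v) (size w).
- by rewrite pairing_small ?mulr0 ?mdeg_content.
- by rewrite IH ?mul0r //; lia.
have [->|] := eqVneq (pairing (word_prod (gen c) v) (content_mon w)) 0.
  by rewrite mulr0.
rewrite pairing_eq ?mdeg_content // => /forallP cvw.
have pvw : perm_eq v w.
  by apply/allP => p _; rewrite /= -(content_monE w) eq_sym (eqP (cvw p)).
case/eqP: vw; apply: (sorted_eq wle_trans wle_anti) pvw; exact: sws.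
Qed.
End Polynomial.

(** * Verma modules *)

Section Quotient.
Variables (C : fieldType) (n : nat) (M : glmod C n) (S : submodule M).

Definition quot_fun (m : M) : quot_mod S := \pi_(quot_car S) m.
Fact quot_fun_linear : linear quot_fun.
Proof.
move=> a u v; rewrite /quot_fun -[LHS]/(\pi_(quot_car S) (a *: u + v)) pi_quotD.
by rewrite -pi_quotZ.
Qed.
HB.instance Definition _ :=
  GRing.isLinear.Build C M (quot_mod S) *:%R quot_fun quot_fun_linear.
Fact quot_fun_equiv x m : quot_fun (gact x m) = gact x (quot_fun m).
Proof. by rewrite [RHS]pi_quot_act. Qed.
Definition quot_hom : glhom M (quot_mod S) := GlHom quot_fun_equiv.

Lemma quot_hom_surj q : exists m, quot_hom m = q.
Proof. by exists (repr (q : quot_car S)); exact: reprK. Qed.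

Lemma quot_hom_eq0 m : quot_hom m = 0 <-> m \in subP S.
Proof.
have [h1 h2] := @Defs.quotP _ _ _ S m 0; rewrite subr0 in h1 h2.
by rewrite -(linear0 quot_hom); split=> [/h1|/h2].
Qed.
End Quotient.

Section Words.
Variables (C : fieldType) (n : nat).
Notation letter := (letter n).
Notation U := (Ualg C n).
Implicit Types (M : glmod C n) (w : seq letter).

Definition act M w (m : M) : M := uact (word_prod (gen (fun=> 0)) w) m.

Lemma act_nil M (m : M) : act [::] m = m.
Proof. by rewrite /act /word_prod big_nil uact1. Qed.

Lemma act_cons M p w (m : M) : act (p :: w) m = gact (Em C p) (act w m).
Proof. by rewrite /act word_prod_cons uactM uact_gen scale0r subr0. Qed.

Lemma act_cat M v w (m : M) : act (v ++ w) m = act v (act w m).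
Proof. by elim: v => [|p v IH] /=; rewrite ?act_nil // !act_cons IH. Qed.

Lemma hom_act M N (f : glhom M N) w m : f (act w m) = act w (f m).
Proof. exact: hom_uact. Qed.

Lemma word_prod_gen_low c w : (forall p, low p -> c p = 0) -> all (@low n) w ->
  word_prod (gen c) w = word_prod (gen (fun=> 0)) w :> U.
Proof.
move=> c0; elim: w => [|p w IH] /=; first by rewrite /word_prod !big_nil.
by move=> /andP[lp /IH lw]; rewrite !word_prod_cons lw /gen c0.
Qed.

Lemma regular_uact (u : U) (m : regular_mod C n) : uact u m = u * (m : U).
Proof.
elim/Ualg_ind: u m => [a|x|u v IHu IHv|u v IHu IHv] m.
- by rewrite uactA mulr_algl.
- exact: uact_iota.
- by rewrite uactD IHu IHv mulrDl.
- by rewrite uactM IHu IHv mulrA.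
Qed.

Lemma gen0_bracket (p q : letter) : fam_span predT (gen (fun=> 0))
  (gen (fun=> 0) p * gen (fun=> 0) q - gen (fun=> 0) q * gen (fun=> 0) p : U).
Proof.
have iE r : iota_U (Em C r) = gen (fun=> 0) r by rewrite /gen scale0r subr0.
rewrite gen_bracket Em_bracket linearB !linearZ /= !iE.
by apply: lspanD; apply: lspanZ; [|apply: lspanN]; apply: fam_span_in.
Qed.

Lemma words_span (u : U) : fam_span predT (word_prod (gen (fun=> 0))) u.
Proof.
elim/Ualg_ind: u => [a|x|u v|u v Su Sv].
- have -> : a%:A = a *: word_prod (gen (fun=> 0)) [::] :> U by rewrite /word_prod big_nil.
  exact/lspanZ/fam_span_in.
- rewrite (matrix_sum_delta x) linear_sum /=; apply: lspan_sum => i _.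
  rewrite linear_sum /=; apply: lspan_sum => j _; rewrite linearZ /=; apply: lspanZ.
  have -> : iota_U (delta_mx i j) = word_prod (gen (fun=> 0)) [:: (i, j)] :> U.
    by rewrite /word_prod big_seq1 /gen scale0r subr0.
  exact: fam_span_in.
- exact: lspanD.
apply: (lspan_map (f := fun u => u * v)) Su => [a x y|_ [w _ ->]].
  by rewrite mulrDl scalerAl.
apply: (lspan_map (f := fun v => word_prod _ w * v)) Sv => [a x y|_ [w' _ ->]].
  by rewrite mulrDr scalerAr.
rewrite /word_prod -big_cat; exact: fam_span_in.
Qed.

Lemma sorted_split w : sorted (@wle n) w ->
  w = [seq p <- w | low p] ++ [seq p <- w | ~~ low p].
Proof.
elim: w => //= p w IH pw; have := IH (path_sorted pw).
have [lp|lp] := boolP (low p) => /= e; first by rewrite -e.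
have : all (fun q => ~~ low q) w.
  apply/allP => q qw; have := allP (order_path_min (@wle_trans n) pw) q qw.
  rewrite /wle /key (negbTE lp); apply: contraTN => ->.
  by have := ltn_ord (pidx q); lia.
move=> upw; rewrite (all_filterP upw).
suff -> : [seq q <- w | low q] = [::] by [].
by apply/eqP; rewrite -size_eq0 size_filter -leqn0 leqNgt -has_count -all_predC.
Qed.

(** * The Verma ideal, and freeness of Verma modules over U(n_-) *)

Section VermaFree.
Hypothesis char0 : forall k, (k%:R == 0 :> C) = (k == 0)%N.
Variable la : 'rV[C]_n.

(** Shifted in this way, the non-low generators lie in the Verma ideal ([gen_verma_ideal]) while the
    low ones are unchanged. *)
Definition shift_la (p : letter) : C := (p.1 == p.2)%:R * la 0 p.1.

Lemma shift_la_low p : low p -> shift_la p = 0.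
Proof.
by rewrite /low /shift_la; case: eqP => [->|_]; rewrite ?ltnn // mul0r.
Qed.

Notation upper := (fun p : letter => ~~ low p).
Notation Y := (word_prod (gen shift_la)).

(* la is a character of the Borel subalgebra, so no constants appear. *)
Lemma upper_bracket p q : upper p -> upper q ->
  fam_span upper (gen shift_la) (gen shift_la p * gen shift_la q - gen shift_la q * gen shift_la p : U).
Proof.
rewrite gen_bracket Em_bracket /low -!leqNgt; case: p q => [i j] [k l] /= ij kl.
have iE (r : letter) : (r.1 < r.2)%N -> iota_U (Em C r) = gen shift_la r :> U.
  move=> r12; rewrite /gen /shift_la; case: eqP r12 => [->|_]; first by rewrite ltnn.
  by rewrite mul0r scale0r subr0.
have [jk|jk] := eqVneq j k; have [li|li] := eqVneq l i.
- have ei : j = i by apply/val_inj/eqP; rewrite eqn_leq ij jk -li kl.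
  by rewrite li -jk ei subrr linear0; exact: lspan0.
- rewrite scale1r scale0r subr0 iE /=; last first.
    rewrite ltn_neqAle (leq_trans ij) ?jk // andbT eq_sym; exact: li.
  by apply: fam_span_in; rewrite -leqNgt /= (leq_trans ij) ?jk.
- rewrite scale1r scale0r sub0r linearN /=; apply: lspanN; rewrite iE /=; last first.
    by rewrite ltn_neqAle (leq_trans kl) ?li // andbT eq_sym; exact: jk.
  by apply: fam_span_in; rewrite -leqNgt /= (leq_trans kl) ?li.
by rewrite !scale0r subrr linear0; exact: lspan0.
Qed.

(** An unshifted upper letter is a shifted one plus a scalar; the last factor is already shifted and
    keeps the words nonempty. *)
Lemma upper_mul b p : all upper b -> upper p ->
  fam_span (fun w => all upper w && (w != [::])) Y (word_prod (gen (fun=> 0)) b * gen shift_la p).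
Proof.
elim: b => [|q b IH] /=.
  move=> _ up; rewrite /word_prod big_nil mul1r.
  have -> : gen shift_la p = Y [:: p] :> U by rewrite /word_prod big_seq1.
  by apply: fam_span_in; rewrite /= up.
move=> /andP[uq ub] up; rewrite word_prod_cons.
have -> : gen (fun=> 0) q = gen shift_la q + (shift_la q)%:A :> U.
  by rewrite /gen subrK scale0r subr0.
rewrite -mulrA mulrDl mulr_algl; apply: lspanD; last exact/lspanZ/IH.
apply: (lspan_map (f := fun v => gen shift_la q * v)) (IH ub up) => [a x y|_ [w /andP[uw _] ->]].
  by rewrite mulrDr scalerAr.
by rewrite -word_prod_cons; apply: fam_span_in; rewrite /= uq uw.
Qed.

Lemma sorted_cat f b : sorted (@wle n) f -> all (@low n) f -> sorted (@wle n) b -> all upper b ->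
  sorted (@wle n) (f ++ b).
Proof.
move=> sf lf sb ub; case: f sf lf => // p f /= pf /andP[lp lf].
rewrite cat_path pf /=; case: b sb ub => //= q b -> /andP[uq _]; rewrite andbT.
have : low (last p f) by have := mem_last p f; rewrite inE => /predU1P[->//|/(allP lf)].
rewrite /wle /key (negbTE uq) => ->.
by have := ltn_ord (pidx (last p f)); lia.
Qed.

(** Straightening writes the left factor through words f b with f low and b upper. Then b times the
    shifted letter becomes nonempty shifted upper words, which are straightened again inside the
    Borel subalgebra without disturbing f. *)
Lemma verma_ideal_span (u : U) : u \in verma_ideal la ->
  fam_span (fun w => sorted (@wle n) w && has upper w) Y u.
Proof.
suff mulp p (d : U) : upper p -> fam_span (fun w => sorted (@wle n) w && has upper w) Y (d * gen shift_la p).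
  move=> /asboolP [a [b ->]]; apply: lspanD; apply: lspan_sum => i _.
    apply: lspan_sum => j ij; have := mulp (i, j) (a i j).
    rewrite /low /gen /shift_la /= -leqNgt (ltnW ij) => /(_ isT).
    by case: eqP ij => [->|_ _]; rewrite ?ltnn // mul0r scale0r subr0.
  have := mulp (i, i) (b i); rewrite /low /gen /shift_la /= ltnn eqxx mul1r.
  exact.
move=> up; apply: (lspan_map (f := fun v => v * gen shift_la p)) (words_span d) => [a x y|_ [w _ ->]].
  by rewrite mulrDl scalerAl.
have sw := straighten (P := predT) (fun p q _ _ => gen0_bracket p q)
  (@wle_total n) (all_predT w).
apply: (lspan_map (f := fun v => v * gen shift_la p)) sw => [a x y|].
  by rewrite mulrDl scalerAl.
move=> _ [{}w /and4P[_ sw _ _] ->].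
rewrite (sorted_split sw) /word_prod big_cat -mulrA /= -!/(word_prod _ _).
set f := filter _ w; set b := filter _ w.
have lf : all (@low n) f by exact: filter_all.
rewrite -(word_prod_gen_low shift_la_low lf).
apply: (lspan_map (f := fun v => Y f * v)) (upper_mul (filter_all _ _) up) => [a x y|].
  by rewrite mulrDr scalerAr.
move=> _ [{}b /andP[ub b0] ->].
have sb := straighten upper_bracket (@wle_total n) ub.
apply: (lspan_map (f := fun v => Y f * v)) sb => [a x y|].
  by rewrite mulrDr scalerAr.
move=> _ [b' /and4P[ub' sb' _ b'0] ->].
rewrite /word_prod -big_cat /=; apply: fam_span_in.
rewrite sorted_cat //=; last exact: (sorted_filter (@wle_trans n)).
rewrite has_cat; case: b' ub' b'0 {sb'} => [|q b'] /=; last by case/andP=> -> _ _; rewrite orbT.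
by case: b b0 {ub}.
Qed.

Definition verma_sub : submodule (regular_mod C n) :=
  SubModule (verma_ideal_closed la)
    (fun x m mJ => verma_ideal_mul (iota_U x) mJ).
Definition vgen : verma la := quot_hom verma_sub (1 : U).

Lemma uact_vgen (u : U) : uact u vgen = quot_hom verma_sub (u : regular_mod C n).
Proof. by rewrite -hom_uact regular_uact mulr1. Qed.

Lemma uact_vgen0 (u : U) : uact u vgen = 0 <-> u \in verma_ideal la.
Proof. by rewrite uact_vgen; exact: (@quot_hom_eq0 _ _ _ verma_sub). Qed.

Lemma vgen_span (m : verma la) : exists u, m = uact u vgen.
Proof. by have [u <-] := @quot_hom_surj _ _ _ verma_sub m; exists u; rewrite uact_vgen. Qed.

Definition low_sorted (w : seq letter) := sorted (@wle n) w && all (@low n) w.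

(** A combination that kills the generator lies in the Verma ideal, hence in the span of sorted
    words with a non-low letter; by PBW this meets the span of low words only in 0. *)
Theorem verma_free : free_on low_sorted (fun w => act w vgen).
Proof.
move=> ws a uws sws; rewrite /act.
(* Low letters carry no shift, so the relation can be read in the shifted PBW basis. *)
have -> : \sum_(w <- ws) a w *: uact (word_prod (gen (fun=> 0)) w) vgen =
    uact (\sum_(w <- ws) a w *: Y w) vgen.
  rewrite uact_suml; apply: eq_big_seq => w /(allP sws)/andP[_ lw].
  by rewrite uactZ (word_prod_gen_low shift_la_low).
move=> /uact_vgen0/verma_ideal_span inJ; apply: (pbw_free char0 (c := shift_la)) => //.
  by apply: sub_all sws => w /andP[].
apply: (free_disjoint (Q1 := fun w => sorted (@wle n) w && has upper w) (Q2 := low_sorted)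
  (pbw_free char0 (c := shift_la))) => //.
- by move=> w /andP[].
- by move=> w /andP[].
- by move=> w /andP[_ /hasP[p pw np]] /andP[_ /allP/(_ p pw)]; rewrite (negbTE np).
rewrite big_seq; apply: lspan_sum => w wws; apply: lspanZ.
by apply: fam_span_in; apply: (allP sws).
Qed.

Lemma vgen_neq0 : vgen != 0.
Proof.
apply/eqP => v0; have := verma_free (ws := [:: [::]]) (c := fun=> 1).
rewrite big_seq1 act_nil v0 scaler0 => /(_ isT isT erefl [::] isT)/eqP.
by rewrite oner_eq0.
Qed.
End VermaFree.
End Words.

(** * Modules generated by triangular lists of weight vectors *)

Section Finite.
Variables (C : fieldType) (n : nat).
Notation letter := (letter n).
Notation U := (Ualg C n).
Notation eps := (eps C n).
Implicit Types (M : glmod C n) (w : seq letter).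

Definition is_weight M (mu : 'rV[C]_n) (m : M) :=
  forall i, gact (Em C (i, i)) m = mu 0 i *: m.

Lemma is_weightZ M mu (m : M) a : is_weight mu m -> is_weight mu (a *: m).
Proof. by move=> wm i; rewrite gactZr wm !scalerA mulrC. Qed.

Lemma epsE (i j : 'I_n) : eps i 0 j = (i == j)%:R.
Proof. by rewrite mxE eq_sym. Qed.

Lemma is_weight_Em M mu (m : M) (p : letter) :
  is_weight mu m -> is_weight (mu + (eps p.1 - eps p.2)) (gact (Em C p) m).
Proof.
move=> wm i; rewrite gact_bracket wm gactZr Em_bracket /= gactDl gactNl !gactZl !mxE.
rewrite !(inj_eq val_inj) scalerDl scalerBl (eq_sym p.2); case: p => j k /=; congr (_ + (_ - _)).
  by case: eqP => [->|_]; rewrite ?scale0r.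
by case: eqP => [->|_]; rewrite ?scale0r.
Qed.

Lemma listspanP (V : lmodType C) (s : seq V) v : lspan (fun p => p \in s) v <->
  exists c : nat -> C, v = \sum_(i < size s) c i *: s`_i.
Proof.
split=> [|[c ->]]; last by apply: lspan_sum => i _; apply/lspanZ/lspan_in/mem_nth.
elim=> [|a p u ps _ [c ->]]; first by exists (fun=> 0); rewrite big1 // => i _; rewrite scale0r.
exists (fun i => (if i == index p s then a else 0) + c i).
under [RHS]eq_bigr do rewrite scalerDl; rewrite big_split /=; congr (_ + _).
have ips : (index p s < size s)%N by rewrite index_mem.
rewrite (bigD1 (Ordinal ips)) //= eqxx nth_index // big1 ?addr0 // => i.
by rewrite -val_eqE /= => /negbTE ->; rewrite scale0r.
Qed.

Lemma fin_genP M (s : seq M) m :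
  lspan (fun p => exists2 x, x \in s & exists u, p = uact u x) m <->
  exists u : nat -> U, m = \sum_(i < size s) uact (u i) s`_i.
Proof.
split=> [|[c ->]]; last first.
  by apply: lspan_sum => i _; apply: lspan_in; exists s`_i; [exact: mem_nth | exists (c i)].
elim=> [|a p v [x xs [u ->]] _ [c ->]].
  by exists (fun=> 0); rewrite big1 // => i _; rewrite uact0l.
exists (fun i => (if i == index x s then a *: u else 0) + c i).
under [RHS]eq_bigr do rewrite uactD; rewrite big_split /=; congr (_ + _).
have ips : (index x s < size s)%N by rewrite index_mem.
rewrite (bigD1 (Ordinal ips)) //= eqxx nth_index // big1 ?addr0 ?uactZ // => i.
by rewrite -val_eqE /= => /negbTE ->; rewrite uact0l.
Qed.

Lemma h_semisimpleP M : h_semisimple M <-> forall m : M, lspan (@weight_vector C n M) m.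
Proof.
split=> hM m.
  have [s [ws ->]] := hM m; rewrite big_seq; apply: lspan_sum => v /ws; exact: lspan_in.
elim: (hM m) => [|a p u [mu wp] _ [s [ws ->]]].
  by exists [::]; split=> //; rewrite big_nil.
exists (a *: p :: s); split; last by rewrite big_cons.
move=> v; rewrite inE => /predU1P[->|]; last exact: ws.
by exists mu; exact: is_weightZ.
Qed.

(** * Low words applied to Borel-stable sets and triangular lists *)

Section LowWords.
Variable M : glmod C n.

(** The bound on word length serves to read off local finiteness under n_+. *)
Definition fspan_le (X : M -> Prop) (k : nat) : M -> Prop := lspan (fun m =>
  exists w x, [/\ all (@low n) w, (size w <= k)%N, X x & m = act w x]).
Definition fspan (X : M -> Prop) : M -> Prop := lspan (fun m =>
  exists w x, [/\ all (@low n) w, X x & m = act w x]).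

Definition borel_stable (X : M -> Prop) := forall (p : letter) x,
  ~~ low p -> X x -> lspan X (gact (Em C p) x).

Lemma fspan_le_sub X k l m : (k <= l)%N -> fspan_le X k m -> fspan_le X l m.
Proof.
move=> kl; apply: lspan_sub => p [w [x [lw wk Xx ->]]]; exists w, x; split=> //.
exact: leq_trans kl.
Qed.

Lemma fspan_le_fspan X k m : fspan_le X k m -> fspan X m.
Proof. by apply: lspan_sub => p [w [x [lw _ Xx ->]]]; exists w, x. Qed.

Lemma fspan_fspan_le X m : fspan X m -> exists k, fspan_le X k m.
Proof.
elim=> [|a p v [w [x [lw Xx ->]]] _ [k vk]]; first by exists 0%N; exact: lspan0.
exists (maxn (size w) k); apply: lspanD; last exact: fspan_le_sub (leq_maxr _ _) vk.
by apply/lspanZ/lspan_in; exists w, x; split=> //; exact: leq_maxl.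
Qed.

Lemma fspan_le_in (X : M -> Prop) m : X m -> fspan_le X 0 m.
Proof. by move=> Xm; apply: lspan_in; exists [::], m; rewrite act_nil. Qed.

Lemma fspan_in (X : M -> Prop) m : X m -> fspan X m.
Proof. by move=> /fspan_le_in/fspan_le_fspan. Qed.

Lemma fspan_le_low X k p m : low p -> fspan_le X k m -> fspan_le X k.+1 (gact (Em C p) m).
Proof.
move=> lp; apply: (lspan_map (gact_linr (M := M) (Em C p))) => _ [w [x [lw wk Xx ->]]].
by apply: lspan_in; exists (p :: w), x; rewrite act_cons /= lp.
Qed.

(** Commuting an upper letter past a low one leaves a single letter, possibly low, in front of a
    word shorter by one, so the bound is not exceeded. *)
Lemma fspan_le_upper X k p m : borel_stable X -> ~~ low p ->
  fspan_le X k m -> fspan_le X k (gact (Em C p) m).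
Proof.
move=> bX up; apply: (lspan_map (gact_linr (M := M) (Em C p))) => _ [w [x [lw wk Xx ->]]].
apply: fspan_le_sub wk _; elim: w lw p up => [|q w IH] /=.
  move=> _ p up; rewrite act_nil; apply: lspan_bind (bX p x up Xx) => y Xy.
  exact: fspan_le_in.
move=> /andP[lq lw] p up; rewrite act_cons gact_bracket; apply: lspanD.
  by apply: fspan_le_low => //; exact: IH.
have any r : fspan_le X (size w).+1 (gact (Em C r) (act w x)).
  have [lr|ur] := boolP (low r); last exact: fspan_le_sub (leqnSn _) (IH lw r ur).
  by apply: fspan_le_low => //; apply: lspan_in; exists w, x.
by rewrite Em_bracket gactDl gactNl !gactZl; apply: lspanB; apply: lspanZ; exact: any.
Qed.

(** This is the factorisation U(gl_n) = U(n_-) U(b): low words on a Borel-stable set already span a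
    submodule. *)
Lemma fspan_gact X x m : borel_stable X -> fspan X m -> fspan X (gact x m).
Proof.
move=> bX /fspan_fspan_le [k mk]; rewrite gact_Em; apply: lspan_sum => p _.
apply/lspanZ/(@fspan_le_fspan _ k.+1); have [lp|up] := boolP (low p).
  exact: fspan_le_low.
exact/(fspan_le_sub (leqnSn k))/fspan_le_upper.
Qed.

Section FSub.
Variables (X : M -> Prop) (bX : borel_stable X).
Definition fsub_pred : {pred M} := fun m => `[< fspan X m >].
Fact fsub_closed : submod_closed fsub_pred.
Proof.
split; first by apply/asboolP; exact: lspan0.
by move=> a u v /asboolP Xu /asboolP Xv; apply/asboolP/lspanD/Xv/lspanZ.
Qed.
Fact fsub_stable x m : m \in fsub_pred -> gact x m \in fsub_pred.
Proof. by move=> /asboolP Xm; apply/asboolP/fspan_gact. Qed.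
Definition fsub : submodule M := SubModule fsub_closed fsub_stable.
End FSub.

Definition wlist := seq (M * 'rV[C]_n).
Definition vecs (xs : wlist) : M -> Prop := fun m => m \in map fst xs.

(* Modulo the span of the tail, the head of the list is a highest weight vector. *)
Fixpoint tri (xs : wlist) : Prop :=
  if xs is x :: ys then
    [/\ is_weight x.2 x.1,
        forall p : letter, (p.1 < p.2)%N -> lspan (vecs ys) (gact (Em C p) x.1) & tri ys]
  else True.

Lemma vecs_sub (xs ys : wlist) m : {subset xs <= ys} -> lspan (vecs xs) m -> lspan (vecs ys) m.
Proof.
by move=> sxy; apply: lspan_sub => p /mapP[x /sxy xy ->]; exact: map_f.
Qed.

Lemma tri_cat xs ys : (forall x, x \in xs -> is_weight x.2 x.1) ->
  (forall x (p : letter), x \in xs -> (p.1 < p.2)%N -> lspan (vecs ys) (gact (Em C p) x.1)) ->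
  tri ys -> tri (xs ++ ys).
Proof.
move=> wx ex ty; elim: xs wx ex => //= x xs IH wx ex; split.
- by apply: wx; exact: mem_head.
- move=> p lp; apply: vecs_sub (ex x p (mem_head _ _) lp) => y.
  by rewrite mem_cat orbC => ->.
apply: IH => [y yxs|y p yxs]; first by apply: wx; rewrite inE yxs orbT.
by apply: ex; rewrite inE yxs orbT.
Qed.

Lemma tri_cat_tri xs ys : tri xs -> tri ys -> tri (xs ++ ys).
Proof.
move=> + ty; elim: xs => //= x xs IH [wx ex tx]; split=> //; last exact: IH.
by move=> p lp; apply: vecs_sub (ex p lp) => y; rewrite mem_cat => ->.
Qed.

Lemma tri_weight xs x : tri xs -> x \in xs -> is_weight x.2 x.1.
Proof.
by elim: xs => // y ys IH /= [wy _ ty]; rewrite inE => /predU1P[->//|]; exact: IH.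
Qed.

Lemma tri_borel xs : tri xs -> borel_stable (vecs xs).
Proof.
elim: xs => // y ys IH /= [wy ey ty] p _ up /mapP[x + ->].
rewrite inE => /predU1P[->|xys]; last first.
  apply: (@vecs_sub ys) => [z zys|]; first by rewrite inE zys orbT.
  by apply: (IH ty p _ up); exact: map_f.
move: up; rewrite /low -leqNgt leq_eqVlt => /orP[|lp]; last first.
  by apply: (@vecs_sub ys) => [z zys|]; [rewrite inE zys orbT | exact: ey].
case: p => i j /= /eqP/val_inj ->; rewrite wy; apply/lspanZ/lspan_in.
exact: mem_head.
Qed.

Fixpoint words_of (k : nat) : seq (seq letter) :=
  if k is l.+1 then [seq p :: w | p <- enum {: letter}, w <- words_of l] else [:: [::]].

Lemma mem_words_of w : w \in words_of (size w).
Proof.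
elim: w => //= p w IH; apply/allpairsP; exists (p, w); split=> //=.
by rewrite mem_enum.
Qed.

Lemma tri_act_weight xs w m : tri xs -> vecs xs m -> exists mu, is_weight mu (act w m).
Proof.
move=> txs /mapP[x xxs ->]; elim: w => [|p w [mu IH]].
  by exists x.2; rewrite act_nil; apply: (tri_weight txs).
by exists (mu + (eps p.1 - eps p.2)); rewrite act_cons; exact: is_weight_Em.
Qed.

Lemma uact_upper_word (X : M -> Prop) w m : (forall (p : letter) m, (p.1 < p.2)%N -> X m -> X (gact (Em C p) m)) ->
  all (fun p : letter => (p.1 < p.2)%N) w -> X m ->
  X (uact (\prod_(p <- w) iota_U (delta_mx p.1 p.2)) m).
Proof.
move=> Xe; elim: w => [|p w IH] /=; first by rewrite big_nil uact1.
move=> /andP[lp lw] Xm; rewrite big_cons uactM uact_iota; apply: (Xe p) => //.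
exact: IH.
Qed.

(** Upper words do not lengthen low words, so U(n_+) m stays in the span of the finitely many low
    words of bounded length applied to the list. *)
Lemma tri_inO xs : tri xs -> (forall m : M, fspan (vecs xs) m) -> inO M.
Proof.
move=> txs Mxs; split.
- exists (map fst xs) => m; apply/fin_genP; apply: lspan_sub (Mxs m) => p [w [x [_ xxs ->]]].
  by exists x => //; exists (word_prod (C := C) (gen (fun=> 0)) w).
- apply/h_semisimpleP => m; apply: lspan_sub (Mxs m) => p [w [x [_ xxs ->]]].
  exact: tri_act_weight xxs.
move=> m; have [k mk] := fspan_fspan_le (Mxs m).
exists (flatten [seq [seq act w x | w <- words_of l, x <- map fst xs] | l <- iota 0 k.+1]).
move=> w lw; apply/listspanP.
have : fspan_le (vecs xs) k (uact (\prod_(p <- w) iota_U (delta_mx p.1 p.2)) m).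
  apply: (uact_upper_word (X := fspan_le (vecs xs) k)) => // p y lp.
  by apply: fspan_le_upper; [exact: tri_borel | rewrite /low -leqNgt ltnW].
apply: lspan_sub => p [v [x [_ vk xxs ->]]].
apply/flatten_mapP; exists (size v); first by rewrite mem_iota.
by apply/allpairsP; exists (v, x); split=> //; exact: mem_words_of.
Qed.

End LowWords.
End Finite.

(** Applying A - d i to the relation eliminates one eigenvector and rescales the others by nonzero
    factors. *)
Lemma eigen_indep (C : fieldType) (V : lmodType C) (A : V -> V) (I : eqType)
    (s : seq I) (d : I -> C) (y : I -> V) :
  linear A -> uniq s -> {in s &, injective d} ->
  (forall i, i \in s -> A (y i) = d i *: y i) -> \sum_(i <- s) y i = 0 ->
  forall i, i \in s -> y i = 0.
Proof.
move=> lA; have A0 : A 0 = 0.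
  by have := lA (-1) 0 0; rewrite !scaleN1r oppr0 addr0 addNr.
have AZ a v : A (a *: v) = a *: A v by have := lA a v 0; rewrite A0 !addr0.
have AD u v : A (u + v) = A u + A v by have := lA 1 u v; rewrite !scale1r.
elim: s y => //= i s IH y /andP[nis us] injd Ay.
have injs : {in s &, injective d}.
  by move=> j k js ks; apply: injd; rewrite inE ?js ?ks orbT.
rewrite big_cons => sum0.
have ys j : j \in s -> y j = 0.
  move=> js; have := IH (fun j => (d j - d i) *: y j) us injs.
  have Ay' : (forall j, j \in s -> A ((d j - d i) *: y j) = d j *: ((d j - d i) *: y j)).
    by move=> k ks; rewrite AZ Ay ?inE ?ks ?orbT // !scalerA mulrC.
  move=> /(_ Ay') h; have : \sum_(j <- s) (d j - d i) *: y j = 0.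
    have := congr1 A sum0; rewrite AD Ay ?mem_head // A0.
    have -> : A (\sum_(j <- s) y j) = \sum_(j <- s) d j *: y j.
      rewrite big_seq [RHS]big_seq; elim/big_rec2: _ => [|k u v ks <-]; first exact: A0.
      by rewrite AD Ay // inE ks orbT.
    move: sum0 => /eqP; rewrite addr_eq0 => /eqP ->; rewrite scalerN addrC scaler_sumr.
    by rewrite -sumrB => e; rewrite -[RHS]e; apply: eq_bigr => k _; rewrite scalerBl.
  move=> /h /(_ j js)/eqP; rewrite scaler_eq0 subr_eq0 => /orP[/eqP/injd|/eqP//].
  rewrite !inE js eqxx orbT => /(_ isT isT) ji.
  by rewrite -ji js in nis.
move: sum0; rewrite big1_seq ?addr0 => [|j /andP[_]]; last exact: ys.
by move=> yi0 j; rewrite inE => /predU1P[->|/ys].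
Qed.

(** * Triangular generators for modules in category O *)

Section TriList.
Variables (C : fieldType) (n : nat).
Hypothesis char0 : forall k, (k%:R == 0 :> C) = (k == 0)%N.
Notation letter := (letter n).
Notation U := (Ualg C n).
Notation eps := (eps C n).
Variable M : glmod C n.

Lemma natr_inj : injective (fun k : nat => k%:R : C).
Proof.
move=> k l; wlog kl : k l / (k <= l)%N => [h|e].
  by case/orP: (leq_total k l) => kl e; [exact: h | apply/esym/h].
apply/eqP; rewrite eqn_leq kl /= -subn_eq0 -char0 natrB //.
by rewrite e subrr.
Qed.

(** A diagonal element with adjoint eigenvalue j - i on E_ij, hence positive on n_+. *)
Definition height_mx : 'M[C]_n := \sum_(i < n) (- (i : nat)%:R) *: Em C (i, i).
Definition height (mu : 'rV[C]_n) : C := \sum_(i < n) (- (i : nat)%:R) * mu 0 i.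

Lemma gact_height mu (m : M) : is_weight mu m -> gact height_mx m = height mu *: m.
Proof.
move=> wm; rewrite gact_suml scaler_suml; apply: eq_bigr => i _.
by rewrite gactZl wm scalerA.
Qed.

Lemma heightD mu nu : height (mu + nu) = height mu + height nu.
Proof. by rewrite /height -big_split; apply: eq_bigr => i _; rewrite mxE mulrDr. Qed.

Lemma height_eps (i j : 'I_n) : (i <= j)%N -> height (eps i - eps j) = (j - i)%:R.
Proof.
have hE (k : 'I_n) : height (eps k) = - (k : nat)%:R.
  rewrite /height (bigD1 k) //= epsE eqxx mulr1 big1 ?addr0 // => l lk.
  by rewrite epsE eq_sym (negbTE lk) mulr0.
have hN mu : height (- mu) = - height mu.
  by rewrite /height -sumrN; apply: eq_bigr => k _; rewrite mxE mulrN.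
by move=> ij; rewrite heightD hN !hE opprK addrC natrB.
Qed.

Definition strict (p : letter) : bool := (p.1 < p.2)%N.
Definition word_wt (w : seq letter) : 'rV[C]_n := \sum_(p <- w) (eps p.1 - eps p.2).

Lemma act_weight mu (v : M) w : is_weight mu v -> is_weight (mu + word_wt w) (act w v).
Proof.
move=> wv; elim: w => [|p w IH]; first by rewrite /word_wt big_nil addr0 act_nil.
rewrite act_cons /word_wt big_cons addrCA addrC; exact: is_weight_Em.
Qed.

Definition rise (w : seq letter) : nat := \sum_(p <- w) (p.2 - p.1).

Lemma height_word w : all strict w -> height (word_wt w) = (rise w)%:R.
Proof.
elim: w => [_|p w IH /= /andP[lp lw]].
  by rewrite /word_wt /rise !big_nil /height big1 // => i _; rewrite mxE mulr0.
by rewrite /word_wt /rise !big_cons heightD height_eps ?(ltnW lp) // natrD -IH.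
Qed.

Lemma rise_drop w k l : all strict w -> (k < l <= size w)%N ->
  (rise (drop l w) < rise (drop k w))%N.
Proof.
elim: w k l => [|p w IH] k [|l] /=; rewrite ?andbF //= => /andP[lp lw].
case: k => [|k]; last by rewrite !ltnS => kl; apply: IH.
have -> : rise (p :: w) = (p.2 - p.1 + rise w)%N by rewrite /rise big_cons.
move=> _.
have le : (rise (drop l w) <= rise w)%N.
  by rewrite -[w in X in (_ <= X)%N](cat_take_drop l) /rise big_cat leq_addl.
by apply: leq_ltn_trans le _; rewrite -{1}[rise w]add0n ltn_add2r subn_gt0.
Qed.

(* Nonzero vectors e_w v of distinct heights are linearly independent. *)
Lemma long_words_vanish mu (v : M) (t : seq M) w : is_weight mu v ->
  (forall w, all strict w -> lspan (fun p => p \in t) (act w v)) ->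
  all strict w -> size w = size t -> act w v = 0.
Proof.
move=> wv tv lw wt; apply/eqP/negP => nz.
(* The suffixes of w applied to v: one vector more than t has entries, of pairwise distinct heights
   by [rise_drop]. *)
pose y (k : 'I_(size t).+1) := act (drop k w) v.
have y0 k : y k != 0.
  apply: contra_notN nz => /eqP yk.
  by rewrite -[w](cat_take_drop k) act_cat -/(y k) yk /act uact0r.
have ld k : all strict (drop k w) by apply/allP => p /mem_drop; exact: (allP lw).
have /choice [c yc] : forall k, exists c : nat -> C, y k = \sum_(i < size t) c i *: t`_i.
  by move=> k; apply/listspanP/tv/ld.
pose A : 'M[C]_((size t).+1, size t) := \matrix_(k, i) c k i.
have : kermx A != 0.
  rewrite -mxrank_eq0 mxrank_ker subn_eq0 -ltnNge ltnS; exact: rank_leq_col.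
rewrite -nz_row_eq0; set a := nz_row _ => a0.
(* There are more rows than columns, so the kernel contains a nonzero row: a linear relation among
   the y k. *)
have /sub_kermxP aA : (a <= kermx A)%MS by exact: nz_row_sub.
case/eqP: a0; apply/rowP => k; rewrite [RHS]mxE; apply/eqP.
have := eigen_indep (gact_linr (M := M) height_mx) (index_enum_uniq _)
  (d := fun k : 'I_(size t).+1 => height mu + (rise (drop k w))%:R) (y := fun k => a 0 k *: y k).
have dinj : {in index_enum ('I_(size t).+1) &, injective
    (fun k : 'I_(size t).+1 => height mu + (rise (drop k w))%:R)}.
  move=> i j _ _ /addrI/natr_inj e; apply/val_inj.
  have [ij|ij|//] := ltngtP (i : nat) j.
    have := @rise_drop w i j lw; rewrite ij wt -ltnS ltn_ord e ltnn => /(_ isT) //.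
  have := @rise_drop w j i lw; rewrite ij wt -ltnS ltn_ord e ltnn => /(_ isT) //.
move=> /(_ dinj); have Ay i : i \in index_enum ('I_(size t).+1) ->
    gact height_mx (a 0 i *: y i) = (height mu + (rise (drop i w))%:R) *: (a 0 i *: y i).
  by rewrite -height_word // -heightD => _; apply/gact_height/is_weightZ/act_weight.
move=> /(_ Ay); have ay0 : \sum_k a 0 k *: y k = 0.
  under eq_bigr do rewrite yc scaler_sumr.
  rewrite exchange_big big1 //= => i _.
  under eq_bigr do rewrite scalerA; rewrite -scaler_suml.
  have -> : \sum_j a 0 j * c j i = (a *m A) 0 i.
    by rewrite mxE; apply: eq_bigr => j _; rewrite mxE.
  by rewrite aA mxE scale0r.
move=> /(_ ay0 k (mem_index_enum _))/eqP; rewrite scaler_eq0 (negbTE (y0 k)) orbF.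
by [].
Qed.

Definition next (L : wlist M) : wlist M :=
  [seq (gact (Em C p) x.1, x.2 + (eps p.1 - eps p.2)) | x <- L, p <- [seq p <- enum {: letter} | strict p]].
(** Each level precedes its images under the raising operators, as [tri] requires. *)
Fixpoint levels k (L : wlist M) : wlist M := if k is l.+1 then L ++ levels l (next L) else L.

Lemma mem_levels k (L : wlist M) : {subset L <= levels k L}.
Proof. by case: k => [|k] //= x; rewrite mem_cat => ->. Qed.

Lemma mem_next (L : wlist M) x p : x \in L -> strict p ->
  (gact (Em C p) x.1, x.2 + (eps p.1 - eps p.2)) \in next L.
Proof.
move=> xL lp; apply/allpairsP; exists (x, p); split=> //=.
by rewrite mem_filter lp mem_enum.
Qed.

Lemma levels_tri k (L : wlist M) : (forall x, x \in L -> is_weight x.2 x.1) ->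
  (forall x, x \in iter k.+1 next L -> x.1 = 0) -> tri (levels k L).
Proof.
elim: k L => [|k IH] L wL zL.
  rewrite /= -[L]cats0; apply: tri_cat => // x p xL lp.
  by have /= -> := zL _ (mem_next xL lp); exact: lspan0.
apply: tri_cat => // [x p xL lp|].
  apply: lspan_in; apply/mapP; exists (gact (Em C p) x.1, x.2 + (eps p.1 - eps p.2)) => //.
  exact/mem_levels/mem_next.
apply: IH => [x|x]; last by rewrite -iterSr; exact: zL.
move=> /allpairsP[[z p] /= [/wL wz _ ->]]; exact: is_weight_Em.
Qed.

Lemma mem_iter_next k mu (v : M) x : x \in iter k next [:: (v, mu)] ->
  exists w, [/\ all strict w, size w = k & x.1 = act w v].
Proof.
elim: k x => [|k IH] x /=.
  by rewrite inE => /eqP ->; exists [::]; rewrite act_nil.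
move=> /allpairsP[[z p] /= [/IH [w [lw sw ->]]]]; rewrite mem_filter => /andP[lp _] ->.
by exists (p :: w); rewrite /= lp lw sw act_cons.
Qed.

Lemma act_strict_word w (m : M) :
  act w m = uact (\prod_(p <- w) iota_U (delta_mx p.1 p.2)) m.
Proof.
by rewrite /act /word_prod; congr uact; apply: eq_bigr => p _; rewrite /gen scale0r subr0.
Qed.

Lemma fspan_uact (X : M -> Prop) (u : U) m : borel_stable X -> fspan X m -> fspan X (uact u m).
Proof.
move=> bX; elim/Ualg_ind: u m => [a|x|u v IHu IHv|u v IHu IHv] m Xm.
- by rewrite uactA; exact: lspanZ.
- by rewrite uact_iota; exact: fspan_gact.
- by rewrite uactD; apply: lspanD; [exact: IHu | exact: IHv].
by rewrite uactM; apply/IHu/IHv.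
Qed.

(** Converse of [tri_inO]. Raising a weight vector repeatedly gives a triangular list, finite
    because long words vanish; the lists of the weight components of the generators are
    concatenated. *)
Theorem inO_tri : inO M -> exists xs : wlist M, tri xs /\ forall m, fspan (vecs xs) m.
Proof.
move=> [[s gens] /h_semisimpleP ss nlf].
have one (v : M) mu : is_weight mu v -> exists2 xs : wlist M, tri xs & vecs xs v.
  move=> wv; have [t tv] := nlf v.
  have {}tv w : all strict w -> lspan (fun p => p \in t) (act w v).
    by move=> /tv tw; apply/listspanP; rewrite act_strict_word.
  exists (levels (size t) [:: (v, mu)]); last first.
    by apply/mapP; exists (v, mu) => //; apply: mem_levels; rewrite mem_head.
  apply: levels_tri => x; first by rewrite inE => /eqP ->.
  (* A word of length [(size t).+1] has a suffix of length [size t], which already kills v. *)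
  case/mem_iter_next=> [[|p w] [lw sw ->]]; first by case: (size t) sw.
  case/andP: lw => _ lw; case: sw => sw.
  by rewrite act_cons (long_words_vanish wv tv) // gact0r.
have gen (m : M) : exists2 xs : wlist M, tri xs & lspan (vecs xs) m.
  elim: (ss m) => [|a p u [mu wp] _ [xs tx xu]]; first by exists [::]; last exact: lspan0.
  have [ys ty yp] := one p mu wp; exists (ys ++ xs); first exact: tri_cat_tri.
  apply: lspanS; first by rewrite /vecs map_cat mem_cat yp.
  by apply: vecs_sub xu => x xx; rewrite mem_cat xx orbT.
have [xs tx xss] : exists2 xs : wlist M, tri xs & forall m, m \in s -> lspan (vecs xs) m.
  elim: (s) => [|m r [xs tx xr]]; first by exists [::].
  have [ys ty ym] := gen m; exists (ys ++ xs); first exact: tri_cat_tri.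
  move=> x; rewrite inE => /predU1P[->|/xr].
    by apply: vecs_sub ym => z zy; rewrite mem_cat zy.
  by apply: vecs_sub => z zx; rewrite mem_cat zx orbT.
exists xs; split=> // m; have /fin_genP := gens m.
apply: lspan_bind => p [x xs_ [u ->]]; apply: fspan_uact; first exact: tri_borel.
by apply: lspan_bind (xss x xs_) => y; exact: fspan_in.
Qed.
End TriList.

(** * Central characters and projection onto blocks *)

Section CentralCharacter.
Variables (C : fieldType) (n : nat).
Hypothesis char0 : forall k, (k%:R == 0 :> C) = (k == 0)%N.
Notation letter := (letter n).
Notation U := (Ualg C n).
Notation eps := (eps C n).
Implicit Types (M : glmod C n) (w : seq letter) (mu : 'rV[C]_n) (z : U).

Lemma low_bracket (p q : letter) : low p -> low q ->
  fam_span (@low n) (gen (fun=> 0))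
    (gen (fun=> 0) p * gen (fun=> 0) q - gen (fun=> 0) q * gen (fun=> 0) p : U).
Proof.
have iE (r : letter) : iota_U (Em C r) = gen (fun=> 0) r by rewrite /gen scale0r subr0.
rewrite gen_bracket Em_bracket /low; case: p q => [i j] [k l] /= ij kl.
have [jk|_] := eqVneq j k; have [li|_] := eqVneq l i.
- by move: ij kl; rewrite jk li; lia.
- rewrite scale1r scale0r subr0 iE; apply: fam_span_in => /=.
  by apply: ltn_trans ij; rewrite jk.
- rewrite scale1r scale0r sub0r linearN /= iE; apply/lspanN/fam_span_in => /=.
  by apply: ltn_trans kl; rewrite li.
by rewrite !scale0r subrr linear0; exact: lspan0.
Qed.

Lemma act_sort M w (m : M) : all (@low n) w ->
  fam_span (fun w' => low_sorted w' && (size w' <= size w)%N) (fun w => act w m) (act w m).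
Proof.
move=> lw; have h := straighten low_bracket (@wle_total n) lw.
apply: (lspan_map (uact_linl m)) h => _ [w' /and4P[lw' sw' ww' _] ->].
by apply: fam_span_in; rewrite /low_sorted sw' lw'.
Qed.

Lemma gen_verma_ideal mu p : ~~ low p -> gen (shift_la mu) p \in verma_ideal mu.
Proof.
case: p => k l; rewrite /low -leqNgt /gen /shift_la /= => kl; apply/asboolP.
exists (fun i j => ((i, j) == (k, l))%:R), (fun i => ((i, i) == (k, l))%:R).
case: (eqVneq k l) kl => [<- _|kl kl'].
  rewrite big1 => [|i _]; last first.
    rewrite big1 // => j ij; rewrite xpair_eqE; case: eqP ij => [->|_ _]; last by rewrite mul0r.
    by case: eqP => [->|_ _]; rewrite ?ltnn // mul0r.
  rewrite add0r (bigD1 k) //= eqxx !mul1r big1 ?addr0 // => i /negbTE ik.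
  by rewrite xpair_eqE ik mul0r.
have {kl'} kl' : (k < l)%N by rewrite ltn_neqAle kl.
rewrite mul0r scale0r subr0 [X in _ + X]big1 ?addr0 => [|i _]; last first.
  by rewrite xpair_eqE; case: eqP => [->|_]; rewrite ?(negbTE kl) mul0r.
rewrite (bigD1 k) //= (bigD1 l) //= eqxx mul1r big1 => [|j /andP[_ /negbTE jl]]; last first.
  by rewrite xpair_eqE jl andbF mul0r.
rewrite addr0 big1 ?addr0 // => i /negbTE ik; apply: big1 => j _.
by rewrite xpair_eqE ik mul0r.
Qed.

Lemma vgen_gen mu p : ~~ low p -> gact (Em C p) (vgen mu) = shift_la mu p *: vgen mu.
Proof.
move=> /(gen_verma_ideal mu)/uact_vgen0; rewrite uact_gen => /eqP.
by rewrite subr_eq0 => /eqP.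
Qed.

Lemma vgen_weight mu : is_weight mu (vgen mu).
Proof. by move=> i; rewrite vgen_gen /low /= ?ltnn // /shift_la eqxx mul1r. Qed.

Lemma vgen_strict mu (p : letter) : (p.1 < p.2)%N -> gact (Em C p) (vgen mu) = 0.
Proof.
move=> p12; rewrite vgen_gen /low -?leqNgt ?(ltnW p12) // /shift_la.
by case: eqP p12 => [->|_ _]; rewrite ?ltnn // mul0r scale0r.
Qed.

Lemma vgen_tri mu : tri [:: (vgen mu, mu)].
Proof.
split=> //; first exact: vgen_weight.
by move=> p /vgen_strict ->; exact: lspan0.
Qed.

Lemma vgen_fspan mu (m : verma mu) : fspan (vecs [:: (vgen mu, mu)]) m.
Proof.
have [u ->] := vgen_span m; apply: fspan_uact; first exact/tri_borel/vgen_tri.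
by apply/fspan_in; rewrite /vecs /= mem_head.
Qed.

Lemma verma_inO mu : inO (verma mu).
Proof. exact: (tri_inO (vgen_tri mu) (@vgen_fspan mu)). Qed.

Lemma vgen_low_span mu (m : verma mu) :
  fam_span (@low_sorted n) (fun w => act w (vgen mu)) m.
Proof.
apply: lspan_bind (vgen_fspan m) => q [w [x [lw]]]; rewrite /vecs /= inE => /eqP -> ->.
by apply: fam_span_sub (act_sort (vgen mu) lw) => w' /andP[].
Qed.

Definition fall (w : seq letter) : nat := \sum_(p <- w) (p.1 - p.2).

Lemma height_low w : all (@low n) w -> height (word_wt C w) = - (fall w)%:R.
Proof.
elim: w => [_|p w IH /= /andP[lp lw]].
  by rewrite /word_wt /fall !big_nil /height big1 ?oppr0 // => i _; rewrite mxE mulr0.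
rewrite /word_wt /fall !big_cons heightD IH // natrD opprD; congr (_ + _).
rewrite -(height_eps C (ltnW lp)) -opprB; set x := eps _ - eps _.
by rewrite /height -sumrN; apply: eq_bigr => i _; rewrite mxE mulrN.
Qed.

Lemma fall_gt0 w : all (@low n) w -> w != [::] -> (0 < fall w)%N.
Proof.
case: w => //= p w /andP[lp _] _; rewrite /fall big_cons addn_gt0 subn_gt0.
by rewrite [X in X || _]lp.
Qed.

Lemma central_gact M z x (m : M) : Ucentral z -> uact z (gact x m) = gact x (uact z m).
Proof. by move=> zc; rewrite -!uact_iota -!uactM zc. Qed.

Lemma central_uact M z u (m : M) : Ucentral z -> uact z (uact u m) = uact u (uact z m).
Proof. by move=> zc; rewrite -!uactM zc. Qed.

(** Since z commutes with [height_mx], z v has the height of v, whereas a nonempty low word strictly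
    lowers the height; so only the empty word occurs in z v. *)
Lemma central_scalar mu z : Ucentral z -> exists c, forall m : verma mu, uact z m = c *: m.
Proof.
move=> zc; suff [c zv] : exists c, uact z (vgen mu) = c *: vgen mu.
  by exists c => m; have [u ->] := vgen_span m; rewrite central_uact // zv uactZr.
have /fam_spanP [ws [c [uws sws e]]] := vgen_low_span (uact z (vgen mu)).
have hv : gact (height_mx C n) (uact z (vgen mu)) = height mu *: uact z (vgen mu).
  by rewrite -central_gact // (gact_height (vgen_weight mu)) uactZr.
have h0 : \sum_(w <- ws) (c w * height (word_wt C w)) *: act w (vgen mu) = 0.
  move: hv; rewrite e gact_sumr scaler_sumr => /eqP; rewrite -subr_eq0 -sumrB => /eqP h.
  rewrite -[RHS]h; apply: eq_bigr => w _; rewrite gactZr.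
  rewrite (gact_height (act_weight w (vgen_weight mu))) heightD scalerDl scalerDr.
  by rewrite !scalerA (mulrC (height mu)) addrC addKr.
have cw w : w \in ws -> w != [::] -> c w = 0.
  move=> wws w0; have := verma_free char0 uws sws h0 wws => /eqP.
  have lw : all (@low n) w by have /andP[] := allP sws w wws.
  rewrite height_low // mulrN oppr_eq0 mulf_eq0 char0 => /orP[/eqP//|/eqP f0].
  by have := fall_gt0 lw w0; rewrite f0.
rewrite e; have [nws|nws] := boolP ([::] \in ws).
  exists (c [::]); rewrite (bigD1_seq [::]) //= act_nil big1_seq ?addr0 // => w /andP[w0 wws].
  by rewrite cw // scale0r.
exists 0; rewrite scale0r big1_seq // => w /= wws; rewrite cw ?scale0r //.
by apply: contraNneq nws => <-.
Qed.

Lemma central_charP mu z : Ucentral z -> forall m : verma mu, uact z m = central_char mu z *: m.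
Proof. by move=> /(central_scalar mu) h; exact: (xgetPex 0 h). Qed.

Lemma central_char_uniq mu z c : Ucentral z -> uact z (vgen mu) = c *: vgen mu ->
  central_char mu z = c.
Proof.
move=> zc; rewrite central_charP // => /eqP; rewrite -subr_eq0 -scalerBl scaler_eq0.
by rewrite (negbTE (vgen_neq0 char0 mu)) orbF subr_eq0 => /eqP.
Qed.

Lemma central_A a : Ucentral (a%:A : U).
Proof. by move=> u; rewrite mulr_algl mulr_algr. Qed.
Lemma central_1 : Ucentral (1 : U).
Proof. by rewrite -[1]scale1r; exact: central_A. Qed.
Lemma centralD z z' : Ucentral z -> Ucentral z' -> Ucentral (z + z').
Proof. by move=> c c' u; rewrite mulrDl mulrDr c c'. Qed.
Lemma centralN z : Ucentral z -> Ucentral (- z).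
Proof. by move=> c u; rewrite mulNr mulrN c. Qed.
Lemma centralB z z' : Ucentral z -> Ucentral z' -> Ucentral (z - z').
Proof. by move=> c /centralN; exact: centralD. Qed.
Lemma centralM z z' : Ucentral z -> Ucentral z' -> Ucentral (z * z').
Proof. by move=> c c' u; rewrite -mulrA c' mulrA c mulrA. Qed.
Lemma centralZ a z : Ucentral z -> Ucentral (a *: z).
Proof. by move=> c u; rewrite -scalerAl -scalerAr c. Qed.
Lemma centralX z k : Ucentral z -> Ucentral (z ^+ k).
Proof.
by move=> c; elim: k => [|k IH]; rewrite ?expr0 ?exprS; [exact: central_1 | exact: centralM].
Qed.
Lemma central_prod (I : Type) (r : seq I) (F : I -> U) :
  (forall i, Ucentral (F i)) -> Ucentral (\prod_(i <- r) F i).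
Proof. by move=> cF; apply: big_ind => //; [exact: central_1 | exact: centralM]. Qed.

Lemma chiA mu a : central_char mu (a%:A : U) = a.
Proof. by apply: central_char_uniq; [exact: central_A | rewrite uactA]. Qed.
Lemma chi1 mu : central_char mu (1 : U) = 1.
Proof. by rewrite -[1 in LHS]scale1r chiA. Qed.
Lemma chiB mu z z' : Ucentral z -> Ucentral z' ->
  central_char mu (z - z') = central_char mu z - central_char mu z'.
Proof.
move=> c c'; apply: central_char_uniq; first exact: centralB.
by rewrite uactB !central_charP // scalerBl.
Qed.
Lemma chiM mu z z' : Ucentral z -> Ucentral z' ->
  central_char mu (z * z') = central_char mu z * central_char mu z'.
Proof.
move=> c c'; apply: central_char_uniq; first exact: centralM.
by rewrite uactM !central_charP // scalerA.
Qed.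
Lemma chiZ mu a z : Ucentral z -> central_char mu (a *: z) = a * central_char mu z.
Proof.
move=> c; apply: central_char_uniq; first exact: centralZ.
by rewrite uactZ central_charP // scalerA.
Qed.
Lemma chi_prod mu (I : Type) (r : seq I) (F : I -> U) : (forall i, Ucentral (F i)) ->
  central_char mu (\prod_(i <- r) F i) = \prod_(i <- r) central_char mu (F i).
Proof.
move=> cF; elim: r => [|i r IH]; first by rewrite !big_nil chi1.
by rewrite !big_cons chiM ?IH //; exact: central_prod.
Qed.

(** The generators of the ideal already send x into the span of X, x being a highest weight vector
    modulo X. *)
Lemma ideal_uact M mu (u : U) (X : M -> Prop) (x : M) : u \in verma_ideal mu ->
  is_weight mu x -> borel_stable X ->
  (forall p : letter, (p.1 < p.2)%N -> fspan X (gact (Em C p) x)) -> fspan X (uact u x).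
Proof.
move=> /asboolP[a [b ->]] wx bX ex; rewrite uactD; apply: lspanD.
  rewrite uact_suml; apply: lspan_sum => i _; rewrite uact_suml; apply: lspan_sum => j ij.
  by rewrite uactM uact_iota; apply: fspan_uact => //; exact: (ex (i, j)).
rewrite uact_suml; apply: lspan_sum => i _.
rewrite uactM uactB uact_iota uactA [gact _ x](wx i) subrr uact0r; exact: lspan0.
Qed.

Lemma central_ideal mu z : Ucentral z -> central_char mu z = 0 -> z \in verma_ideal mu.
Proof. by move=> zc z0; apply/uact_vgen0; rewrite central_charP // z0 scale0r. Qed.

(** As z lies in the Verma ideal of every weight listed, it sends the head of the list into the
    submodule generated by the tail; each application of z removes one head. *)
Lemma tri_central M (xs : wlist M) z : tri xs -> Ucentral z ->
  (forall x, x \in xs -> central_char x.2 z = 0) ->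
  forall m, fspan (vecs xs) m -> uact (z ^+ size xs) m = 0.
Proof.
move=> + zc; elim: xs => [|x ys IH] /=.
  move=> _ _ m; elim=> [|a p u [w [y [_ +]]]]; first by rewrite uact0r.
  by rewrite /vecs.
move=> [wx ex ty] zx m mX; rewrite exprSr uactM; apply: (IH ty).
  by move=> y yys; apply: zx; rewrite inE yys orbT.
apply: (lspan_map (f := uact z)) mX => [a u v|]; first exact: uact_linr.
move=> _ [w [y [lw + ->]]]; rewrite /vecs /= inE /act central_uact // => /predU1P[->|yys].
  apply: fspan_uact; first exact: tri_borel.
  apply: (ideal_uact (mu := x.2)) => //; first by apply: central_ideal => //; apply/zx/mem_head.
    exact: tri_borel.
  by move=> p /ex; apply: lspan_bind => ?; exact: fspan_in.
do 2!(apply: fspan_uact; first exact: tri_borel); exact: fspan_in.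
Qed.

(** * Universal property of Verma modules *)

Section VermaHom.
Variables (M : glmod C n) (mu : 'rV[C]_n) (x : M).
Hypotheses (wx : is_weight mu x) (ex : forall p : letter, (p.1 < p.2)%N -> gact (Em C p) x = 0).

Fact hw_ideal u : u \in verma_ideal mu -> uact u x = 0.
Proof.
move=> uI; have := ideal_uact (X := fun=> False) uI wx (fun _ _ _ h => False_ind _ h).
have e0 : forall p : letter, (p.1 < p.2)%N -> fspan (fun=> False) (gact (Em C p) x).
  by move=> p /ex ->; exact: lspan0.
by move=> /(_ e0); elim=> // a p v [? [? [? []]]].
Qed.

Definition verma_fun (q : verma mu) : M := uact (repr (q : quot_car (verma_sub mu)) : U) x.

Fact verma_fun_pi (u : U) : verma_fun (quot_hom (verma_sub mu) (u : regular_mod C n)) = uact u x.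
Proof.
apply/eqP; rewrite -subr_eq0 -uactB hw_ideal //.
exact: (@repr_quot _ _ _ (verma_sub mu) (u : regular_mod C n)).
Qed.

Fact verma_fun_linear : linear verma_fun.
Proof.
move=> a p q; have [u <-] := @quot_hom_surj _ _ _ (verma_sub mu) p.
have [v <-] := @quot_hom_surj _ _ _ (verma_sub mu) q.
by rewrite -linearP !verma_fun_pi uact_linl.
Qed.
HB.instance Definition _ :=
  GRing.isLinear.Build C (verma mu) M *:%R verma_fun verma_fun_linear.
Fact verma_fun_equiv y q : verma_fun (gact y q) = gact y (verma_fun q).
Proof.
have [u <-] := @quot_hom_surj _ _ _ (verma_sub mu) q.
by rewrite -hequiv !verma_fun_pi [gact y _]/(iota_U y * u) uactM uact_iota.
Qed.
Definition verma_hom : glhom (verma mu) M := GlHom verma_fun_equiv.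

Lemma verma_hom_vgen : verma_hom (vgen mu) = x.
Proof. by rewrite [LHS]verma_fun_pi uact1. Qed.
End VermaHom.
End CentralCharacter.

(** * Closure properties of category O and exactness of the block projections *)

Section Projection.
Variables (C : fieldType) (n : nat).
Hypothesis char0 : forall k, (k%:R == 0 :> C) = (k == 0)%N.
Notation letter := (letter n).
Notation U := (Ualg C n).
Notation glmod := (glmod C n).
Implicit Types (M N : glmod) (mu : 'rV[C]_n) (z : U).

Definition hom_surj M N (f : glhom M N) := forall y, exists x, f x = y.
Definition mses A B D (f : glhom A B) (g : glhom B D) : Prop :=
  [/\ injective f, hom_surj g & forall y, g y = 0 <-> exists x, f x = y].

Lemma hom_weight M N (f : glhom M N) nu m : is_weight nu m -> is_weight nu (f m).
Proof. by move=> wm i; rewrite -hequiv wm linearZ. Qed.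

Lemma hom_vecs M N (f : glhom M N) (xs : wlist M) m : lspan (vecs xs) m ->
  lspan (vecs [seq (f x.1, x.2) | x <- xs]) (f m).
Proof.
apply: (lspan_map (f := f)) => [a u v|_ /mapP[x xxs ->]]; first by rewrite linearP.
by apply: lspan_in; rewrite /vecs -map_comp; apply/mapP; exists x.
Qed.

Lemma tri_hom M N (f : glhom M N) (xs : wlist M) : tri xs -> tri [seq (f x.1, x.2) | x <- xs].
Proof.
elim: xs => //= x ys IH [wx ex ty]; split; [exact: hom_weight | | exact: IH].
by move=> p lp; rewrite -hequiv; apply/hom_vecs/ex.
Qed.

Lemma fspan_hom M N (f : glhom M N) (xs : wlist M) m : fspan (vecs xs) m ->
  fspan (vecs [seq (f x.1, x.2) | x <- xs]) (f m).
Proof.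
apply: (lspan_map (f := f)) => [a u v|_ [w [y [lw /mapP[x xxs ->] ->]]]]; first by rewrite linearP.
apply: lspan_in; exists w, (f x.1); rewrite hom_act; split=> //.
by rewrite /vecs -map_comp; apply/mapP; exists x.
Qed.

Lemma fspan_vecs_sub M (xs ys : wlist M) m : {subset xs <= ys} -> fspan (vecs xs) m -> fspan (vecs ys) m.
Proof.
move=> sxy; apply: lspan_sub => _ [w [y [lw /mapP[x xxs ->] ->]]].
by exists w, x.1; split=> //; apply/map_f/sxy.
Qed.

(** Images of triangular lists concatenate to a triangular list. Quotients, direct sums, copies and
    zero modules are all treated through this. *)
Lemma inO_cover (I : finType) (Ms : I -> glmod) N (f : forall i, glhom (Ms i) N) :
  (forall i, inO (Ms i)) -> (forall y, lspan (fun p => exists i m, p = f i m) y) -> inO N.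
Proof.
move=> Oi cov; have /choice [xs xsP] : forall i, exists xs : seq (N * 'rV[C]_n),
    tri xs /\ forall m, fspan (vecs xs) (f i m).
  move=> i; have [xs [tx gx]] := inO_tri char0 (Oi i).
  exists [seq (f i x.1, x.2) | x <- xs]; split; first exact: tri_hom.
  by move=> m; apply/fspan_hom/gx.
have [ys [ty gy]] : exists ys : wlist N, tri ys /\ forall i, i \in enum I ->
    forall m, fspan (vecs ys) (f i m).
  elim: (enum I) => [|i s [ys [ty gy]]]; first by exists [::].
  exists (xs i ++ ys); split; first by apply: tri_cat_tri => //; case: (xsP i).
  move=> j; rewrite inE => /predU1P[->|js] m.
    by apply: fspan_vecs_sub (proj2 (xsP i) m) => x; rewrite mem_cat => ->.
  by apply: fspan_vecs_sub (gy j js m) => x; rewrite mem_cat orbC => ->.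
apply: (tri_inO ty) => y; apply: lspan_bind (cov y) => _ [i [m ->]].
by apply: gy; rewrite mem_enum.
Qed.

Lemma hom_loc_nilp M N (f : glhom M N) (th : U -> C) m : loc_nilp th m -> loc_nilp th (f m).
Proof. by move=> h z /h[k hk]; exists k; rewrite -hom_uact hk linear0. Qed.

Lemma loc_nilp_inj M N (f : glhom M N) (th : U -> C) m :
  injective f -> loc_nilp th (f m) -> loc_nilp th m.
Proof.
move=> fi h z /h[k hk]; exists k; apply: fi; rewrite hom_uact hk.
by rewrite linear0.
Qed.

Lemma loc_nilp_span M (th : U -> C) (X : M -> Prop) m :
  (forall x, X x -> loc_nilp th x) -> lspan X m -> loc_nilp th m.
Proof.
move=> hX; elim=> [z _|a p v Xp _ IH]; first by exists 0%N; rewrite uact0r.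
apply/asboolP; apply: (proj2 (comp_closed th M)); apply/asboolP; [exact: hX | exact: IH].
Qed.

Lemma inO_char_cover (I : finType) (Ms : I -> glmod) N (f : forall i, glhom (Ms i) N) th :
  (forall i, inO_char th (Ms i)) -> (forall y, lspan (fun p => exists i m, p = f i m) y) ->
  inO_char th N.
Proof.
move=> Oi cov; split; first by apply: (inO_cover (fun i => proj1 (Oi i)) cov).
move=> y; apply: loc_nilp_span (cov y) => _ [i [m ->]].
exact/hom_loc_nilp/(proj2 (Oi i)).
Qed.

Lemma inO_surj M N (f : glhom M N) : hom_surj f -> inO M -> inO N.
Proof.
move=> sf OM; apply: (inO_cover (I := unit) (f := fun=> f)) => // y.
by have [x <-] := sf y; apply: lspan_in; exists tt, x.
Qed.

Lemma inO_char_zero th M : (forall m : M, m = 0) -> inO_char th M.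
Proof.
(* A zero module is covered by the empty family. *)
move=> M0; apply: (inO_char_cover (I := void) (f := fun=> hom_id M)) => [[]|y].
by rewrite (M0 y); exact: lspan0.
Qed.

(** If a listed weight nu has a character other than that of mu, some z separates them, and a
    normalised z - chi_nu(z) has value 1 at mu and 0 at nu. The product e of these factors has value
    0 or 1 at each listed weight, and 1 only where the character is that of mu. So (z - chi_mu(z)) e
    and e (1 - e) vanish at all listed weights and are nilpotent by [tri_central]. *)
Lemma block_idempotent M mu : inO M -> exists e r, [/\ Ucentral e, central_char mu e = 1,
  forall z (m : M), Ucentral z -> uact ((z - (central_char mu z)%:A) ^+ r * e ^+ r) m = 0
  & forall m : M, uact ((e * (1 - e)) ^+ r) m = 0].
Proof.
move=> /(inO_tri char0) [xs [tx gx]].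
have /choice [f fP] : forall nu : 'rV[C]_n, exists f : U, [/\ Ucentral f, central_char mu f = 1 &
    central_char nu f = 0 \/ forall z, Ucentral z -> central_char nu z = central_char mu z].
  move=> nu; have [[z [zc zd]]|same] := pselect (exists z, Ucentral z /\ central_char nu z <> central_char mu z).
    have d0 : central_char mu z - central_char nu z != 0.
      by rewrite subr_eq0 eq_sym; apply/eqP.
    have cA := @central_A C n (central_char nu z).
    exists ((central_char mu z - central_char nu z)^-1 *: (z - (central_char nu z)%:A)).
    split; first exact/centralZ/centralB.
      by rewrite chiZ ?chiB ?chiA ?mulVf //; exact: centralB.
    by left; rewrite chiZ ?chiB ?chiA ?subrr ?mulr0 //; exact: centralB.
  exists 1; split; [exact: central_1 | exact: chi1 |].
  by right=> z zc; apply: contra_notP same => zd; exists z.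
have fc nu : Ucentral (f nu) by case: (fP nu).
pose e : U := \prod_(x <- xs) f x.2.
have ec : Ucentral e by apply: central_prod.
have e1 : central_char mu e = 1.
  by rewrite /e chi_prod // big1 // => x _; case: (fP x.2).
have ex x : x \in xs -> central_char x.2 e = 0 \/
    central_char x.2 e = 1 /\ forall z, Ucentral z -> central_char x.2 z = central_char mu z.
  move=> xxs; case: (fP x.2) => _ _ [f0|same]; last by right; rewrite same.
  by left; rewrite /e chi_prod // (big_rem x) //= f0 mul0r.
have ec' : Ucentral (1 - e) by apply: centralB => //; exact: central_1.
exists e, (size xs); split=> // [z m zc|m].
  have zc' : Ucentral (z - (central_char mu z)%:A) by apply: centralB => //; exact: central_A.
  rewrite -exprMn_comm; last exact: zc'.
  apply: (tri_central char0 tx) => //; first exact: centralM.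
  move=> x /ex; rewrite chiM // chiB //; last exact: central_A.
  by rewrite chiA //; case=> [->|[_ ->//]]; rewrite ?mulr0 // subrr mul0r.
apply: (tri_central char0 tx) => //; first exact: centralM.
move=> x /ex; rewrite chiM // chiB //; last exact: central_1.
by rewrite chi1 //; case=> [->|[-> _]]; rewrite ?mul0r // subrr mulr0.
Qed.

(** On y the element e would be both nilpotent and unipotent. *)
Lemma unipotent_nilpotent M (e : U) r k (y : M) :
  uact (e ^+ r) y = 0 -> uact ((e - 1) ^+ k) y = 0 -> y = 0.
Proof.
elim: k y => [|k IH] y; first by rewrite expr0 uact1.
move=> er; rewrite exprSr uactM => /IH h.
have : uact (e - 1) y = 0.
  apply: h; rewrite -uactM; have -> : e ^+ r * (e - 1) = (e - 1) * e ^+ r.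
    by rewrite mulrBr mulrBl mulr1 mul1r -exprSr -exprS.
  by rewrite uactM er uact0r.
rewrite uactB uact1 => /eqP; rewrite subr_eq0 => /eqP ey.
have ey' s : uact (e ^+ s) y = y.
  by elim: s => [|s IHs]; rewrite ?expr0 ?uact1 // exprSr uactM ey.
by rewrite -(ey' r).
Qed.

(** The e of [block_idempotent] is idempotent only up to nilpotents, so p = 1 - (1 - e^r)^r is used.
    It is a multiple of e^r, whence its image lies in the block, and 1 - p is a multiple of (1 -
    e)^r, which kills the block. The clause about quotients N of M gives right exactness of the
    projection. *)
Theorem block_projector M mu : inO M -> exists p, [/\ Ucentral p,
  forall m : M, loc_nilp (central_char mu) (uact p m)
  & forall N (g : glhom M N), hom_surj g ->
      forall y : N, loc_nilp (central_char mu) y -> uact p y = y].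
Proof.
move=> /(block_idempotent mu) [e [r [ec e1 ze ee]]].
have ec' : Ucentral (1 - e) by apply: centralB => //; exact: central_1.
have geom (x : U) k : 1 - x ^+ k = (1 - x) * \sum_(i < k) x ^+ i.
  by rewrite -opprB subrX1 -mulNr opprB.
have cgeom (x : U) k : Ucentral x -> Ucentral (\sum_(i < k) x ^+ i).
  move=> xc; apply: big_ind => [u|u v|i _]; first by rewrite mul0r mulr0.
    exact: centralD.
  exact: centralX.
have c1er : Ucentral (1 - e ^+ r) by apply: centralB; [exact: central_1 | exact: centralX].
exists (1 - (1 - e ^+ r) ^+ r); split.
- by apply: centralB; [exact: central_1 | exact: centralX].
- move=> m z zc; exists r; rewrite -uactM (geom (1 - e ^+ r)) subKr mulrA uactM ze //.
move=> N g sg y hy; rewrite uactB uact1 geom exprMn_comm; last exact: ec'.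
rewrite centralX // uactM; suff -> : uact ((1 - e) ^+ r) y = 0 by rewrite uact0r subr0.
(* On (1 - e)^r y the power e^r vanishes, N being a quotient of M, and e - 1 is nilpotent because
   chi_mu(e) = 1. *)
have [k hk] := hy e ec; rewrite e1 scale1r in hk.
apply: (@unipotent_nilpotent _ e r k).
  by rewrite -uactM -exprMn_comm; [have [x <-] := sg y; rewrite -hom_uact ee linear0 | exact: ec].
by rewrite -uactM -(centralX r ec') uactM hk uact0r.
Qed.

Section SubIncl.
Variables (M : glmod) (S : submodule M).
Definition sub_incl_fun (m : sub_mod S) : M := sub_val m.
Fact sub_incl_linear : linear sub_incl_fun. Proof. by []. Qed.
HB.instance Definition _ :=
  GRing.isLinear.Build C (sub_mod S) M *:%R sub_incl_fun sub_incl_linear.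
Fact sub_incl_equiv x m : sub_incl_fun (gact x m) = gact x (sub_incl_fun m).
Proof. by []. Qed.
Definition sub_incl : glhom (sub_mod S) M := GlHom sub_incl_equiv.
Lemma sub_incl_inj : injective sub_incl.
Proof. exact: val_inj. Qed.
Lemma sub_inclP m : sub_incl m \in subP S.
Proof. exact: sub_valP. Qed.
Lemma sub_incl_onto m : m \in subP S -> exists m', sub_incl m' = m.
Proof. by move=> Sm; exists (SubCar Sm). Qed.
End SubIncl.

Section CoRestrict.
Variables (M N : glmod) (S : submodule N) (f : glhom M N).
Hypothesis fS : forall m, f m \in subP S.
Definition corestr_fun (m : M) : sub_mod S := SubCar (fS m).
Fact corestr_linear : linear corestr_fun.
Proof. by move=> a u v; apply: val_inj; rewrite /= linearP. Qed.
HB.instance Definition _ :=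
  GRing.isLinear.Build C M (sub_mod S) *:%R corestr_fun corestr_linear.
Fact corestr_equiv x m : corestr_fun (gact x m) = gact x (corestr_fun m).
Proof. by apply: val_inj; rewrite /= hequiv. Qed.
Definition corestr : glhom M (sub_mod S) := GlHom corestr_equiv.
End CoRestrict.

Section CentralHom.
Variables (M : glmod) (p : U) (pc : Ucentral p).
Fact central_linear : linear (fun m : M => uact p m).
Proof. by move=> a u v; exact: uact_linr. Qed.
Definition central_fun (m : M) : M := uact p m.
HB.instance Definition _ :=
  GRing.isLinear.Build C M M *:%R central_fun central_linear.
Fact central_equiv x m : central_fun (gact x m) = gact x (central_fun m).
Proof. exact: central_gact. Qed.
Definition central_hom : glhom M M := GlHom central_equiv.
End CentralHom.

(** The block is a submodule by definition; the projector presents it as a quotient, to which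
    [inO_surj] applies. *)
Lemma proj_quotient M mu : inO M -> exists g : glhom M (proj_mod (central_char mu) M), hom_surj g.
Proof.
move=> OM; have [p [pc pm py]] := block_projector mu OM.
have pS m : central_hom M pc m \in subP (comp_sub (central_char mu) M).
  by apply/asboolP/pm.
exists (corestr pS) => y; exists (sub_incl _ y); apply: val_inj => /=.
apply: (py M (hom_id M)); first by move=> x; exists x.
by have /asboolP := sub_valP y.
Qed.

Lemma proj_loc_nilp M th (m : proj_mod th M) : loc_nilp th m.
Proof.
apply: (loc_nilp_inj (@sub_incl_inj M (comp_sub th M))).
by have /asboolP := sub_valP m.
Qed.

Lemma proj_inO M mu : inO M -> inO_char (central_char mu) (proj_mod (central_char mu) M).
Proof.
move=> OM; have [g sg] := proj_quotient mu OM.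
by split; [exact: inO_surj sg OM | exact: proj_loc_nilp].
Qed.

Lemma proj_exact A B D (f : glhom A B) (g : glhom B D) mu : inO B -> mses f g ->
  mses (proj_map (central_char mu) f) (proj_map (central_char mu) g).
Proof.
move=> OB [fi gs mid]; have [p [pc pm py]] := block_projector mu OB; split.
- by move=> x y /(congr1 val) /= /fi /val_inj.
- move=> y; have [b bE] := gs (val y).
  have pS m : central_hom B pc m \in subP (comp_sub (central_char mu) B).
    by apply/asboolP/pm.
  (* A lift of y is projected into the block; its image is still y since p fixes the block of D. *)
  exists (corestr pS b); apply: val_inj => /=.
  rewrite /central_fun hom_uact bE; apply: (py D g) => //.
  by have /asboolP := sub_valP y.
move=> y; split=> [/(congr1 val) /= /mid [x xE]|[x <-]]; last first.
  by apply: val_inj => /=; apply/mid; exists (val x).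
have xS : x \in subP (comp_sub (central_char mu) A).
  apply/asboolP/(loc_nilp_inj fi); rewrite xE.
  by have /asboolP := sub_valP y.
by exists (SubCar xS); apply: val_inj.
Qed.

Lemma tens_exact (V : vectType C) (rV : rep n V) A B D (f : glhom A B) (g : glhom B D) :
  mses f g -> mses (tens_map rV f) (tens_map rV g).
Proof.
move=> [fi gs mid]; split.
- move=> x y /ffunP xy; apply/ffunP => i; apply: fi.
  by have := xy i; rewrite !ffunE.
- move=> y; have /choice [x xE] : forall i, exists x, g x = y i by move=> i; exact: gs.
  by exists [ffun i => x i]; apply/ffunP => i; rewrite !ffunE.
move=> y; split=> [/ffunP y0|[x <-]]; last first.
  by apply/ffunP => i; rewrite !ffunE; apply/mid; exists (x i).
have /choice [x xE] : forall i, exists x, f x = y i.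
  by move=> i; apply/mid; have := y0 i; rewrite !ffunE.
by exists [ffun i => x i]; apply/ffunP => i; rewrite !ffunE.
Qed.

Lemma copies_exact k A B D (f : glhom A B) (g : glhom B D) :
  mses f g -> mses (copies_map k f) (copies_map k g).
Proof.
move=> [fi gs mid]; split.
- move=> x y /ffunP xy; apply/ffunP => i; apply: fi.
  by have := xy i; rewrite !ffunE.
- move=> y; have /choice [x xE] : forall i, exists x, g x = y i by move=> i; exact: gs.
  by exists [ffun i => x i]; apply/ffunP => i; rewrite !ffunE.
move=> y; split=> [/ffunP y0|[x <-]]; last first.
  by apply/ffunP => i; rewrite !ffunE; apply/mid; exists (x i).
have /choice [x xE] : forall i, exists x, f x = y i.
  by move=> i; apply/mid; have := y0 i; rewrite !ffunE.
by exists [ffun i => x i]; apply/ffunP => i; rewrite !ffunE.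
Qed.

Lemma dsum_exact A B D A' B' D' (f : glhom A B) (g : glhom B D)
    (f' : glhom A' B') (g' : glhom B' D') :
  mses f g -> mses f' g' -> mses (dsum_map f f') (dsum_map g g').
Proof.
move=> [fi gs mid] [fi' gs' mid']; split.
- by move=> [x x'] [y y'] [/fi -> /fi' ->].
- by move=> [y y']; have [x <-] := gs y; have [x' <-] := gs' y'; exists (x, x').
move=> [y y']; split=> [[/mid [x <-] /mid' [x' <-]]|[[x x'] [<- <-]]].
  by exists (x, x').
by congr pair; [apply/mid; exists x | apply/mid'; exists x'].
Qed.

(** * Direct sums and copies *)

Section Injections.
Variables A B : glmod.
Definition dinl_fun (a : A) : dsum A B := (a, 0).
Fact dinl_linear : linear dinl_fun.
Proof. by move=> c u v; congr pair; rewrite /= scaler0 addr0. Qed.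
HB.instance Definition _ := GRing.isLinear.Build C A (dsum A B) *:%R dinl_fun dinl_linear.
Fact dinl_equiv x a : dinl_fun (gact x a) = gact x (dinl_fun a).
Proof. by congr pair; rewrite /= gact0r. Qed.
Definition dinl : glhom A (dsum A B) := GlHom dinl_equiv.
Definition dinr_fun (b : B) : dsum A B := (0, b).
Fact dinr_linear : linear dinr_fun.
Proof. by move=> c u v; congr pair; rewrite /= scaler0 addr0. Qed.
HB.instance Definition _ := GRing.isLinear.Build C B (dsum A B) *:%R dinr_fun dinr_linear.
Fact dinr_equiv x a : dinr_fun (gact x a) = gact x (dinr_fun a).
Proof. by congr pair; rewrite /= gact0r. Qed.
Definition dinr : glhom B (dsum A B) := GlHom dinr_equiv.
Definition dsnd_fun (p : dsum A B) : B := p.2.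
Fact dsnd_linear : linear dsnd_fun. Proof. by []. Qed.
HB.instance Definition _ := GRing.isLinear.Build C (dsum A B) B *:%R dsnd_fun dsnd_linear.
Fact dsnd_equiv x a : dsnd_fun (gact x a) = gact x (dsnd_fun a). Proof. by []. Qed.
Definition dsnd : glhom (dsum A B) B := GlHom dsnd_equiv.

Lemma dsum_mses : mses dinl dsnd.
Proof.
split=> [x y [//]|y|[a b]]; first by exists (0, y).
by split=> [/= ->|[x [_ <-]]//]; exists a.
Qed.

Lemma dsum_inO_char th : inO_char th A -> inO_char th B -> inO_char th (dsum A B).
Proof.
move=> OA OB; apply: (inO_char_cover (I := bool) (Ms := fun b => if b then A else B)
  (f := fun b => if b return glhom (if b then A else B) _ then dinl else dinr)) => [[]//|[a b]].
have -> : (a, b) = dinl a + dinr b by congr pair; rewrite /= ?addr0 ?add0r.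
by apply: lspanD; apply: lspan_in; [exists true, a | exists false, b].
Qed.
End Injections.

Section CopyInjections.
Variables (k : nat) (A : glmod) (i : 'I_k).
Definition copy_fun (a : A) : copies k A := [ffun j => (j == i)%:R *: a].
Fact copy_linear : linear copy_fun.
Proof.
by move=> c u v; apply/ffunP => j; rewrite !ffunE scalerDr !scalerA mulrC.
Qed.
HB.instance Definition _ := GRing.isLinear.Build C A (copies k A) *:%R copy_fun copy_linear.
Fact copy_equiv x a : copy_fun (gact x a) = gact x (copy_fun a).
Proof. by apply/ffunP => j; rewrite !ffunE gactZr. Qed.
Definition copy : glhom A (copies k A) := GlHom copy_equiv.
End CopyInjections.

Lemma copies_inO_char k (A : glmod) th : inO_char th A -> inO_char th (copies k A).
Proof.
move=> OA; apply: (inO_char_cover (f := fun i : 'I_k => copy A i)) => // y.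
have -> : y = \sum_i copy A i (y i).
  apply/ffunP => j; rewrite sum_ffunE (bigD1 j) //= ffunE eqxx scale1r big1 ?addr0 // => i.
  by rewrite ffunE eq_sym => /negbTE ->; rewrite scale0r.
by apply: lspan_sum => i _; apply: lspan_in; exists i, (y i).
Qed.
End Projection.

(** * Tensor products with a Verma module *)

Section TensorWeights.
Variables (C : fieldType) (n : nat).
Hypothesis char0 : forall k, (k%:R == 0 :> C) = (k == 0)%N.
Notation letter := (letter n).
Notation U := (Ualg C n).
Notation glmod := (glmod C n).
Variables (V : vectType C) (rV : rep n V).

Section Pure.
Variable M : glmod.
Definition pure (v : V) (m : M) : tens rV M := [ffun i => coord (vbasis {:V}) i v *: m].

Lemma pure_linl m a u v : pure (a *: u + v) m = a *: pure u m + pure v m.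
Proof. by apply/ffunP => i; rewrite !ffunE linearP scalerDl scalerA. Qed.
Lemma pure_linr v a (m m' : M) : pure v (a *: m + m') = a *: pure v m + pure v m'.
Proof. by apply/ffunP => i; rewrite !ffunE scalerDr !scalerA mulrC. Qed.
Lemma pure0l m : pure 0 m = 0.
Proof. by apply/ffunP => i; rewrite !ffunE linear0 scale0r. Qed.
Lemma pure0r v : pure v 0 = 0.
Proof. by apply/ffunP => i; rewrite !ffunE scaler0. Qed.
Lemma pureZr v a (m : M) : pure v (a *: m) = a *: pure v m.
Proof. by have := pure_linr v a m 0; rewrite pure0r !addr0. Qed.
Lemma pureZl v a (m : M) : pure (a *: v) m = a *: pure v m.
Proof. by have := pure_linl m a v 0; rewrite pure0l !addr0. Qed.
Lemma pureDr v (m m' : M) : pure v (m + m') = pure v m + pure v m'.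
Proof. by have := pure_linr v 1 m m'; rewrite !scale1r. Qed.
Lemma pure_suml (I : Type) (r : seq I) (F : I -> V) m :
  pure (\sum_(i <- r) F i) m = \sum_(i <- r) pure (F i) m.
Proof.
elim/big_rec2: _ => [|i u v _ <-]; first exact: pure0l.
by have := pure_linl m 1 (F i) v; rewrite !scale1r.
Qed.

Lemma gact_pure x v m : gact x (pure v m) = pure v (gact x m) + pure (rV x v) m.
Proof.
apply/ffunP => j; rewrite !ffunE gactZr; congr (_ + _).
rewrite ract_coord linear_sum scaler_suml; apply: eq_bigr => i _.
by rewrite linearZ ffunE scalerA /= mulrC.
Qed.
End Pure.

Variables (I : finType) (e : I -> V) (co : I -> V -> C) (wt : I -> 'rV[C]_n) (h : I -> nat).
Hypothesis co_linear : forall i a u v, co i (a *: u + v) = a * co i u + co i v.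
Hypothesis co_basis : forall i j, co i (e j) = (i == j)%:R.
Hypothesis co_expand : forall v, v = \sum_i co i v *: e i.
Hypothesis e_weight : forall i k, rV (Em C (k, k)) (e i) = wt i 0 k *: e i.
Hypothesis e_strict : forall i (p : letter), (p.1 < p.2)%N ->
  lspan (fun u => exists2 j, (h j < h i)%N & u = e j) (rV (Em C p) (e i)).

Lemma co_sum i (J : Type) (r : seq J) (a : J -> C) (F : J -> V) :
  co i (\sum_(j <- r) a j *: F j) = \sum_(j <- r) a j * co i (F j).
Proof.
elim/big_rec2: _ => [|j u v _ <-]; last exact: co_linear.
by have := co_linear i (-1) 0 0; rewrite scaler0 addr0 mulN1r addNr.
Qed.

Section TensM.
Variable M : glmod.
Notation N := (tens rV M).

(** Tensors are stored in coordinates on [vbasis]; this is the change to the weight basis e. *)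
Definition tco i (f : N) : M := \sum_(l < \dim {:V}) co i (vbasis {:V})`_l *: f l.

Lemma tco_linear i : linear (tco i).
Proof.
move=> a f g; rewrite /tco scaler_sumr -big_split /=; apply: eq_bigr => l _.
by rewrite !ffunE scalerDr !scalerA mulrC.
Qed.

Lemma tco0 i : tco i 0 = 0.
Proof. by have := tco_linear i (-1) 0 0; rewrite !scaleN1r oppr0 addr0 addNr. Qed.
Lemma tcoD i f g : tco i (f + g) = tco i f + tco i g.
Proof. by have := tco_linear i 1 f g; rewrite !scale1r. Qed.
Lemma tcoB i f g : tco i (f - g) = tco i f - tco i g.
Proof. by have := tco_linear i (-1) g f; rewrite !scaleN1r ![- _ + _]addrC. Qed.

Lemma tco_pure i v m : tco i (pure v m) = co i v *: m.
Proof.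
rewrite {2}[v](coord_vbasis (memvf v)) co_sum scaler_suml; apply: eq_bigr => l _.
by rewrite ffunE scalerA mulrC.
Qed.

Lemma tens_expand (f : N) : f = \sum_i pure (e i) (tco i f).
Proof.
have fE : f = \sum_(l < \dim {:V}) pure (vbasis {:V})`_l (f l).
  apply/ffunP => j; rewrite sum_ffunE (bigD1 j) //= ffunE coord_free ?(basis_free (vbasisP _)) //.
  rewrite eqxx scale1r big1 ?addr0 // => l lj.
  by rewrite ffunE coord_free ?(basis_free (vbasisP _)) // (negbTE lj) scale0r.
rewrite {1}fE; under eq_bigr => l _ do rewrite [(vbasis _)`_l]co_expand pure_suml.
rewrite exchange_big; apply: eq_bigr => i _.
rewrite /tco; elim/big_rec2: _ => [|l u v _ ->]; first by rewrite pure0r.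
by rewrite pureDr pureZl pureZr.
Qed.

Lemma pure_weight i mu (m : M) : is_weight mu m -> is_weight (mu + wt i) (pure (e i) m).
Proof.
by move=> wm k; rewrite gact_pure wm pureZr e_weight pureZl -scalerDl mxE.
Qed.

Definition tens_list (ys : wlist M) (js : seq I) : wlist N :=
  flatten [seq [seq (pure (e i) y.1, y.2 + wt i) | y <- ys] | i <- js].

(** By [e_strict], raising operators then send e i into the span of vectors with later indices. *)
Fixpoint closed_below (js : seq I) : Prop :=
  if js is i :: js' then (forall j, (h j < h i)%N -> j \in js') /\ closed_below js' else True.

Lemma tens_list_vec ys js i y : vecs ys y -> i \in js -> vecs (tens_list ys js) (pure (e i) y).
Proof.
move=> /mapP[z zys ->] ijs; rewrite /vecs; apply/mapP; exists (pure (e i) z.1, z.2 + wt i) => //.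
by apply/flatten_mapP; exists i => //; exact: map_f.
Qed.

(** In E_p (e_i ⊗ y) = e_i ⊗ E_p y + E_p e_i ⊗ y the first term lies later in the block of i, the
    second in later blocks. *)
Lemma tens_list_tri ys js : tri ys -> closed_below js -> tri (tens_list ys js).
Proof.
move=> ty; elim: js => //= i js IH [hi cj]; rewrite /tens_list /= -/(tens_list ys js).
have {IH} tj := IH cj.
suff block (zs : wlist M) : {subset zs <= ys} -> tri zs ->
    tri ([seq (pure (e i) y.1, y.2 + wt i) | y <- zs] ++ tens_list ys js) by exact: block.
elim: zs => // y zs IH sub [wy ey tz]; split.
- exact: pure_weight.
- move=> p lp; rewrite gact_pure; apply: lspanD; last first.
    apply: (lspan_map (f := fun v => pure v y.1)) (e_strict i lp) => [a u v|_ [j ji ->]].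
      exact: pure_linl.
    apply: (@vecs_sub _ _ _ (tens_list ys js)) => [x|]; first by rewrite mem_cat orbC => ->.
    apply/lspan_in/tens_list_vec; last exact: hi.
    by apply/map_f/sub/mem_head.
  apply: (lspan_map (f := pure (e i))) (ey p lp) => [a u v|_ /mapP[z zz ->]]; first exact: pure_linr.
  apply: lspan_in; apply/mapP; exists (pure (e i) z.1, z.2 + wt i) => //.
  by rewrite mem_cat; apply/orP; left; exact: (map_f (fun y => (pure (e i) y.1, y.2 + wt i))).
by apply: IH => // z zz; apply: sub; rewrite inE zz orbT.
Qed.

(** The identity u ⊗ E_q m = E_q (u ⊗ m) - E_q u ⊗ m strips a word of its letters at the price of
    changing u, so the induction runs over all vectors of V. *)
Lemma tens_list_gen ys js : tri ys -> closed_below js -> (forall i, i \in js) ->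
  (forall m, fspan (vecs ys) m) -> forall f : N, fspan (vecs (tens_list ys js)) f.
Proof.
move=> ty cj allj gy f; have bX := tri_borel (tens_list_tri ty cj).
rewrite (tens_expand f); apply: lspan_sum => i _; move: (tco i f) (e i) => m v.
elim: (gy m) v => [|a p u [w [y [_ yy ->]]] _ IH] v; first by rewrite pure0r; exact: lspan0.
rewrite pure_linr; apply: lspanD (IH v); apply: lspanZ.
elim: w v => [|q w IHw] v.
  rewrite act_nil [v]co_expand pure_suml; apply: lspan_sum => j _.
  by rewrite pureZl; apply/lspanZ/fspan_in/tens_list_vec.
rewrite act_cons; have -> : pure v (gact (Em C q) (act w y)) =
    gact (Em C q) (pure v (act w y)) - pure (rV (Em C q) v) (act w y).
  by rewrite gact_pure addrK.
by apply: lspanB => //; exact: fspan_gact.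
Qed.

Definition by_height : seq I := sort (fun i j => (h j <= h i)%N) (enum I).

Lemma mem_by_height i : i \in by_height.
Proof. by rewrite mem_sort mem_enum. Qed.

Lemma by_height_uniq : uniq by_height.
Proof. by rewrite sort_uniq enum_uniq. Qed.

Lemma by_height_closed : closed_below by_height.
Proof.
have tr : transitive (fun i j => (h j <= h i)%N) by move=> i j k ij jk; exact: leq_trans jk ij.
have : sorted (fun i j => (h j <= h i)%N) by_height.
  by apply: sort_sorted => i j; exact: leq_total.
suff tail s js : (forall i, i \in s ++ js) -> sorted (fun i j => (h j <= h i)%N) (s ++ js) ->
    closed_below js.
  by apply: (tail [::]); exact: mem_by_height.
elim: js s => //= i js IH s allj st; split; last first.
  by rewrite -cat_rcons in allj st; exact: IH st.
move=> j ji; have := allj j; rewrite mem_cat inE => /orP[js'|/predU1P[je|//]].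
  have := st; rewrite (sorted_pairwise tr) pairwise_cat => /and3P[/allrelP/(_ j i js' (mem_head _ _))].
  by rewrite leqNgt ji.
by rewrite je ltnn in ji.
Qed.

Lemma tens_inO : inO M -> inO N.
Proof.
move=> /(inO_tri char0) [ys [ty gy]].
apply: (tri_inO (tens_list_tri ty by_height_closed)).
exact: (tens_list_gen ty by_height_closed mem_by_height gy).
Qed.
End TensM.

(** * Freeness of V ⊗ M(la) over U(n_-) *)

Section TensVerma.
Variable la : 'rV[C]_n.
Notation M := (verma la).
Notation N := (tens rV M).
Notation v := (vgen la).

Definition below k : M -> Prop :=
  fam_span (fun w => low_sorted w && (size w < k)%N) (fun w => act w v).
Definition tbelow k (t : N) := forall i, below k (tco i t).

Lemma below_act k w : all (@low n) w -> (size w < k)%N -> below k (act w v).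
Proof.
move=> lw wk; apply: fam_span_sub (act_sort v lw) => w' /andP[-> w'w].
exact: leq_ltn_trans wk.
Qed.

Lemma below_sub k l m : (k <= l)%N -> below k m -> below l m.
Proof.
by move=> kl; apply: fam_span_sub => w /andP[-> wk]; exact: leq_trans kl.
Qed.

Lemma below_gact k p m : low p -> below k m -> below k.+1 (gact (Em C p) m).
Proof.
move=> lp; apply: (lspan_map (gact_linr (M := M) (Em C p))) => _ [w /andP[/andP[_ lw] wk] ->].
by rewrite -act_cons; apply: below_act; rewrite /= ?lp.
Qed.

Lemma tco_gact i x (t : N) :
  tco i (gact x t) = gact x (tco i t) + \sum_j co i (rV x (e j)) *: tco j t.
Proof.
have tco_sum (F : I -> N) : tco i (\sum_j F j) = \sum_j tco i (F j) :> M.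
  by apply: big_morph; [exact: tcoD | exact: tco0].
rewrite {1}(tens_expand t) gact_sumr tco_sum.
under eq_bigr do rewrite gact_pure tcoD !tco_pure co_basis.
rewrite big_split /=; congr (_ + _).
rewrite (bigD1 i) //= eqxx scale1r big1 ?addr0 // => j.
by rewrite eq_sym => /negbTE ->; rewrite scale0r.
Qed.

(** A letter that acts on u is lost to v, so the remaining terms involve shorter words. *)
Lemma act_pure u w : all (@low n) w -> tbelow (size w) (act w (pure u v) - pure u (act w v)).
Proof.
elim: w => [_ i|p w IH /= /andP[lp lw] i].
  by rewrite !act_nil subrr tco0; exact: lspan0.
have -> : act (p :: w) (pure u v) - pure u (act (p :: w) v) =
    gact (Em C p) (act w (pure u v) - pure u (act w v)) + pure (rV (Em C p) u) (act w v).
  by rewrite gactBr gact_pure !act_cons opprD addrA subrK.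
rewrite tcoD tco_pure tco_gact; have {}IH := IH lw; apply: lspanD; first apply: lspanD.
- exact: below_gact.
- by apply: lspan_sum => j _; apply/lspanZ/(below_sub (leqnSn _))/IH.
by apply/lspanZ/below_act.
Qed.

Definition tens_fam (wi : seq letter * I) : N := act wi.1 (pure (e wi.2) v).

(** In the coordinate i0 the terms of maximal word length are the vectors [act w v] modulo shorter
    words, and [verma_free] forces their coefficients to vanish; the maximal length then drops. *)
Theorem tens_free : free_on (fun wi : seq letter * I => low_sorted wi.1) tens_fam.
Proof.
move=> ws c uws lws sum0.
suff main k : (forall wi, wi \in ws -> c wi != 0 -> (size wi.1 < k)%N) ->
    forall wi, wi \in ws -> c wi = 0.
  apply: (main (\max_(wi <- ws) size wi.1).+1) => wi wiws _.
  by rewrite ltnS (leq_bigmax_seq (F := fun wi => size wi.1)).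
elim: k => [|k IH] small.
  by move=> wi wiws; apply/eqP; case: eqP => // /eqP /(small wi wiws).
apply: IH => -[w0 i0] wiws0 c0; rewrite ltn_neqAle -ltnS (small _ wiws0 c0) andbT.
apply/eqP => /= sw0; case/eqP: c0.
pose top (wi : seq letter * I) := (wi.2 == i0) && (size wi.1 == k).
pose ws' := [seq wi.1 | wi <- ws & top wi].
have uws' : uniq ws'.
  rewrite map_inj_in_uniq ?filter_uniq // => -[w i] [w' i'].
  by rewrite !mem_filter => /andP[/andP[/eqP /= -> _] _] /andP[/andP[/eqP /= -> _] _] /= ->.
have lws' : all (fun w => low_sorted w && (size w == k)) ws'.
  apply/allP => w /mapP[wi]; rewrite mem_filter => /andP[/andP[_ sk] wiws] ->.
  by rewrite sk (allP lws).
have w0ws' : w0 \in ws'.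
  by apply/mapP; exists (w0, i0); rewrite // mem_filter wiws0 /top /= eqxx sw0 eqxx.
apply: (verma_free char0 (ws := ws') (c := fun w => c (w, i0))) w0ws' => //.
  by apply: sub_all lws' => w /andP[].
apply: (free_disjoint (verma_free char0 (la := la))
  (Q1 := fun w => low_sorted w && (size w == k)) (Q2 := fun w => low_sorted w && (size w < k)%N)).
- by move=> w /andP[].
- by move=> w /andP[].
- by move=> w /andP[_ /eqP ->]; rewrite ltnn andbF.
- rewrite big_seq; apply: lspan_sum => w wws; apply: lspanZ.
  by apply: fam_span_in; exact: (allP lws').
have tco_sum (F : seq letter * I -> N) :
    tco i0 (\sum_(wi <- ws) c wi *: F wi) = \sum_(wi <- ws) c wi *: tco i0 (F wi).
  elim/big_rec2: _ => [|wi x y _ <-]; last exact: tco_linear.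
  exact: tco0.
have := congr1 (tco i0) sum0; rewrite tco_sum tco0.
rewrite (bigID top) /= => /eqP; rewrite addrC addr_eq0 => /eqP low0.
have part wi : wi \in ws -> below (size wi.1) (tco i0 (tens_fam wi) - (i0 == wi.2)%:R *: act wi.1 v).
  move=> wiws; have /andP[_ lw] := allP lws wi wiws.
  have := act_pure (e wi.2) lw i0.
  by rewrite tcoB tco_pure co_basis.
(* The top part equals minus the other terms minus the lower-order errors, all spanned by words
   shorter than k. *)
have -> : \sum_(w <- ws') c (w, i0) *: act w v =
    - \sum_(wi <- ws | ~~ top wi) c wi *: tco i0 (tens_fam wi)
    - \sum_(wi <- ws | top wi) c wi *: (tco i0 (tens_fam wi) - (i0 == wi.2)%:R *: act wi.1 v).
  rewrite low0 opprK -sumrB big_map big_filter; apply: eq_bigr => -[w i] /andP[/eqP /= -> _].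
  by rewrite eqxx scale1r -scalerBr subKr.
have szk wi : wi \in ws -> c wi != 0 -> (size wi.1 <= k)%N by move=> *; rewrite -ltnS small.
apply: lspanB; first apply: lspanN; rewrite big_seq_cond; apply: lspan_sum => wi /andP[wiws twi];
    have [->|cwi] := eqVneq (c wi) 0; rewrite ?scale0r; try exact: lspan0; apply: lspanZ.
  rewrite -[tco _ _](subrK ((i0 == wi.2)%:R *: act wi.1 v)); apply: lspanD.
    exact: below_sub (szk wi wiws cwi) (part wi wiws).
  have [i0i|_] := eqVneq i0 wi.2; last by rewrite scale0r; exact: lspan0.
  rewrite scale1r; apply: below_act; first by have /andP[] := allP lws wi wiws.
  rewrite ltn_neqAle (szk wi wiws cwi) andbT; apply: contra twi => sk.
  by rewrite /top i0i eqxx sk.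
exact: below_sub (szk wi wiws cwi) (part wi wiws).
Qed.
End TensVerma.
End TensorWeights.

(** * Submodules generated by triangular lists *)

Section Submodules.
Variables (C : fieldType) (n : nat).
Notation letter := (letter n).
Notation glmod := (glmod C n).
Implicit Types (M N : glmod).

Definition hom_list M N (f : glhom M N) (xs : wlist M) : wlist N := [seq (f x.1, x.2) | x <- xs].

Lemma hom_weight_inj M N (f : glhom M N) mu m : injective f -> is_weight mu (f m) -> is_weight mu m.
Proof. by move=> fi wm k; apply: fi; rewrite hequiv wm linearZ. Qed.

Lemma hom_list_vecs M N (f : glhom M N) (xs : wlist M) y :
  vecs (hom_list f xs) y -> exists2 x, vecs xs x & y = f x.
Proof.
by rewrite /vecs /hom_list -map_comp => /mapP[x xxs ->]; exists x.1; first exact: map_f.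
Qed.

Lemma lspan_reflect M N (f : glhom M N) (xs : wlist M) m : injective f ->
  lspan (vecs (hom_list f xs)) (f m) -> lspan (vecs xs) m.
Proof.
move=> fi; suff h t : lspan (vecs (hom_list f xs)) t -> exists2 x, lspan (vecs xs) x & f x = t.
  by move=> /h [x xx /fi <-].
elim=> [|a _ u /hom_list_vecs[p pp ->] _ [x xx <-]]; first by exists 0; rewrite ?linear0 //; exact: lspan0.
by exists (a *: p + x); [exact: lspanS | rewrite linearP].
Qed.

Lemma fspan_reflect M N (f : glhom M N) (xs : wlist M) m : injective f ->
  fspan (vecs (hom_list f xs)) (f m) -> fspan (vecs xs) m.
Proof.
move=> fi; suff h t : fspan (vecs (hom_list f xs)) t -> exists2 x, fspan (vecs xs) x & f x = t.
  by move=> /h [x xx /fi <-].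
elim=> [|a _ u [w [_ [lw /hom_list_vecs[p pp ->] ->]]] _ [x xx <-]].
  by exists 0; rewrite ?linear0 //; exact: lspan0.
exists (a *: act w p + x); last by rewrite linearP hom_act.
by apply: lspanS xx; exists w, p.
Qed.

Lemma tri_reflect M N (f : glhom M N) (xs : wlist M) : injective f -> tri (hom_list f xs) -> tri xs.
Proof.
move=> fi; elim: xs => //= x ys IH [wx ex ty]; split; [exact: hom_weight_inj wx | | exact: IH].
by move=> p /ex; rewrite /= -hequiv; exact: lspan_reflect.
Qed.

(** The list itself lies in the submodule, and triangularity and generation are reflected by the
    injective inclusion. *)
Lemma fsub_inO M (xs : wlist M) (txs : tri xs) : inO (sub_mod (fsub (tri_borel txs))).
Proof.
set S := fsub _; have [ys yE] : exists ys : wlist (sub_mod S), hom_list (sub_incl S) ys = xs.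
  have : forall x, x \in xs -> x.1 \in subP S.
    by move=> x xxs; apply/asboolP/fspan_in/map_f.
  move: S => S; elim: (xs) => [|x zs IH] xS; first by exists [::].
  have [ys <-] : exists ys : wlist (sub_mod S), hom_list (sub_incl S) ys = zs.
    by apply: IH => z zzs; apply: xS; rewrite inE zzs orbT.
  by exists ((SubCar (xS x (mem_head _ _)), x.2) :: ys); rewrite /= -surjective_pairing.
apply: (@tri_inO _ _ _ ys).
  by apply: (tri_reflect (@sub_incl_inj _ _ _ S)); rewrite yE.
move=> m; apply: (fspan_reflect (@sub_incl_inj _ _ _ S)); rewrite yE.
by have /asboolP := sub_valP m.
Qed.

Fact null_equiv M N x (m : M) : (\0 : {linear M -> N}) (gact x m) = gact x ((\0 : {linear M -> N}) m).
Proof. by rewrite /= gact0r. Qed.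
Definition null_hom M N : glhom M N := GlHom (@null_equiv M N).

Lemma iso_mses M N (f : glhom M N) : injective f -> hom_surj f -> mses f (null_hom N (zero_mod C n)).
Proof.
move=> fi fs; split; [exact: fi | | by move=> y; split=> // _; exact: fs].
by move=> y; exists 0; apply/rowP => -[].
Qed.

(** * Additive functions on category O and Verma flags *)

Section Additive.
Variables (W : zmodType) (G : glmod -> W).
Hypothesis G_ses : forall A B D (f : glhom A B) (g : glhom B D),
  inO A -> inO B -> inO D -> mses f g -> G B = G A + G D.
Hypothesis char0 : forall k, (k%:R == 0 :> C) = (k == 0)%N.

Lemma zero_inO M : (forall m : M, m = 0) -> inO M.
Proof. by move=> M0; have [] := inO_char_zero char0 (fun=> 0) M0. Qed.

(** For M = 0 the identity maps form an exact sequence 0 -> M -> M -> M -> 0. *)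
Lemma additive_zero M : (forall m : M, m = 0) -> G M = 0.
Proof.
move=> M0; have OM := zero_inO M0.
have : mses (hom_id M) (hom_id M).
  split=> // [y|y]; first by exists y.
  by split=> _; [exists y | exact: M0].
by move=> /(G_ses OM OM OM) /eqP; rewrite -{1}[G M]addr0 (inj_eq (addrI _)) eq_sym => /eqP.
Qed.

Lemma additive_iso M N (f : glhom M N) : inO M -> injective f -> hom_surj f -> G N = G M.
Proof.
move=> OM fi fs; have ON := inO_surj char0 fs OM.
have Z0 : forall z : zero_mod C n, z = 0 by move=> z; apply/rowP => -[].
rewrite (G_ses OM ON (zero_inO Z0) (iso_mses fi fs)).
by rewrite (additive_zero Z0) addr0.
Qed.

Section Flag.
Variables (V : vectType C) (rV : rep n V).
Variables (I : finType) (e : I -> V) (co : I -> V -> C) (wt : I -> 'rV[C]_n) (h : I -> nat).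
Hypothesis co_linear : forall i a u v, co i (a *: u + v) = a * co i u + co i v.
Hypothesis co_basis : forall i j, co i (e j) = (i == j)%:R.
Hypothesis co_expand : forall v, v = \sum_i co i v *: e i.
Hypothesis e_weight : forall i k, rV (Em C (k, k)) (e i) = wt i 0 k *: e i.
Hypothesis e_strict : forall i (p : letter), (p.1 < p.2)%N ->
  lspan (fun u => exists2 j, (h j < h i)%N & u = e j) (rV (Em C p) (e i)).
Variable la : 'rV[C]_n.
Notation N := (tens rV (verma la)).

Definition flag_list (js : seq I) : wlist N := tens_list rV e wt [:: (vgen la, la)] js.

Lemma flag_tri js : closed_below h js -> tri (flag_list js).
Proof. exact: (tens_list_tri e_weight e_strict (vgen_tri la)). Qed.

Definition flag_sub js (cj : closed_below h js) := fsub (tri_borel (flag_tri cj)).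

Lemma flag_vec js y : vecs (flag_list js) y -> exists2 j, j \in js & y = pure rV (e j) (vgen la).
Proof.
by rewrite /vecs => /mapP[x /flatten_mapP[j jjs]] /=; rewrite inE => /eqP -> ->; exists j.
Qed.

Lemma flag_fam js t : fspan (vecs (flag_list js)) t ->
  fam_span (fun wi : seq letter * I => low_sorted wi.1 && (wi.2 \in js)) (tens_fam rV e la) t.
Proof.
apply: lspan_bind => _ [w [y [lw /flag_vec[j jjs ->] ->]]].
apply: lspan_bind (act_sort (pure rV (e j) (vgen la)) lw) => _ [w' /andP[lw' _] ->].
by apply: lspan_in; exists (w', j); rewrite //= lw' jjs.
Qed.

(** In the quotient the class of e_i ⊗ v is a generating highest weight vector of weight la + wt i.
    By [tens_free] no nonzero low combination of it falls into the smaller submodule, so the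
    quotient is the Verma module itself. *)
Lemma flag_step i js (cj : closed_below h js) (cij : closed_below h (i :: js)) : i \notin js ->
  G (sub_mod (flag_sub cij)) = G (sub_mod (flag_sub cj)) + G (verma (la + wt i)).
Proof.
move=> ijs; set A := sub_mod (flag_sub cj); set B := sub_mod (flag_sub cij).
have OA : inO A by exact: fsub_inO. have OB : inO B by exact: fsub_inO.
have AB t : t \in subP (flag_sub cj) -> t \in subP (flag_sub cij).
  move=> /asboolP tA; apply/asboolP; apply: fspan_vecs_sub tA => x.
  by rewrite /flag_list /tens_list /= inE => ->; rewrite orbT.
have fP m : sub_incl (flag_sub cj) m \in subP (flag_sub cij) by apply/AB/sub_valP.
pose f : glhom A B := corestr fP.
(* The smaller submodule, seen inside the larger one. *)
pose P : {pred B} := fun b => sub_incl (flag_sub cij) b \in subP (flag_sub cj).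
have PE b : (b \in P) = (sub_incl (flag_sub cij) b \in subP (flag_sub cj)) by [].
have P_closed : submod_closed P.
  have [c0 cl] := sub_closed (flag_sub cj); split.
    by rewrite PE linear0; exact: c0.
  by move=> a u v; rewrite !PE linearP; exact: cl.
have P_stable x m : m \in P -> gact x m \in P.
  by rewrite !PE hequiv => mP; exact: sub_stable.
pose S' := SubModule P_closed P_stable.
pose D := quot_mod S'; pose g : glhom B D := quot_hom S'.
have gs : hom_surj g by exact: quot_hom_surj.
have OD : inO D by exact: (inO_surj char0 gs OB).
have g0 b : g b = 0 <-> sub_incl (flag_sub cij) b \in subP (flag_sub cj) by exact: quot_hom_eq0.
have fg : mses f g.
  split=> //.
    by move=> x y fxy; apply: val_inj; exact: (congr1 (sub_incl (flag_sub cij)) fxy).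
  move=> y; split=> [/g0 yA|[x <-]]; last by apply/g0; exact: (sub_inclP x).
  by exists (SubCar yA); apply: val_inj.
rewrite (G_ses OA OB OD fg); congr (_ + _).
pose v := vgen la; pose x0 := pure rV (e i) v.
have x0P : x0 \in subP (flag_sub cij).
  by apply/asboolP/fspan_in; rewrite /vecs /flag_list /tens_list /= mem_head.
pose b0 : B := SubCar x0P.
have [wx0 ex0 _] : tri (flag_list (i :: js)) by exact: flag_tri.
have wb0 : is_weight (la + wt i) (g b0).
  by apply/hom_weight/(hom_weight_inj (@sub_incl_inj _ _ _ (flag_sub cij))).
have eb0 (p : letter) : (p.1 < p.2)%N -> gact (Em C p) (g b0) = 0.
  move=> /ex0 eb; rewrite -hequiv; apply/g0; rewrite hequiv; apply/asboolP.
  by apply: lspan_bind eb => y; exact: fspan_in.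
pose phi : glhom (verma (la + wt i)) D := verma_hom wb0 eb0.
have phi_act w : phi (act w (vgen _)) = g (act w b0).
  by rewrite !hom_act verma_hom_vgen.
apply: (additive_iso (f := phi)); first exact: verma_inO; last first.
  move=> y; have [b <-] := gs y.
  (* Modulo the smaller submodule, every element comes from the Verma module: words on e_i ⊗ v lift,
     the others map to 0. *)
  suff lift t : fspan (vecs (flag_list (i :: js))) t ->
      exists b' q, sub_incl (flag_sub cij) b' = t /\ phi q = g b'.
    have /asboolP/lift [b' [q [/sub_incl_inj <- <-]]] := sub_valP b.
    by exists q.
  elim=> [|a _ u [w [y' [lw yX ->]]] _ [b' [q [<- qE]]]].
    by exists 0, 0; rewrite !linear0.
  suff [b1 [q1 [<- q1E]]] : exists b1 q1, sub_incl (flag_sub cij) b1 = act w y' /\ phi q1 = g b1.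
    by exists (a *: b1 + b'), (a *: q1 + q); rewrite !linearP q1E qE.
  have [j] := flag_vec yX; rewrite inE => /predU1P[-> y'E|jjs y'E].
    exists (act w b0), (act w (vgen _)); split; last exact: phi_act.
    by rewrite hom_act y'E.
  have tA : act w y' \in subP (flag_sub cj).
    apply/asboolP; rewrite /act; apply: fspan_uact; first exact/tri_borel/flag_tri.
    by apply: fspan_in; rewrite y'E; apply: tens_list_vec jjs; rewrite /vecs /= mem_head.
  exists (SubCar (AB _ tA)), 0; split=> //; rewrite linear0.
  by apply/esym/g0.
have phi_inj q : phi q = 0 -> q = 0.
  have /fam_spanP [ws [c [uws lws ->]]] := vgen_low_span q.
  have -> : phi (\sum_(w <- ws) c w *: act w (vgen _)) = g (\sum_(w <- ws) c w *: act w b0).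
    by rewrite !linear_sum; apply: eq_bigr => w _; rewrite !linearZ; congr (_ *: _); exact: phi_act.
  move=> /g0; have -> : sub_incl (flag_sub cij) (\sum_(w <- ws) c w *: act w b0) =
      \sum_(w <- ws) c w *: act w x0.
    by rewrite linear_sum; apply: eq_bigr => w _; rewrite linearZ; congr (_ *: _); exact: hom_act.
  move=> /asboolP/flag_fam tjs.
  have free := tens_free char0 (rV := rV) co_linear co_basis co_expand (la := la).
  have ti : fam_span (fun wi : seq letter * I => low_sorted wi.1 && (wi.2 == i))
      (tens_fam rV e la) (\sum_(w <- ws) c w *: act w x0).
    rewrite big_seq; apply: lspan_sum => w wws; apply: lspanZ.
    by apply: lspan_in; exists (w, i); rewrite //= eqxx (allP lws).
  have sum0 : \sum_(w <- ws) c w *: act w x0 = 0.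
    apply: (free_disjoint free _ _ _ ti tjs).
    - by move=> wi /andP[].
    - by move=> wi /andP[].
    - by move=> [w j] /= /andP[_ /eqP ->] /andP[_]; rewrite (negbTE ijs).
  have := free [seq (w, i) | w <- ws] (fun wi => c wi.1).
  rewrite map_inj_uniq; last by move=> w w' [].
  rewrite uws all_map big_map => /(_ isT lws sum0) c0.
  rewrite big_seq big1 // => w wws.
  by rewrite (c0 (w, i)) ?scale0r //; exact: map_f.
by move=> p q /eqP; rewrite -subr_eq0 -linearB => /eqP/phi_inj/eqP; rewrite subr_eq0 => /eqP.
Qed.

Lemma flag_sum js (cj : closed_below h js) : uniq js ->
  G (sub_mod (flag_sub cj)) = \sum_(i <- js) G (verma (la + wt i)).
Proof.
elim: js cj => [|i js IH] cj /=.
  move=> _; rewrite big_nil; apply: additive_zero => m; apply: val_inj.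
  have zero t : fspan (vecs (flag_list [::])) t -> t = 0.
    by elim=> // a p u [w [y [_ +]]]; rewrite /vecs.
  by have /asboolP/zero := sub_valP m.
case/andP=> ijs ujs; rewrite big_cons (flag_step (proj2 cj)) // IH //.
exact: addrC.
Qed.

Theorem tens_verma_additive : G N = \sum_i G (verma (la + wt i)).
Proof.
have cj := by_height_closed h.
have gen := tens_list_gen co_expand e_weight e_strict (vgen_tri la) cj
  (mem_by_height h) (@vgen_fspan _ _ la).
rewrite (additive_iso (f := sub_incl (flag_sub cj))).
- rewrite flag_sum ?by_height_uniq // -[RHS]big_enum.
  by apply: perm_big; rewrite perm_sort.
- exact: fsub_inO.
- exact: sub_incl_inj.
move=> y; have yS : y \in subP (flag_sub cj) by apply/asboolP/gen.
by exists (SubCar yS).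
Qed.
End Flag.
End Additive.
End Submodules.

(** * The Casimir element and invariance of the central characters *)

Section Casimir.
Variables (C : fieldType) (n : nat).
Hypothesis char0 : forall k, (k%:R == 0 :> C) = (k == 0)%N.
Notation letter := (letter n).
Notation U := (Ualg C n).
Notation eps := (eps C n).
Notation rho := (rho C n).

Lemma Ucentral_gen (z : U) : (forall p, z * iota_U (Em C p) = iota_U (Em C p) * z) -> Ucentral z.
Proof.
move=> zE u; elim/Ualg_ind: u => [a|x|u v zu zv|u v zu zv].
- by rewrite mulr_algl mulr_algr.
- rewrite (matrix_sum_delta x) !linear_sum mulr_sumr mulr_suml; apply: eq_bigr => i _.
  rewrite !linear_sum mulr_sumr mulr_suml; apply: eq_bigr => j _.
  by rewrite linearZ -scalerAr -scalerAl; congr (_ *: _); exact: (zE (i, j)).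
- by rewrite mulrDr mulrDl zu zv.
by rewrite mulrA zu -mulrA zv mulrA.
Qed.

Definition casimir : U := \sum_i \sum_j iota_U (Em C (i, j)) * iota_U (Em C (j, i)).

Lemma iota_bracket (p q : letter) : iota_U (Em C p) * iota_U (Em C q) =
  iota_U (Em C q) * iota_U (Em C p) + (p.2 == q.1)%:R *: iota_U (Em C (p.1, q.2))
    - (q.2 == p.1)%:R *: iota_U (Em C (q.1, p.2)).
Proof.
have := iota_U_bracket (Em C p) (Em C q); rewrite Em_bracket linearB !linearZ_LR /=.
by move=> e; rewrite -addrA [X in _ + X]e addrC subrK.
Qed.

Lemma sum_delta (V : lmodType C) (k : 'I_n) (F : 'I_n -> V) : \sum_i (k == i)%:R *: F i = F k.
Proof.
rewrite (bigD1 k) //= eqxx scale1r big1 ?addr0 // => i.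
by rewrite eq_sym => /negbTE ->; rewrite scale0r.
Qed.

(** The commutator of E_kl with E_ij E_ji has four terms, which cancel in pairs after summation over
    i and j. *)
Lemma casimir_central : Ucentral casimir.
Proof.
apply: Ucentral_gen => -[k l]; apply/esym/eqP; rewrite -subr_eq0; apply/eqP.
rewrite /casimir mulr_sumr mulr_suml -sumrB.
pose E i j : U := iota_U (Em C (i, j)).
have comm i j : E k l * (E i j * E j i) - E i j * E j i * E k l =
    (l == i)%:R *: (E k j * E j i) - (k == j)%:R *: (E i l * E j i)
    + ((l == j)%:R *: (E i j * E k i) - (k == i)%:R *: (E i j * E j l)).
  rewrite mulrA iota_bracket /= mulrBl mulrDl -!scalerAl -[_ * _ * E j i]mulrA.
  rewrite iota_bracket /= mulrBr mulrDr -!scalerAr mulrA (eq_sym j k) (eq_sym i k).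
  rewrite -!/(E _ _); set t := E i j * E j i * E k l.
  set a := _ *: _; set b := _ *: _; set c := _ *: _; set d := _ *: _.
  by rewrite -!addrA (addrC t) !addrA subrK addrC !addrA addrAC; congr (_ - _); rewrite addrC !addrA.
under eq_bigr => i _.
  rewrite mulr_sumr mulr_suml -sumrB.
  under eq_bigr do rewrite comm.
  over.
under eq_bigr => i _.
  rewrite big_split /= !sumrB; over.
rewrite big_split /= !sumrB.
have -> : \sum_i \sum_j (l == i)%:R *: (E k j * E j i) = \sum_j E k j * E j l.
  rewrite exchange_big; apply: eq_bigr => j _; exact: (sum_delta l (fun i => E k j * E j i)).
have -> : \sum_i \sum_j (k == j)%:R *: (E i l * E j i) = \sum_i E i l * E k i.
  by apply: eq_bigr => i _; exact: (sum_delta k (fun j => E i l * E j i)).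
have -> : \sum_i \sum_j (l == j)%:R *: (E i j * E k i) = \sum_i E i l * E k i.
  by apply: eq_bigr => i _; exact: (sum_delta l (fun j => E i j * E k i)).
have -> : \sum_i \sum_j (k == i)%:R *: (E i j * E j l) = \sum_j E k j * E j l.
  rewrite exchange_big; apply: eq_bigr => j _; exact: (sum_delta k (fun i => E i j * E j l)).
by rewrite addrA subrK subrr.
Qed.

(** The pairing of mu with 2 rho. *)
Definition pair_sum (mu : 'rV[C]_n) : C := \sum_(i < n) \sum_(j < n | (i < j)%N) (mu 0 i - mu 0 j).
Definition cas (mu : 'rV[C]_n) : C := \sum_i mu 0 i ^+ 2 + pair_sum mu.

(** On the generator the terms with j < i vanish, and for i < j the product E_ij E_ji acts as the
    bracket E_ii - E_jj. *)
Lemma chi_casimir mu : central_char mu casimir = cas mu.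
Proof.
apply: central_char_uniq => //; first exact: casimir_central.
rewrite uact_suml /cas /pair_sum -big_split scaler_suml; apply: eq_bigr => i _.
rewrite uact_suml (bigD1 i) //= uactM !uact_iota !vgen_weight gactZr vgen_weight scalerA -expr2.
rewrite scalerDl; congr (_ + _); rewrite (bigID (fun j : 'I_n => (i < j)%N)) /=.
rewrite [X in _ + X]big1 ?addr0 => [|j /andP[ji ij]]; last first.
  rewrite uactM !uact_iota vgen_strict ?gact0r //=.
  by rewrite ltn_neqAle ji leqNgt.
rewrite scaler_suml; apply: eq_big => [j|j /andP[_ ij]].
  by rewrite andbC; have [/=|//] := ltnP i j; rewrite -val_eqE /= neq_ltn orbC => ->.
rewrite uactM !uact_iota gact_bracket vgen_strict // gact0r add0r Em_bracket /= !eqxx.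
by rewrite !scale1r gactDl gactNl !vgen_weight scalerBl.
Qed.

Lemma pair_sumD mu nu : pair_sum (mu + nu) = pair_sum mu + pair_sum nu.
Proof.
rewrite /pair_sum -big_split; apply: eq_bigr => i _; rewrite -big_split; apply: eq_bigr => j _.
by rewrite /= !mxE opprD addrACA.
Qed.

Lemma pair_sumZ a mu : pair_sum (a *: mu) = a * pair_sum mu.
Proof.
rewrite /pair_sum mulr_sumr; apply: eq_bigr => i _; rewrite mulr_sumr; apply: eq_bigr => j _.
by rewrite /= !mxE mulrBr.
Qed.

Lemma two_neq0 : (2%:R : C) != 0. Proof. by rewrite char0. Qed.

Lemma pair_sum_eps (m : 'I_n) : pair_sum (eps m) = 2%:R * rho 0 m.
Proof.
rewrite /rho mxE mulrA mulfV ?two_neq0 // mul1r summxE; apply: eq_bigr => i _.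
rewrite summxE; apply: eq_bigr => j _; rewrite !mxE.
by rewrite (eq_sym (i : nat)) (eq_sym (j : nat)).
Qed.

(* In coordinates centred at -rho the Casimir is |la|^2 - |rho|^2. *)
Lemma cas_shift la a (m : 'I_n) :
  cas (la + a *: eps m - rho) = cas (la - rho) + (2%:R * a * la 0 m + a ^+ 2).
Proof.
rewrite addrAC; set mu := la - rho.
have muE : mu 0 m = la 0 m - rho 0 m by rewrite !mxE.
rewrite /cas pair_sumD pair_sumZ pair_sum_eps.
have -> : \sum_i (mu + a *: eps m) 0 i ^+ 2 = \sum_i mu 0 i ^+ 2 + (2%:R * a * mu 0 m + a ^+ 2).
  have sE i : (mu + a *: eps m) 0 i = mu 0 i + a * (m == i)%:R.
    by rewrite mxE [X in _ + X]mxE epsE.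
  rewrite (bigD1 m) //= [in RHS](bigD1 m) //= [RHS]addrAC; congr (_ + _).
    rewrite sE eqxx mulr1; ring.
  apply: eq_bigr => i; rewrite eq_sym => /negbTE im.
  by rewrite sE im mulr0 addr0.
rewrite muE; ring.
Qed.
End Casimir.

(** * Singular vectors, and invariance of central characters under permutations *)

Section WeylInvariance.
Variables (C : fieldType) (n : nat).
Hypothesis char0 : forall k, (k%:R == 0 :> C) = (k == 0)%N.
Notation letter := (letter n).
Notation U := (Ualg C n).
Notation eps := (eps C n).
Notation rho := (rho C n).

Section Singular.
Variables (mu : 'rV[C]_n) (i j : 'I_n).
Hypothesis ij : (j = i.+1 :> nat).
Notation f k := (act (nseq k (j, i)) (vgen mu)).

(** As i and j are adjacent, the bracket of E_p with E_ji is zero or, up to sign, again a raising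
    operator other than E_ij. *)
Lemma singular_other k (p : letter) : (p.1 < p.2)%N -> p != (i, j) -> gact (Em C p) (f k) = 0.
Proof.
elim: k p => [|k IH] [r s] /= rs pij; first by rewrite act_nil vgen_strict.
rewrite act_cons gact_bracket IH // gact0r add0r Em_bracket gactDl gactNl !gactZl /=.
have [sj|_] := eqVneq s j; have [ir|_] := eqVneq i r.
- by rewrite sj ir eqxx in pij.
- rewrite scale0r subr0 scale1r IH //=.
    by move: rs pij; rewrite sj xpair_eqE eqxx andbT -val_eqE /= ij; lia.
  by rewrite xpair_eqE negb_and -[i == j]val_eqE /= ij neq_ltn ltnSn orbT.
- rewrite scale0r sub0r scale1r IH ?oppr0 //=.
    by move: rs pij; rewrite -ir xpair_eqE eqxx /= -val_eqE /= ij; lia.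
  by rewrite xpair_eqE negb_and -[j == i]val_eqE /= ij neq_ltn ltnSn orbT.
by rewrite !scale0r subrr.
Qed.

Lemma nseq_wt k : word_wt C (nseq k (j, i)) = k%:R *: (eps j - eps i).
Proof.
rewrite /word_wt big_nseq; elim: k => [|k IH] /=; first by rewrite scale0r.
by rewrite IH -[k.+1]add1n natrD scalerDl scale1r.
Qed.

(** The sl_2 formula e f^k v = k (h - k + 1) f^(k-1) v. *)
Lemma singular_simple k : gact (Em C (i, j)) (f k) =
  (k%:R * (mu 0 i - mu 0 j - k%:R + 1)) *: f k.-1.
Proof.
have nij : (j == i) = false by apply/negbTE; rewrite -val_eqE /= ij neq_ltn ltnSn orbT.
elim: k => [|k IH]; first by rewrite mul0r scale0r act_nil vgen_strict //= ij.
have wk := act_weight (nseq k (j, i)) (vgen_weight mu).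
rewrite /= act_cons gact_bracket IH gactZr Em_bracket gactDl gactNl /= !eqxx !scale1r.
rewrite !(wk _) nseq_wt !mxE !eqxx !val_eqE nij (eq_sym i) nij.
(* For k = 0 the truncated [k.-1] makes the two vectors differ, but the coefficient is 0. *)
have -> : (k%:R * (mu 0 i - mu 0 j - k%:R + 1)) *: gact (Em C (j, i)) (f k.-1) =
    (k%:R * (mu 0 i - mu 0 j - k%:R + 1)) *: f k.
  by case: k {IH wk} => [|k]; rewrite ?mul0r ?scale0r //= -act_cons.
rewrite -scalerBl -scalerDl; congr (_ *: _); rewrite -[k.+1]addn1 natrD -[true%:R]/(1 : C) -[false%:R]/(0 : C); ring.
Qed.

Lemma singular_neq0 k : f k != 0.
Proof.
apply/eqP => f0; have := verma_free char0 (ws := [:: nseq k (j, i)]) (c := fun=> 1) (la := mu).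
rewrite big_seq1 f0 scaler0 /= andbT; have -> : low_sorted (nseq k (j, i)).
  rewrite /low_sorted all_nseq /low /= ij ltnSn orbT andbT.
  case: k {f0} => //= k; elim: k => //= k ->; rewrite andbT; exact: leqnn.
by move=> /(_ isT isT erefl _ (mem_head _ _))/eqP; rewrite oner_eq0.
Qed.

(** The sl_2 coefficient vanishes at this exponent, so f^(k+1) v is singular and yields a nonzero
    map of Verma modules, on whose image z acts by both scalars. *)
Lemma chi_reflection k z : Ucentral z -> mu 0 i - mu 0 j + 1 = k.+1%:R ->
  central_char (mu + k.+1%:R *: (eps j - eps i)) z = central_char mu z.
Proof.
move=> zc dk; set mu' := mu + _.
have wx : is_weight mu' (f k.+1) by rewrite /mu' -nseq_wt; exact/act_weight/vgen_weight.
have ex (p : letter) : (p.1 < p.2)%N -> gact (Em C p) (f k.+1) = 0.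
  move=> lp; have [->|pij] := eqVneq p (i, j); last exact: singular_other.
  by rewrite singular_simple addrAC dk subrr mulr0 scale0r.
have := hom_uact (verma_hom wx ex) z (vgen mu'); rewrite !verma_hom_vgen.
rewrite !central_charP // linearZ verma_hom_vgen => /eqP; rewrite -subr_eq0 -scalerBl scaler_eq0.
by rewrite (negbTE (singular_neq0 _)) orbF subr_eq0 => /eqP.
Qed.
End Singular.

Definition wt_of (a : {ffun 'I_n -> 'I_8}) : 'rV[C]_n := \sum_m (a m : nat)%:R *: eps m.

Lemma wt_ofE a m : wt_of a 0 m = (a m : nat)%:R.
Proof.
rewrite /wt_of summxE (bigD1 m) //= mxE epsE eqxx mulr1 big1 ?addr0 // => l lm.
by rewrite mxE epsE (negbTE lm) mulr0.
Qed.

Definition swap (a : {ffun 'I_n -> 'I_8}) (i j : 'I_n) : {ffun 'I_n -> 'I_8} :=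
  [ffun m => a (tperm i j m)].

Lemma content_swap a i j : content (swap a i j) = content a.
Proof.
apply/ffunP => k; rewrite !ffunE; congr (Posz _).
rewrite -(card_imset _ (@perm_inj _ (tperm i j))); apply: eq_card => m.
apply/imsetP/idP => [[l]|]; rewrite !inE.
  by rewrite ffunE => /eqP lk ->; rewrite lk.
by move=> mk; exists (tperm i j m); rewrite ?tpermK // !inE ffunE tpermK.
Qed.

Lemma rhoE m : 2%:R * rho 0 m = \sum_(l < n) ((m < l)%N%:R - (l < m)%N%:R).
Proof.
rewrite -pair_sum_eps // /pair_sum sumrB.
under eq_bigr => k _ do rewrite sumrB.
rewrite sumrB; congr (_ - _).
  rewrite (bigD1 m) //= [X in _ + X]big1 ?addr0 => [|k km]; last first.
    by rewrite big1 // => l _; rewrite epsE eq_sym (negbTE km).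
  by rewrite big_mkcond; apply: eq_bigr => l _; rewrite epsE eqxx; case: ifP.
apply: eq_bigr => k _; rewrite big_mkcond (bigD1 m) //= epsE eqxx big1 ?addr0 => [|l lm].
  by case: ifP.
by rewrite epsE eq_sym (negbTE lm) if_same.
Qed.

Lemma rho_step (i j : 'I_n) : j = i.+1 :> nat -> rho 0 i - rho 0 j = 1.
Proof.
move=> ij; apply: (mulfI (two_neq0 char0)); rewrite mulrBr !rhoE -sumrB mulr1.
rewrite (eq_bigr (fun l => (i == l)%:R *: (1 : C^o) + (j == l)%:R *: (1 : C^o))).
  by rewrite big_split /= !sum_delta -mulr2n.
move=> l _; rewrite -!val_eqE /= ij /GRing.scale /= !mulr1.
have [] : (l < i \/ l > i.+1 \/ l = i :> nat \/ l = i.+1 :> nat)%N by lia.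
  move=> li; have -> : (i < l)%N = false by lia.
  have -> : (i.+1 < l)%N = false by lia.
  have -> : (l < i.+1)%N by lia.
  have -> : (i == l :> nat) = false by lia.
  have -> : (i.+1 == l) = false by lia.
  by rewrite li subrr addr0.
case=> [li|[->|->]].
- have -> : (i < l)%N by lia.
  have -> : (l < i)%N = false by lia.
  have -> : (l < i.+1)%N = false by lia.
  have -> : (i == l :> nat) = false by lia.
  have -> : (i.+1 == l) = false by lia.
  by rewrite li subrr addr0.
- by rewrite ltnn ltnSn eqxx (gtn_eqF (ltnSn i)) ltnNge leqnSn /= subrr !sub0r opprK addr0.
by rewrite ltnn ltnSn eqxx (ltn_eqF (ltnSn i)) ltnNge leqnSn /= !subr0 add0r.
Qed.

Lemma wt_swap (a : {ffun 'I_n -> 'I_8}) (i j : 'I_n) k : i != j -> (a i = a j + k :> nat)%N ->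
  wt_of (swap a i j) = wt_of a + k%:R *: (eps j - eps i).
Proof.
move=> nij aij; apply/rowP => m.
have eE : (k%:R *: (eps j - eps i)) 0 m = k%:R * ((j == m)%:R - (i == m)%:R).
  by rewrite 3!mxE !mxE !val_eqE !(eq_sym m).
rewrite wt_ofE mxE wt_ofE eE /swap ffunE; case: tpermP => [->|->|/eqP mi /eqP mj].
- by rewrite eqxx eq_sym (negbTE nij) sub0r mulrN1 aij natrD addrK.
- by rewrite eqxx (negbTE nij) subr0 mulr1 aij natrD.
by rewrite eq_sym (negbTE mj) eq_sym (negbTE mi) subrr mulr0 addr0.
Qed.

(** In rho-shifted coordinates the reflection exchanges adjacent entries, and a_i - a_j is the
    exponent of the singular vector. *)
Lemma chi_swap (a : {ffun 'I_n -> 'I_8}) (i j : 'I_n) z : Ucentral z -> j = i.+1 :> nat -> (a j < a i)%N ->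
  central_char (wt_of (swap a i j) - rho) z = central_char (wt_of a - rho) z.
Proof.
move=> zc ij aij; have nij : i != j by rewrite -val_eqE /= ij neq_ltn ltnSn.
have aE : (a i = a j + (a i - a j).-1.+1 :> nat)%N by lia.
rewrite (wt_swap nij aE) addrAC (chi_reflection ij zc) //.
rewrite ![(wt_of a - rho) 0 _]mxE !wt_ofE ![(- rho) 0 _]mxE {1}aE natrD opprD opprK.
have := rho_step ij; set x := rho 0 i; set y := rho 0 j => xy.
have -> : x = y + 1 by rewrite -xy addrC subrK.
ring.
Qed.

Definition descents_free (a : {ffun 'I_n -> 'I_8}) : Prop :=
  forall i j : 'I_n, (i <= j)%N -> (a i <= a j)%N.

(** Bubble sort by [chi_swap]. Earlier positions weigh more in [meas], so moving a smaller entry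
    forward decreases it. *)
Lemma sort_content a : exists b, [/\ content b = content a, descents_free b
  & forall z, Ucentral z -> central_char (wt_of b - rho) z = central_char (wt_of a - rho) z].
Proof.
pose meas (a : {ffun 'I_n -> 'I_8}) := (\sum_(m < n) (n - m) * a m)%N.
have [k] := ubnP (meas a); elim: k a => // k IH a; rewrite ltnS => ak.
have [/existsP[i /existsP[j /andP[/eqP ij aij]]]|nodesc] :=
  boolP [exists i : 'I_n, exists j : 'I_n, (j == i.+1 :> nat) && (a j < a i)%N].
  have nij : j != i by rewrite -val_eqE /= ij neq_ltn ltnSn orbT.
  have [|b [bc bm bz]] := IH (swap a i j).
    apply: leq_trans ak; rewrite /meas (bigD1 i) // (bigD1 j) //=.
    rewrite [X in (_ < X)%N](bigD1 i) // (bigD1 j) //= !ffunE tpermL tpermR !addnA.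
    rewrite (eq_bigr (fun m : 'I_n => (n - m) * a m)%N); last first.
      by move=> m /andP[mi mj]; rewrite ffunE tpermD // eq_sym.
    by rewrite ltn_add2r ij; have := ltn_ord j; rewrite ij; move: aij; nia.
  exists b; split=> //; first by rewrite bc content_swap.
  by move=> z zc; rewrite bz // chi_swap.
exists a; split=> // i j; have [d dE] : exists d, (j - i = d)%N by exists (j - i)%N.
elim: d j dE => [|d IHd] j dE ij.
  by have -> : i = j by apply: val_inj => /=; lia.
have jn : (j.-1 < n)%N by have := ltn_ord j; lia.
apply: leq_trans (IHd (Ordinal jn) _ _) _ => /=; [lia | lia |].
rewrite leqNgt; apply: contra nodesc => aj; apply/existsP; exists (Ordinal jn).
by apply/existsP; exists j; rewrite aj andbT; apply/eqP => /=; lia.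
Qed.

Lemma initial_segment (A : {set 'I_n}) : (forall i j : 'I_n, (i <= j)%N -> j \in A -> i \in A) ->
  forall m : 'I_n, (m \in A) = (m < #|A|)%N.
Proof.
have cardlt k : (k <= n)%N -> #|[set l : 'I_n | (l < k)%N]| = k.
  move=> kn; rewrite cardsE -sum1_card; rewrite -(big_ord_widen n (fun=> 1%N) kn).
  by rewrite sum1_card card_ord.
move=> Adown m; apply/idP/idP => [mA|].
  rewrite -[X in (X <= _)%N](cardlt m.+1) ?ltn_ord //; apply: subset_leq_card.
  by apply/fintype.subsetP => l; rewrite inE ltnS => lm; exact: Adown mA.
apply: contraLR => mA; rewrite -leqNgt -[X in (_ <= X)%N](cardlt m) ?(ltnW (ltn_ord m)) //.
apply: subset_leq_card; apply/fintype.subsetP => l lA; rewrite inE ltnNge.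
by apply: contra mA => ml; exact: Adown lA.
Qed.

(** The positions with values below i form an initial segment of length d_0 + ... + d_(i-1), so
    position m falls in the stretch to which [lambda_] gives the value b m. *)
Lemma lambda_content b : descents_free b -> lambda_ C n (content b) = wt_of b.
Proof.
move=> bm; apply/rowP => m; rewrite wt_ofE /lambda_ summxE.
have absE k : `|content b k|%N = #|[set l | b l == k]| by rewrite ffunE.
have cnt (i : nat) : \sum_(k < 8 | (k < i)%N) `|content b k|%N = #|[set l | (b l < i)%N]|.
  under eq_bigr do rewrite absE -sum1dep_card.
  rewrite -sum1dep_card (exchange_big_dep (fun l => b l < i)%N) /= => [|k l ki /eqP -> //].
  apply: eq_bigr => l bl; rewrite (bigD1 (b l)) /=; last by rewrite bl eqxx.
  by rewrite big1 ?addn0 // => k /andP[/andP[_ /eqP ->]]; rewrite eqxx.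
have seg (i : nat) : (b m < i)%N = (m < #|[set l | (b l < i)%N]|)%N.
  have down (k l : 'I_n) : (k <= l)%N -> l \in [set l | (b l < i)%N] -> k \in [set l | (b l < i)%N].
    by move=> kl; rewrite !inE; exact/leq_ltn_trans/bm.
  by have := initial_segment down m; rewrite inE.
have cntS (i : 'I_8) : #|[set l | (b l < i.+1)%N]| = (#|[set l | (b l < i)%N]| + `|content b i|)%N.
  rewrite -!cnt (bigD1 i) //= addnC; congr (_ + _)%N; apply: eq_bigl => k.
  by rewrite ltnS (leq_eqVlt k) -val_eqE; case: (ltngtP k i).
rewrite (bigD1 (b m)) //= summxE.
have bm_lo : (#|[set l | (b l < b m)%N]| <= m)%N by rewrite leqNgt -seg ltnn.
have bm_hi : (m < #|[set l | (b l < b m)%N]| + `|content b (b m)|)%N.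
  by rewrite -cntS -seg.
have mj : (m - #|[set l | (b l < b m)%N]| < `|content b (b m)|)%N by lia.
rewrite (bigD1 (Ordinal mj)) //= !mxE cnt subnKC // eqxx mulr1 big1 ?addr0 => [|j jm].
  rewrite big1 ?addr0 // => i im; rewrite summxE big1 // => j _; rewrite !mxE cnt.
  have [mE|_] := eqVneq (m : nat) (#|[set l | (b l < i)%N]| + j)%N; last by rewrite mulr0.
  have := seg i; have := seg i.+1; rewrite cntS mE.
  by have := ltn_ord j; move: im; rewrite -val_eqE /=; lia.
rewrite !mxE; have [mE|_] := eqVneq (m : nat) (#|[set l | (b l < b m)%N]| + j)%N; last by rewrite mulr0.
by case/eqP: jm; apply: val_inj => /=; rewrite mE addKn.
Qed.

Lemma chi_content a z : Ucentral z ->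
  theta_ (content a) z = central_char (wt_of a - rho) z.
Proof.
move=> zc; have [b [bc bm bz]] := sort_content a.
by rewrite /theta_ -bc lambda_content // bz.
Qed.

End WeylInvariance.

(** * Weight bases of the fundamental representations and their squares *)

Section WeightBases.
Variables (C : fieldType) (n : nat).
Hypothesis char0 : forall k, (k%:R == 0 :> C) = (k == 0)%N.
Notation letter := (letter n).
Notation eps := (eps C n).
Notation glmod := (glmod C n).

Definition dcol (i : 'I_n) : 'cV[C]_n := delta_mx i 0.

Lemma dcolE i k : dcol i k 0 = (i == k)%:R.
Proof. by rewrite mxE eqxx andbT eq_sym. Qed.

Lemma dcol_expand (v : 'cV[C]_n) : v = \sum_i v i 0 *: dcol i.
Proof.
apply/colP => k; rewrite summxE (bigD1 k) //= mxE dcolE eqxx mulr1 big1 ?addr0 // => i.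
by rewrite mxE dcolE => /negbTE ->; rewrite mulr0.
Qed.

Variables (r : mxrep C n n) (s : C) (h : 'I_n -> nat).
Hypothesis r_weight : forall k i, r (Em C (k, k)) *m dcol i = (s * (i == k)%:R) *: dcol i.
Hypothesis r_strict : forall (p : letter) i, (p.1 < p.2)%N ->
  lspan (fun u => exists2 j, (h j < h i)%N & u = dcol j) (r (Em C p) *m dcol i).

Section Additive.
Variables (W : zmodType) (G : glmod -> W).
Hypothesis G_ses : forall A B D (f : glhom A B) (g : glhom B D),
  inO A -> inO B -> inO D -> mses f g -> G B = G A + G D.
Variable la : 'rV[C]_n.

Lemma col_weight i k : col_rep r (Em C (k, k)) (dcol i) = (s *: eps i) 0 k *: dcol i.
Proof. by rewrite mxE epsE; exact: r_weight. Qed.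

Lemma col_co_linear (i : 'I_n) a (u v : 'cV[C]_n) : (a *: u + v) i 0 = a * u i 0 + v i 0.
Proof. by rewrite !mxE. Qed.

Lemma col_inO M : inO M -> inO (tens (col_rep r) M).
Proof.
exact: (tens_inO char0 dcol_expand col_weight (fun i p => @r_strict p i)).
Qed.

Lemma col_additive : G (tens (col_rep r) (verma la)) = \sum_(i < n) G (verma (la + s *: eps i)).
Proof.
apply: (tens_verma_additive G_ses char0 col_co_linear _ dcol_expand col_weight
  (fun i p => @r_strict p i)).
by move=> i j; rewrite dcolE eq_sym.
Qed.

(** * Symmetric and alternating squares, treated together *)

Section Square.
Variables (sg : C) (S : {vspace 'M[C]_n}) (P : pred letter) (c : letter -> C).
Hypothesis sg2 : sg * sg = 1.
Hypothesis memS : forall A, (A \in S) = (A^T == sg *: A).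
Hypothesis stabS : forall x A, A \in S -> sq_rep r x A \in S.

(** The tensor u ⊗ v + sg v ⊗ u, with sg = 1 for Sym^2 and sg = -1 for Alt^2. The factor c in [sqb]
    is chosen so that the dual coordinate is a matrix entry. *)
Definition sqv (u v : 'cV[C]_n) : 'M[C]_n := u *m v^T + sg *: (v *m u^T).
Definition sqb (p : letter) : 'M[C]_n := c p *: sqv (dcol p.1) (dcol p.2).

Hypothesis c_dual : forall p q, P p -> P q ->
  c q * ((q == p)%:R + sg * ((q.2, q.1) == p)%:R) = (q == p)%:R.
Hypothesis sqb_cover : forall i j, exists p a,
  sqv (dcol i) (dcol j) = a *: sqb p /\ (a != 0 -> P p /\ (h p.1 + h p.2 = h i + h j)%N).
Hypothesis sqb_expand : forall A, A \in S -> A = \sum_(p | P p) A p.1 p.2 *: sqb p.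

Lemma sqv_linl v : linear (sqv^~ v).
Proof.
move=> a u u'; rewrite /sqv mulmxDl linearP mulmxDr !scalerDr -scalemxAl -scalemxAr /=.
by rewrite [sg *: (a *: _)]scalerA mulrC -scalerA addrACA.
Qed.

Lemma sqv_sym u v : sqv v u = sg *: sqv u v.
Proof. by rewrite /sqv scalerDr scalerA sg2 scale1r addrC. Qed.

Lemma sqv_linr u : linear (sqv u).
Proof.
by move=> a v v'; rewrite sqv_sym sqv_linl scalerDr -sqv_sym scalerA mulrC -scalerA -sqv_sym.
Qed.

Lemma sqv_mem u v : sqv u v \in S.
Proof.
rewrite memS /sqv linearD linearZ /= !trmx_mul !trmxK scalerDr scalerA sg2 scale1r addrC.
exact: eqxx.
Qed.

Lemma sqb_mem p : sqb p \in S.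
Proof. by rewrite /sqb memvZ // sqv_mem. Qed.

Lemma sq_sqv x u v : sq_rep r x (sqv u v) = sqv (r x *m u) v + sqv u (r x *m v).
Proof.
rewrite /= /sq_act /sqv mulmxDr mulmxDl -scalemxAr -scalemxAl !trmx_mul !mulmxA.
by rewrite [LHS]addrACA [RHS]addrACA; congr (_ + _); exact: addrC.
Qed.

Lemma sq_repZ x a A : sq_rep r x (a *: A) = a *: sq_rep r x A.
Proof. by rewrite /= /sq_act -scalemxAr -scalemxAl scalerDr. Qed.

Definition sqi := {p in P}.
Definition sqe (p : sqi) : subvs_of S := vsproj S (sqb (val p)).
Definition sqco (p : sqi) (A : subvs_of S) : C := vsval A (val p).1 (val p).2.
Definition sqwt (p : letter) : 'rV[C]_n := s *: (eps p.1 + eps p.2).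

Lemma sqe_val p : vsval (sqe p) = sqb (val p).
Proof. by rewrite vsprojK ?sqb_mem. Qed.

Lemma sqco_linear p a u v : sqco p (a *: u + v) = a * sqco p u + sqco p v.
Proof. by rewrite /sqco linearP !mxE. Qed.

Lemma dcol_mul i j : dcol i *m (dcol j)^T = Em C (i, j).
Proof. by rewrite /dcol trmx_delta mul_delta_mx. Qed.

Lemma sqb_entry p k l : sqb p k l = c p * ((p == (k, l))%:R + sg * ((p.2, p.1) == (k, l))%:R).
Proof.
rewrite -!(EmE C _ (k, l)) /sqb /sqv !dcol_mul mxE [X in c p * X]mxE [X in _ + X]mxE.
by case: p.
Qed.

Lemma sqco_basis p q : sqco p (sqe q) = (p == q)%:R.
Proof.
rewrite /sqco sqe_val sqb_entry -surjective_pairing.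
by rewrite c_dual; [rewrite eq_sym | exact: (valP p) | exact: (valP q)].
Qed.

Lemma sqco_expand v : v = \sum_p sqco p v *: sqe p.
Proof.
apply: val_inj; rewrite -!/(vsval _) linear_sum [LHS]sqb_expand ?subvsP //.
transitivity (\sum_(p : sqi) vsval v (val p).1 (val p).2 *: sqb (val p)).
  exact: (big_sub P (fun p => vsval v p.1 p.2 *: sqb p)).
by apply: eq_bigr => p _; rewrite [RHS]linearZ /= sqe_val.
Qed.

Lemma sqe_weight p k : subrep stabS (Em C (k, k)) (sqe p) = sqwt (val p) 0 k *: sqe p.
Proof.
have e : vsval (subrep stabS (Em C (k, k)) (sqe p)) = sq_rep r (Em C (k, k)) (sqb (val p)).
  by rewrite -sqe_val; exact: (subrep_actE stabS).
suff key : sq_rep r (Em C (k, k)) (sqb (val p)) = sqwt (val p) 0 k *: sqb (val p).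
  by apply: val_inj; rewrite [LHS]e key [RHS]linearZ /= sqe_val.
rewrite /sqb sq_repZ sq_sqv !r_weight.
have Zl a u v : sqv (a *: u) v = a *: sqv u v.
  have := sqv_linl v a u 0; rewrite addr0 => ->.
  by rewrite /sqv mul0mx trmx0 mulmx0 scaler0 !addr0.
have Zr a u v : sqv u (a *: v) = a *: sqv u v.
  by rewrite sqv_sym Zl scalerA mulrC -scalerA -sqv_sym.
rewrite Zl Zr -scalerDl !scalerA mulrC /sqwt; congr (_ * _ *: _).
by rewrite !mxE !val_eqE !(eq_sym k) mulrDr.
Qed.

Lemma sqe_strict p (q : letter) : (q.1 < q.2)%N ->
  lspan (fun u => exists2 p', (h (val p').1 + h (val p').2 < h (val p).1 + h (val p).2)%N & u = sqe p')
    (subrep stabS (Em C q) (sqe p)).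
Proof.
move=> lq; rewrite /= /subrep_act sqe_val /sqb.
rewrite -/(sq_rep r _ _) sq_repZ sq_sqv.
have vZ a A : vsproj S (a *: A) = a *: vsproj S A by exact: linearZ.
rewrite vZ linearD; apply: lspanZ.
have cover i j : (h i + h j < h (val p).1 + h (val p).2)%N ->
    lspan (fun u => exists2 p' : sqi, (h (val p').1 + h (val p').2 < h (val p).1 + h (val p).2)%N & u = sqe p')
      (vsproj S (sqv (dcol i) (dcol j))).
  move=> hij; have [p' [a [-> ap]]] := sqb_cover i j; rewrite vZ.
  have [->|/ap [Pp' hp']] := eqVneq a 0; first by rewrite scale0r; exact: lspan0.
  by apply/lspanZ/lspan_in; exists (exist _ p' Pp'); rewrite /= ?hp'.
apply: lspanD.
  apply: (lspan_map (f := fun u => vsproj S (sqv u (dcol (val p).2)))) (r_strict (val p).1 lq).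
    by move=> a u v; rewrite sqv_linl linearP.
  by move=> _ [j hj ->]; apply: cover; rewrite ltn_add2r.
apply: (lspan_map (f := fun u => vsproj S (sqv (dcol (val p).1) u))) (r_strict (val p).2 lq).
  by move=> a u v; rewrite sqv_linr linearP.
by move=> _ [j hj ->]; apply: cover; rewrite ltn_add2l.
Qed.

Lemma square_inO M : inO M -> inO (tens (subrep stabS) M).
Proof. exact: (tens_inO char0 sqco_expand sqe_weight sqe_strict). Qed.

Lemma square_additive : G (tens (subrep stabS) (verma la)) =
  \sum_(p : letter | P p) G (verma (la + sqwt p)).
Proof.
rewrite (tens_verma_additive G_ses char0 sqco_linear sqco_basis sqco_expand sqe_weight sqe_strict).
exact/esym/(big_sub P (fun p => G (verma (la + sqwt p)))).
Qed.
End Square.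

Lemma half_neq0 : 2%:R^-1 != 0 :> C. Proof. by rewrite invr_eq0 two_neq0. Qed.

Definition sym_idx (p : letter) := (p.1 <= p.2)%N.
Definition alt_idx (p : letter) := (p.1 < p.2)%N.
(** On the diagonal [sqv] counts the same tensor twice. *)
Definition sym_coef (p : letter) : C := if p.1 == p.2 then 2%:R^-1 else 1.

Lemma mem_sym A : (A \in sym_space C n) = (A^T == 1 *: A).
Proof. by rewrite scale1r; apply/mem_symP/eqP. Qed.
Lemma mem_alt A : (A \in alt_space C n) = (A^T == -1 *: A).
Proof. by rewrite scaleN1r; apply/mem_altP/eqP. Qed.

Lemma sym_dual p q : sym_idx p -> sym_idx q ->
  sym_coef q * ((q == p)%:R + 1 * ((q.2, q.1) == p)%:R) = (q == p)%:R.
Proof.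
case: p q => [i j] [k l]; rewrite /sym_idx /sym_coef /= !xpair_eqE mul1r => ij kl.
have [e|kl'] := eqVneq k l.
  by rewrite e; set x := (_ && _)%:R; rewrite -[x + x]mulr2n -[x *+ 2]mulr_natl mulrA mulVf ?mul1r ?two_neq0.
rewrite mul1r; have -> : (l == i) && (k == j) = false; last by rewrite addr0.
by apply/negP => /andP[/eqP li /eqP kj]; case/eqP: kl'; apply: val_inj => /=; move: ij kl; rewrite -li -kj; lia.
Qed.

Lemma alt_dual p q : alt_idx p -> alt_idx q ->
  1 * ((q == p)%:R + -1 * ((q.2, q.1) == p)%:R) = (q == p)%:R :> C.
Proof.
case: p q => [i j] [k l]; rewrite /alt_idx /= !xpair_eqE mul1r => ij kl.
have -> : (l == i) && (k == j) = false; last by rewrite mulr0 addr0.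
by apply/negP => /andP[/eqP li /eqP kj]; move: ij kl; rewrite -li -kj; lia.
Qed.

Lemma sym_coef_neq0 p : sym_coef p != 0.
Proof. by rewrite /sym_coef; case: ifP; rewrite ?half_neq0 ?oner_eq0. Qed.

Lemma sym_cover i j : exists p a, sqv 1 (dcol i) (dcol j) = a *: sqb 1 sym_coef p /\
  (a != 0 -> sym_idx p /\ (h p.1 + h p.2 = h i + h j)%N).
Proof.
have aux (k l : 'I_n) : (k <= l)%N -> exists p a, sqv 1 (dcol k) (dcol l) = a *: sqb 1 sym_coef p /\
  (a != 0 -> sym_idx p /\ (h p.1 + h p.2 = h k + h l)%N).
  move=> kl; exists (k, l), (sym_coef (k, l))^-1; split=> //.
  by rewrite /sqb scalerA mulVf ?sym_coef_neq0 // scale1r.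
have [ij|/ltnW ji] := leqP i j; first exact: aux.
by rewrite (sqv_sym (mul1r 1) (dcol j)) scale1r addnC; exact: aux.
Qed.

Lemma alt_cover i j : exists p a, sqv (-1) (dcol i) (dcol j) = a *: sqb (-1) (fun=> 1) p /\
  (a != 0 -> alt_idx p /\ (h p.1 + h p.2 = h i + h j)%N).
Proof.
have [ij|ji|/val_inj <-] := ltngtP i j.
- by exists (i, j), 1; rewrite /sqb !scale1r.
- exists (j, i), (-1); rewrite /sqb scale1r -sqv_sym ?mulrNN ?mul1r //; split=> // _.
  by rewrite addnC.
(* The vector is zero here, so with coefficient 0 any index will do. *)
exists (i, i), 0; rewrite scale0r eqxx; split=> //.
by rewrite /sqv scaleN1r subrr.
Qed.

Lemma sym_expand A : A \in sym_space C n -> A = \sum_(p | sym_idx p) A p.1 p.2 *: sqb 1 sym_coef p.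
Proof.
move=> /mem_symP AT; apply/matrixP => k l.
have AE i j : A i j = A j i by rewrite -{1}AT mxE.
(* The one ordered index that contributes to the entry (k, l). *)
rewrite summxE; pose p0 : letter := if (k <= l)%N then (k, l) else (l, k).
have Pp0 : sym_idx p0 by rewrite /p0 /sym_idx; case: (leqP k l) => [|/ltnW].
rewrite (bigD1 p0) //= big1 ?addr0 => [|p /andP[Pp pp0]]; last first.
  rewrite mxE sqb_entry; have -> : (p == (k, l)) = false.
    apply: contraNF pp0 => /eqP pE; rewrite /p0; move: Pp; rewrite pE /sym_idx /= => ->.
    exact: eqxx.
  have -> : ((p.2, p.1) == (k, l)) = false; last by rewrite mulr0 addr0 !mulr0.
  apply: contraNF pp0; case: p Pp => p1 p2; rewrite /sym_idx /= /p0 => Pp /eqP[e1 e2].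
  move: Pp; rewrite e1 e2; case: (leqP k l) => [kl lk|_ _]; last exact: eqxx.
  have -> : k = l by apply: val_inj => /=; lia.
  exact: eqxx.
rewrite mxE sqb_entry (mulrA (A _ _)) [A _ _ * _]mulrC -mulrA mul1r.
have -> : A p0.1 p0.2 = A k l by rewrite /p0; case: ifP.
rewrite /sym_coef /p0; have [kl|lk] := leqP k l; last first.
  by rewrite /= !xpair_eqE -!val_eqE /= (ltn_eqF lk) (gtn_eqF lk) !eqxx /= add0r mulr1 mul1r.
rewrite /= !xpair_eqE !eqxx /= (eq_sym l); case: eqVneq => [_|_] /=.
  by rewrite -mulr2n mulrA mulrC mulrA -mulr_natl mulr1 mulfV ?mul1r ?two_neq0.
by rewrite addr0 mulr1 mul1r.
Qed.

Lemma alt_expand A : A \in alt_space C n -> A = \sum_(p | alt_idx p) A p.1 p.2 *: sqb (-1) (fun=> 1) p.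
Proof.
move=> /mem_altP AT; apply/matrixP => k l.
have AE i j : A i j = - A j i by have := congr1 (fun B : 'M_n => B j i) AT; rewrite !mxE.
have A0 i : A i i = 0.
  apply/eqP; have /eqP := AE i i; rewrite -subr_eq0 opprK -mulr2n -mulr_natl mulf_eq0.
  by rewrite (negbTE (two_neq0 char0)).
rewrite summxE; have [kl|kl] := eqVneq k l.
  rewrite kl A0 big1 // => p Pp; rewrite mxE sqb_entry.
  have -> : (p == (l, l)) = false.
    by apply: contraTF Pp => /eqP ->; rewrite /alt_idx ltnn.
  have -> : ((p.2, p.1) == (l, l)) = false; last by rewrite mulr0 addr0 !mulr0.
  by apply: contraTF Pp; case: p => p1 p2 /eqP[-> ->]; rewrite /alt_idx ltnn.
pose p0 : letter := if (k < l)%N then (k, l) else (l, k).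
have lk : (k < l)%N = false -> (l < k)%N.
  by move=> /negbT; rewrite -leqNgt leq_eqVlt => /orP[/eqP/val_inj e|//]; rewrite e eqxx in kl.
have Pp0 : alt_idx p0 by rewrite /p0 /alt_idx; case: ifP => //= /lk.
rewrite (bigD1 p0) //= big1 ?addr0 => [|p /andP[Pp pp0]]; last first.
  rewrite mxE sqb_entry; have -> : (p == (k, l)) = false.
    apply: contraNF pp0 => /eqP pE; rewrite /p0; move: Pp; rewrite pE /alt_idx /= => ->.
    exact: eqxx.
  have -> : ((p.2, p.1) == (k, l)) = false; last by rewrite mulr0 addr0 !mulr0.
  apply: contraNF pp0; case: p Pp => p1 p2; rewrite /alt_idx /= /p0 => Pp /eqP[e1 e2].
  by move: Pp; rewrite e1 e2 ltnNge => /negbTE lk'; case: ltnP lk' => // /ltnW ->.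
rewrite mxE sqb_entry mul1r /p0; case: ifP => [_|_]; rewrite /= !xpair_eqE !eqxx /=.
  by rewrite (eq_sym l) (negbTE kl) mulr0 addr0 mulr1.
by rewrite (eq_sym l) (negbTE kl) add0r mulr1 mulrN1 -AE.
Qed.

Lemma sym_inO M : inO M -> inO (tens (Sym2 r) M).
Proof.
exact: (@square_inO 1 (sym_space C n) sym_idx sym_coef (mul1r 1) mem_sym (@sym_stable C n n r)
  sym_cover sym_expand M).
Qed.

Lemma alt_inO M : inO M -> inO (tens (Alt2 r) M).
Proof.
exact: (@square_inO (-1) (alt_space C n) alt_idx (fun=> 1) (etrans (mulrNN 1 1) (mul1r 1)) mem_alt
  (@alt_stable C n n r) alt_cover alt_expand M).
Qed.

(** Each weight s (eps_i + eps_j) with i < j occurs once in either square and cancels; the diagonal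
    weights of Sym^2 remain. *)
Theorem sym_alt_additive : G (tens (Sym2 r) (verma la)) - G (tens (Alt2 r) (verma la)) =
  \sum_(i < n) G (verma (la + (2%:R * s) *: eps i)).
Proof.
rewrite (@square_additive 1 (sym_space C n) sym_idx sym_coef (mul1r 1) mem_sym (@sym_stable C n n r)
  sym_dual sym_cover sym_expand).
rewrite (@square_additive (-1) (alt_space C n) alt_idx (fun=> 1) (etrans (mulrNN 1 1) (mul1r 1)) mem_alt
  (@alt_stable C n n r) alt_dual alt_cover alt_expand).
rewrite (bigID (fun p : letter => p.1 == p.2)) /= -addrA.
rewrite [X in _ + (X - _)](eq_bigl alt_idx) => [|[i j]]; last first.
  by rewrite /sym_idx /alt_idx /= [in RHS]ltn_neqAle andbC.
rewrite subrr addr0 -(pair_big_dep predT (fun i j : 'I_n => (i <= j)%N && (i == j))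
  (fun i j : 'I_n => G (verma (la + sqwt (i, j))))) /=.
apply: eq_bigr => i _; rewrite (bigD1 i) /=; last by rewrite leqnn eqxx.
rewrite big1 ?addr0 => [|j /andP[/andP[_ /eqP ->]]]; last by rewrite eqxx.
by rewrite /sqwt /= -mulr2n -scaler_nat scalerA mulrC.
Qed.
End Additive.
End WeightBases.

(** * The fundamental representation and its dual *)

Section Fundamental.
Variables (C : fieldType) (n : nat).
Notation letter := (letter n).

Lemma L_weight k i : L_mxrep C n (Em C (k, k)) *m dcol C i = (1 * (i == k)%:R) *: dcol C i.
Proof.
rewrite /= /dcol mul_delta_mx_cond mul1r eq_sym -scaler_nat /=.
by case: eqP => [->|_]; rewrite ?scale0r.
Qed.

Lemma L_strict (p : letter) (i : 'I_n) : (p.1 < p.2)%N ->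
  lspan (fun u => exists2 j : 'I_n, (j < i)%N & u = dcol C j) (L_mxrep C n (Em C p) *m dcol C i).
Proof.
move=> lp; rewrite /= /dcol mul_delta_mx_cond; case: eqP => [<-|_]; last exact: lspan0.
by apply: lspan_in; exists p.1.
Qed.

Notation Ldual := (dual_mxrep (L_mxrep C n)).

Lemma Ldual_dcol p i : Ldual (Em C p) *m dcol C i = - ((p.1 == i)%:R *: dcol C p.2).
Proof.
by rewrite /= /dual_mx /= /dcol trmx_delta mulNmx mul_delta_mx_cond -scaler_nat.
Qed.

Lemma Ldual_weight k i : Ldual (Em C (k, k)) *m dcol C i = (-1 * (i == k)%:R) *: dcol C i.
Proof.
rewrite Ldual_dcol /= mulN1r scaleNr eq_sym; congr (- _).
by case: eqP => [->|_]; rewrite ?scale0r.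
Qed.

(** Raising operators increase the index of a dual basis vector, hence the reversed height. *)
Lemma Ldual_strict (p : letter) (i : 'I_n) : (p.1 < p.2)%N ->
  lspan (fun u => exists2 j : 'I_n, (n - j < n - i)%N & u = dcol C j) (Ldual (Em C p) *m dcol C i).
Proof.
move=> lp; rewrite Ldual_dcol; case: eqP => [<-|_]; last by rewrite scale0r oppr0; exact: lspan0.
rewrite scale1r; apply/lspanN/lspan_in; exists p.2 => //.
by have := ltn_ord p.2; lia.
Qed.
End Fundamental.

(** * The functors and the Grothendieck group *)

Section Exactness.
Variables (C : fieldType) (n : nat).
Hypothesis char0 : forall k, (k%:R == 0 :> C) = (k == 0)%N.
Notation glmod := (glmod C n).
Notation gfun := (gfun C n).
Notation theta := (@theta_ C n).

Lemma zero_mod_eq0 (m : zero_mod C n) : m = 0.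
Proof. by apply/rowP => -[]. Qed.

Lemma inO_inO d (M : glmod) : inO_ d M -> inO M.
Proof. by rewrite /inO_; case: ifP => _ => [[]//|]; exact: zero_inO. Qed.

Lemma inO_zero d (M : glmod) : (forall m : M, m = 0) -> inO_ d M.
Proof. by move=> M0; rewrite /inO_; case: ifP => // _; exact: inO_char_zero. Qed.

Definition gexact (G : gfun) : Prop := forall A B D (f : glhom A B) (g : glhom B D),
  inO B -> mses f g -> mses (gmap G f) (gmap G g).

Lemma F_zero_exact : gexact (F_zero C n).
Proof.
move=> A B D f g _ _; split=> // [y|y]; first by exists y.
by rewrite [y]zero_mod_eq0; split=> // _; exists 0.
Qed.

Lemma F_copies_exact k : gexact (F_copies C n k).
Proof. by move=> A B D f g _; exact: copies_exact. Qed.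

Lemma collect_exact src (G : idx -> gfun) : (forall d, gexact (G d)) ->
  (forall s (M : glmod), inO_ (src s) M -> inO_ s (G (src s) M)) -> exact_On (collect src G).
Proof.
move=> Gex Gst; split=> [M OM s|A B D f g fg s]; first exact/Gst/OM.
by apply: (Gex (src s)); [exact/inO_inO/ofamP | exact: fg].
Qed.

Lemma dsum_inO_ d (A B : glmod) : inO_ d A -> inO_ d B -> inO_ d (dsum A B).
Proof.
rewrite /inO_; case: ifP => _; first exact: dsum_inO_char.
by move=> A0 B0 [x y]; rewrite (A0 x) (B0 y).
Qed.

Lemma famsum_exact (F G : famfun C n) : exact_On F -> exact_On G -> exact_On (famsum F G).
Proof.
move=> [Fs Fe] [Gs Ge]; split=> [M OM s|A B D f g fg s].
  by apply: dsum_inO_; [exact: Fs | exact: Gs].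
by apply: dsum_exact; [exact: (Fe A B D f g fg) | exact: (Ge A B D f g fg)].
Qed.

(** Justifies [shift s j i] as the source index of the component s in [translations]. *)
Lemma shiftK (d : idx) i j : shift (shift d i j) j i = d.
Proof. by apply/ffunP => k; rewrite !ffunE; ring. Qed.

Lemma translation_exact (V : vectType C) (rV : rep n V) i j d :
  (forall M, inO M -> inO (tens rV M)) -> gexact (translation rV i j d).
Proof.
move=> tO; rewrite /translation; case: ifP => _; last exact: F_zero_exact.
move=> A B D f g OB fg; apply: proj_exact => //; first exact: tO.
exact: tens_exact.
Qed.

Lemma translations_exact (V : vectType C) (rV : rep n V) i j :
  (forall M, inO M -> inO (tens rV M)) -> exact_On (translations rV i j).
Proof.
move=> tO; apply: collect_exact => [d|s M OM]; first exact: translation_exact.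
rewrite /translation shiftK; case: ifP => Ds; last by apply: inO_zero; exact: zero_mod_eq0.
by rewrite /inO_ Ds; apply: proj_inO => //; apply/tO/(inO_inO OM).
Qed.

Lemma copies_inO_ k d (M : glmod) : inO_ d M -> inO_ d (copies k M).
Proof.
rewrite /inO_; case: ifP => _; first exact: copies_inO_char.
by move=> M0 f; apply/ffunP => i; rewrite (M0 (f i)) ffunE.
Qed.

Lemma H_exact (P : idx -> bool) (k : idx -> nat) :
  exact_On (collect id (fun d => if P d then F_copies C n (k d) else F_zero C n)).
Proof.
apply: collect_exact => [d|s M OM]; case: ifP => _.
- exact: F_copies_exact.
- exact: F_zero_exact.
- exact: copies_inO_.
by apply: inO_zero; exact: zero_mod_eq0.
Qed.

Lemma inD_content (a : {ffun 'I_n -> 'I_8}) : inD n (content a).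
Proof.
apply/andP; split; first by apply/forallP => k; rewrite ffunE.
under eq_bigr do rewrite ffunE.
rewrite -(big_morph Posz PoszD (erefl _)); apply/eqP; congr Posz.
under eq_bigr do rewrite -sum1dep_card.
rewrite (exchange_big_dep predT) //= -[RHS]card_ord -sum1_card; apply: eq_bigr => m _.
by rewrite (big_pred1 (a m)) // => k; rewrite eq_sym.
Qed.

Lemma verma_fam_inOn (a : {ffun 'I_n -> 'I_8}) : inOn (verma_fam C a).
Proof.
move=> d; rewrite /verma_fam; case: eqP => [->|_]; last by apply: inO_zero; exact: zero_mod_eq0.
rewrite /inO_ inD_content; split; first exact: verma_inO.
move=> m z zc; exists 1%N; rewrite expr1 chi_content // uactB uactA central_charP //.
exact: subrr.
Qed.
End Exactness.

(** * Classes of families and of block components *)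

Section Grothendieck.
Variables (C : fieldType) (n : nat).
Hypothesis char0 : forall k, (k%:R == 0 :> C) = (k == 0)%N.
Notation glmod := (glmod C n).
Notation family := (Defs.family C n).
Notation Vsp := (Vsp_tens C n).
Notation rho := (rho C n).
Notation eps := (eps C n).
Implicit Types a : {ffun 'I_n -> 'I_8}.
Variable gamma : KOn C n -> Vsp.
Hypothesis Hg : is_gamma gamma.

Definition additive_on (Phi : KOn C n -> Vsp) := forall x y, Phi (Kadd x y) = Phi x + Phi y.

Lemma additive_K0 Phi : additive_on Phi -> Phi (Kcl (@K0 C n)) = 0.
Proof.
move=> PD; have := PD (Kcl (@K0 C n)) (Kcl (@K0 C n)); rewrite Kcl_add.
have -> : Kcl (Kadd_ (@K0 C n) (@K0 C n)) = Kcl (@K0 C n) by apply/KclP; exact: keq_add0.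
by rewrite -{1}[Phi _]addr0 => /addrI.
Qed.

Lemma additive_Kopp Phi x : additive_on Phi -> Phi (Kopp x) = - Phi x.
Proof.
move=> PD; apply/eqP; rewrite -addr_eq0 -PD -[x]KreprK Kcl_opp Kcl_add.
have -> : Kcl (Kadd_ (Kopp_ (Krepr x)) (Krepr x)) = Kcl (@K0 C n) by apply/KclP; exact: keq_addN.
by rewrite additive_K0.
Qed.

Lemma leibnizD X (t u : Vsp) : leibniz X (t + u) = leibniz X t + leibniz X u.
Proof. by rewrite /leibniz -big_split; apply: eq_bigr => a _; rewrite ffunE scalerDl. Qed.
Lemma leibniz0 X : leibniz X (0 : Vsp) = 0.
Proof. by rewrite /leibniz big1 // => a _; rewrite ffunE scale0r. Qed.
Lemma leibnizN X (t : Vsp) : leibniz X (- t) = - leibniz X t.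
Proof. by rewrite /leibniz -sumrN; apply: eq_bigr => a _; rewrite ffunE scaleNr. Qed.

Lemma vtenE (a b : {ffun 'I_n -> 'I_8}) : vten C a b = (b == a)%:R.
Proof. by rewrite ffunE. Qed.

Lemma leibniz_vten X a : leibniz X (vten C a) =
  \sum_(m < n) \sum_(j < 8) X j (a m) *: vten C (tset a m j).
Proof.
rewrite /leibniz (bigD1 a) //= vtenE eqxx scale1r [X in _ + X]big1 ?addr0 // => b ba.
by rewrite vtenE (negbTE ba) scale0r.
Qed.

(* As gamma is injective with image the Z-span of the v_a, the classes of the *)
(* Verma modules generate K(O^n).                                             *)
Lemma leibniz_ext Phi X : additive_on Phi ->
  (forall a (Ma : inOn (verma_fam C a)), Phi (Kclass (OnObj Ma)) = leibniz X (vten C a)) ->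
  forall x, Phi x = leibniz X (gamma x).
Proof.
move=> PD Pv x; have gD : additive_on gamma by exact: gamma_add.
have /(gamma_im Hg) [z zE] : exists y, gamma y = gamma x by exists x.
(* The good vectors form a subgroup containing every v_a, hence the whole integral span. *)
pose good t := exists y, gamma y = t /\ Phi y = leibniz X (gamma y).
have good0 : good 0.
  by exists (Kcl (@K0 C n)); rewrite !additive_K0 // leibniz0.
have goodD t u : good t -> good u -> good (t + u).
  move=> [y [<- yP]] [w [<- wP]]; exists (Kadd y w).
  by rewrite gD PD leibnizD yP wP.
have goodN t : good t -> good (- t).
  move=> [y [<- yP]]; exists (Kopp y).
  by rewrite !additive_Kopp // leibnizN yP.
have goodv a : good (vten C a).
  have Ma := verma_fam_inOn char0 a; exists (Kclass (OnObj Ma)).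
  by rewrite (gamma_verma Hg) Pv.
have goodn a (k : nat) : good (k%:R *: vten C a).
  by elim: k => [|k IH]; rewrite ?scale0r // -natr1 scalerDl scale1r; exact: goodD.
have goodz a (k : int) : good (k%:~R *: vten C a).
  by case: k => k; [exact: goodn | rewrite NegzE mulrNz scaleNr; exact/goodN/goodn].
have [y [yx yP]] : good (gamma x).
  by rewrite zE; apply: big_ind => // a _; exact: goodz.
by rewrite -(gamma_inj Hg yx).
Qed.

(** Extended by 0 outside O^n, so that families can be handled without a membership proof in each
    term. *)
Definition gcl (M : family) : Vsp :=
  if pselect (inOn M) is left h then gamma (Kclass (OnObj h)) else 0.

Lemma gclE M (h : inOn M) : gcl M = gamma (Kclass (OnObj h)).
Proof. by rewrite /gcl; case: pselect => // h'; rewrite (Prop_irrelevance h h'). Qed.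

Lemma gcl_ses A B D (f : famhom A B) (g : famhom B D) :
  inOn A -> inOn B -> inOn D -> ses f g -> gcl B = gcl A + gcl D.
Proof.
move=> OA OB OD fg; rewrite (gclE OA) (gclE OB) (gclE OD) -(gamma_add Hg).
congr gamma; rewrite /Kclass Kcl_add; apply/KclP.
exact: (@keq_ses _ _ (OnObj OA) (OnObj OB) (OnObj OD) f g fg).
Qed.

Definition fam_zero (M : family) := forall d (m : M d), m = 0.

Lemma fam_zero_inOn M : fam_zero M -> inOn M.
Proof. by move=> M0 d; apply: inO_zero => // m; exact: M0. Qed.

Lemma gcl_zero M : fam_zero M -> gcl M = 0.
Proof.
move=> M0; have OM := fam_zero_inOn M0.
have : ses (fun d => hom_id (M d)) (fun d => hom_id (M d)).
  move=> d; split=> // [y|y]; first by exists y.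
  by split=> _; [exists y | exact: M0].
by move=> /(gcl_ses OM OM OM) /eqP; rewrite -{1}[gcl M]addr0 (inj_eq (addrI _)) eq_sym => /eqP.
Qed.

Lemma gcl_iso M N : inOn M -> inOn N ->
  (forall d, exists f : glhom (M d) (N d), injective f /\ hom_surj f) -> gcl N = gcl M.
Proof.
move=> OM ON iso; pose f : famhom M N := fun d => projT1 (cid (iso d)).
have fP d : injective (f d) /\ hom_surj (f d) by rewrite /f; case: cid.
pose Z : family := fun=> zero_mod C n.
have Z0 : fam_zero Z by move=> d m; exact: zero_mod_eq0.
have fg : ses f (fun d => null_hom (N d) (Z d)).
  by move=> d; apply: iso_mses; case: (fP d).
by rewrite (gcl_ses OM ON (fam_zero_inOn Z0) fg) (gcl_zero Z0) addr0.
Qed.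

Definition conc (s : idx) (M : glmod) : family := fun d => if d == s then M else zero_mod C n.

Lemma conc_inOn s M : inO_ s M -> inOn (conc s M).
Proof.
move=> OM d; rewrite /conc; case: eqP => [->//|_].
by apply: inO_zero => //; exact: zero_mod_eq0.
Qed.

Lemma zero_bij (M N : glmod) : (forall m : M, m = 0) -> (forall m : N, m = 0) ->
  exists f : glhom M N, injective f /\ hom_surj f.
Proof.
move=> M0 N0; exists (null_hom M N); split=> [x y _|y]; first by rewrite (M0 x) (M0 y).
by exists 0; rewrite (N0 y).
Qed.

Definition conc_map s A B (f : glhom A B) : famhom (conc s A) (conc s B) := fun d =>
  if d == s as b return glhom (if b then A else zero_mod C n) (if b then B else zero_mod C n)
  then f else hom_id (zero_mod C n).

Lemma conc_ses s A B D (f : glhom A B) (g : glhom B D) :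
  mses f g -> ses (conc_map s f) (conc_map s g).
Proof.
move=> fg d; rewrite /conc_map /conc; case: eqP => _; first exact: fg.
split=> // [y|y]; first by exists y.
by rewrite [y]zero_mod_eq0; split=> // _; exists 0.
Qed.

Lemma gcl_conc_ses s A B D (f : glhom A B) (g : glhom B D) :
  inO_ s A -> inO_ s B -> inO_ s D -> mses f g ->
  gcl (conc s B) = gcl (conc s A) + gcl (conc s D).
Proof.
by move=> OA OB OD /(conc_ses s); apply: gcl_ses; exact: conc_inOn.
Qed.

Lemma gcl_conc s (X : glmod) (M : family) : inO_ s X -> M s = X ->
  (forall d, d != s -> forall m : M d, m = 0) -> gcl M = gcl (conc s X).
Proof.
move=> OX MX M0; apply: gcl_iso; first exact: conc_inOn.
  move=> d; have [->|ds] := eqVneq d s; first by rewrite MX.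
  by apply: inO_zero => //; exact: M0.
move=> d; rewrite /conc; have [->|ds] := eqVneq d s; last first.
  by apply: zero_bij; [exact: zero_mod_eq0 | exact: M0].
by rewrite MX; exists (hom_id X); split=> // y; exists y.
Qed.

(** The additive function to which the Verma flags are applied. *)
Definition block (s : idx) (M : glmod) : Vsp := gcl (conc s (proj_mod (@theta_ C n s) M)).

Lemma block_ses s A B D (f : glhom A B) (g : glhom B D) : inD n s ->
  inO A -> inO B -> inO D -> mses f g -> block s B = block s A + block s D.
Proof.
move=> Ds OA OB OD fg; have pO M : inO M -> inO_ s (proj_mod (@theta_ C n s) M).
  by move=> OM; rewrite /inO_ Ds; exact: proj_inO.
apply: (gcl_conc_ses (pO _ OA) (pO _ OB) (pO _ OD)).
exact: (proj_exact char0 (lambda_ C n s - rho) OB fg).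
Qed.

Lemma gcl_famsum (F G : famfun C n) M : inOn (F M) -> inOn (G M) ->
  gcl (famsum F G M) = gcl (F M) + gcl (G M).
Proof.
move=> OF OG; apply: (@gcl_ses _ _ _ (fun s => dinl (F M s) (G M s)) (fun s => dsnd (F M s) (G M s))) => //.
  by move=> s; apply: dsum_inO_.
by move=> s; exact: dsum_mses.
Qed.

Lemma proj_zero th (M : glmod) : (forall m : M, m = 0) -> forall m : proj_mod th M, m = 0.
Proof. by move=> M0 m; apply: val_inj; rewrite [LHS]M0 [RHS]M0. Qed.

Lemma tens_zero (V : vectType C) (rV : rep n V) (M : glmod) : (forall m : M, m = 0) ->
  forall m : tens rV M, m = 0.
Proof. by move=> M0 m; apply/ffunP => i; rewrite (M0 (m i)) ffunE. Qed.

Lemma verma_fam_zero a d : d != content a -> forall m : verma_fam C a d, m = 0.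
Proof. by rewrite /verma_fam => /negbTE ->; exact: zero_mod_eq0. Qed.

(** M(a) has only the component at its content, so its translate has only the one at the shifted
    content. *)
Lemma translations_verma (V : vectType C) (rV : rep n V) i j a :
  (forall M, inO M -> inO (tens rV M)) ->
  gcl (translations rV i j (verma_fam C a)) =
  if inD n (shift (content a) i j)
  then block (shift (content a) i j) (tens rV (verma (wt_of C a - rho))) else 0.
Proof.
move=> tO; set s0 := shift _ i j.
have ne s : s != s0 -> shift s j i != content a.
  by apply: contraNneq => e; rewrite /s0 -e shiftK.
have zero s : s != s0 \/ ~~ inD n s -> forall m : translations rV i j (verma_fam C a) s, m = 0.
  move=> cs; rewrite /= /collect_obj /translation shiftK.
  case: ifP => [Ds|_]; last exact: zero_mod_eq0.
  case: cs => [/ne/verma_fam_zero v0|]; last by rewrite Ds.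
  exact/proj_zero/tens_zero.
case: ifP => Ds0; last first.
  apply: gcl_zero => s; apply: zero; have [->|] := eqVneq s s0; last by left.
  by right; rewrite Ds0.
apply: gcl_conc => [||s ss0]; last by apply: zero; left.
  by rewrite /inO_ Ds0; apply: proj_inO => //; apply: tO; exact: verma_inO.
by rewrite /= /collect_obj /translation shiftK Ds0 /s0 shiftK /verma_fam eqxx.
Qed.

Lemma wt_tset a m (k : 'I_8) : wt_of C (tset a m k) = wt_of C a + (k%:R - (a m)%:R) *: eps m.
Proof.
apply/rowP => l; have eE (c : C) : (c *: eps m) 0 l = c * (m == l)%:R by rewrite mxE epsE.
rewrite mxE eE !wt_ofE ffunE eq_sym; have [->|_] := eqVneq m l; last by rewrite mulr0 addr0.
by rewrite mulr1 addrC subrK.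
Qed.

Lemma content_tset a m (k : 'I_8) : content (tset a m k) = shift (content a) (a m) k.
Proof.
apply/ffunP => l; rewrite !ffunE.
have card (b : {ffun 'I_n -> 'I_8}) : #|[set m | b m == l]|%:Z = \sum_(m' < n) (b m' == l)%:Z.
  rewrite -(big_morph Posz PoszD (erefl _)) -sum1dep_card big_mkcond.
  by congr Posz; apply: eq_bigr => m' _; case: ifP.
rewrite !card (bigD1 m) //= [in RHS](bigD1 m) //= ffunE eqxx.
rewrite (eq_bigr (fun m' => (a m' == l)%:Z)) => [|m' /negbTE mm]; last by rewrite ffunE mm.
rewrite !val_eqE !(eq_sym l); ring.
Qed.

Lemma gcl_verma_fam a : gcl (verma_fam C a) = vten C a.
Proof. by rewrite (gclE (verma_fam_inOn char0 a)) (gamma_verma Hg). Qed.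

(** By [chi_content] all of M(a') lies in the block, so the inclusion of the component is an
    isomorphism. *)
Lemma block_same a a' s mu : content a' = s -> wt_of C a' - rho = mu -> block s (verma mu) = vten C a'.
Proof.
move=> <- <-; rewrite -gcl_verma_fam.
have Oa := verma_fam_inOn char0 a'.
have OX : inO_ (content a') (proj_mod (@theta_ C n (content a')) (verma (wt_of C a' - rho))).
  rewrite /inO_ inD_content; apply: proj_inO => //; exact: verma_inO.
apply/esym/gcl_iso => // [|d]; first exact: conc_inOn.
rewrite /conc /verma_fam; have [_|_] := eqVneq d (content a'); last first.
  by apply: zero_bij; exact: zero_mod_eq0.
exists (sub_incl (comp_sub (@theta_ C n (content a')) (verma (wt_of C a' - rho)))).
split; first exact: sub_incl_inj.
move=> y; apply: sub_incl_onto; apply/asboolP => z zc; exists 1%N.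
by rewrite expr1 chi_content // uactB uactA central_charP // subrr.
Qed.

(** The Casimir minus its value on the block acts on the Verma module by a nonzero scalar, which is
    nilpotent on no nonzero vector. *)
Lemma block_other s mu : central_char mu (casimir C n) != @theta_ C n s (casimir C n) ->
  block s (verma mu) = 0.
Proof.
move=> d; apply: gcl_zero => s'; rewrite /conc; case: eqP => _; last exact: zero_mod_eq0.
move=> m; apply: val_inj; have /asboolP/(_ _ (@casimir_central C n)) [k] := sub_valP m.
rewrite -[sub_val m]/(val m) -[val 0]/(0 : verma mu).
have -> : uact ((casimir C n - (@theta_ C n s (casimir C n))%:A) ^+ k) (val m) =
    (central_char mu (casimir C n) - @theta_ C n s (casimir C n)) ^+ k *: val m.
  have cz : Ucentral (casimir C n) by exact: casimir_central.
  elim: k => [|k IH]; first by rewrite !expr0 uact1 scale1r.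
  by rewrite exprS uactM IH uactZr uactB uactA central_charP // -scalerBl scalerA mulrC -exprS.
by move/eqP; rewrite scaler_eq0 expf_eq0 subr_eq0 (negbTE d) andbF /= => /eqP.
Qed.

(* Only the Verma modules with a_m = k survive the projection: for the others *)
(* the Casimir separates the central characters.                              *)
Lemma block_sum (a : {ffun 'I_n -> 'I_8}) (k k' : 'I_8) (c : C) : k != k' -> c = k'%:R - k%:R ->
  (if inD n (shift (content a) k k')
   then \sum_(m < n) block (shift (content a) k k') (verma (wt_of C a + c *: eps m - rho)) else 0) =
  \sum_(m | a m == k) vten C (tset a m k').
Proof.
move=> kk' cE; have c0 : c != 0.
  by rewrite cE subr_eq0 (inj_eq (natr_inj char0)) eq_sym.
have content_k m : a m = k -> content (tset a m k') = shift (content a) k k'.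
  by move=> <-; exact: content_tset.
case: ifP => Ds; last first.
  rewrite big1 // => m /eqP am; have := inD_content (tset a m k').
  by rewrite content_k // Ds.
(* Otherwise the shifted content would have entry -1 at k. The tuple changed at m0 then represents
   the character of the target block. *)
have [m0 am0] : exists m0, a m0 = k.
  have /andP[/forallP/(_ k) + _] := Ds; rewrite !ffunE eqxx (negbTE (_ : (k : nat) != k')) //.
  rewrite addr0; case: (pickP [pred m | a m == k]) => [m /eqP am _|none]; first by exists m.
  by rewrite (eq_card0 (A := [set m | a m == k])) // => m; rewrite inE; exact: none.
have wtE m : a m = k -> wt_of C (tset a m k') = wt_of C a + c *: eps m.
  by move=> am; rewrite wt_tset am cE.
rewrite (bigID (fun m => a m == k)) /= [X in _ + X]big1 ?addr0 => [|m am]; last first.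
  apply: block_other; rewrite -(content_k _ am0) chi_content //; last exact: casimir_central.
  (* The two Casimir values differ by 2 c (a_m - k). *)
  rewrite !chi_casimir // wtE // !cas_shift // !wt_ofE am0.
  rewrite (inj_eq (addrI _)) (inj_eq (addIr _)).
  by rewrite (inj_eq (mulfI _)) ?mulf_neq0 ?two_neq0 // (inj_eq (natr_inj char0)).
apply: eq_bigr => m /eqP am; apply: (block_same a); first exact: content_k.
by rewrite wtE.
Qed.

(** * Translates of Verma modules *)

Section Translations.
Variables (r : mxrep C n n) (s : C) (h : 'I_n -> nat).
Hypothesis r_weight : forall k i, r (Em C (k, k)) *m dcol C i = (s * (i == k)%:R) *: dcol C i.
Hypothesis r_strict : forall (p : letter n) i, (p.1 < p.2)%N ->
  lspan (fun u => exists2 j, (h j < h i)%N & u = dcol C j) (r (Em C p) *m dcol C i).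

Lemma col_translation a (k k' : 'I_8) : k != k' -> s = k'%:R - k%:R ->
  gcl (translations (col_rep r) k k' (verma_fam C a)) = \sum_(m | a m == k) vten C (tset a m k').
Proof.
move=> kk' sE; rewrite -(block_sum a kk' sE) translations_verma => [|M]; last first.
  exact: (col_inO char0 r_weight r_strict).
case: ifP => // Ds; rewrite (col_additive char0 r_weight r_strict (G := block _)) => [|A B D f g].
  by apply: eq_bigr => m _; rewrite addrAC.
exact: block_ses.
Qed.

Lemma square_translation a (k k' : 'I_8) : k != k' -> 2%:R * s = k'%:R - k%:R ->
  gcl (translations (Sym2 r) k k' (verma_fam C a)) -
  gcl (translations (Alt2 r) k k' (verma_fam C a)) = \sum_(m | a m == k) vten C (tset a m k').
Proof.
move=> kk' sE; rewrite -(block_sum a kk' sE) !translations_verma => [|M|M]; last first.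
- exact: (sym_inO char0 r_weight r_strict).
- exact: (alt_inO char0 r_weight r_strict).
case: ifP => [Ds|_]; last by rewrite subr0.
rewrite (sym_alt_additive char0 r_weight r_strict (G := block _)) => [|A B D f g].
  by apply: eq_bigr => m _; rewrite addrAC.
exact: block_ses.
Qed.
End Translations.
End Grothendieck.

(** * Splitting off one copy from a power of a module *)

Section Copies.
Variables (C : fieldType) (n k : nat) (M : glmod C n).

Definition drop_fun (f : copies k.+1 M) : copies k M := [ffun j => f (lift ord0 j)].
Fact drop_linear : linear drop_fun.
Proof. by move=> a f g; apply/ffunP => j; rewrite !ffunE. Qed.
HB.instance Definition _ :=
  GRing.isLinear.Build C (copies k.+1 M) (copies k M) *:%R drop_fun drop_linear.
Fact drop_equiv x f : drop_fun (gact x f) = gact x (drop_fun f).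
Proof. by apply/ffunP => j; rewrite !ffunE. Qed.
Definition drop_hom : glhom (copies k.+1 M) (copies k M) := GlHom drop_equiv.

Lemma copies_mses : mses (copy M (ord0 : 'I_k.+1)) drop_hom.
Proof.
split=> [x y /ffunP/(_ ord0)|y|f].
- by rewrite !ffunE eqxx !scale1r.
- exists [ffun j => if unlift ord0 j is Some i then y i else 0].
  by apply/ffunP => j; rewrite !ffunE liftK.
split=> [/ffunP f0|[x <-]]; last first.
  by apply/ffunP => j; rewrite !ffunE /= scale0r.
exists (f ord0); apply/ffunP => j; rewrite ffunE; case: (unliftP ord0 j) => [i ->|->].
  by have := f0 i; rewrite !ffunE => ->; rewrite /= scale0r.
by rewrite eqxx scale1r.
Qed.
End Copies.

(** * Comparison of the functors with the spin representation *)

Section Main.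
Variables (C : fieldType) (n : nat).
Hypothesis char0 : forall k, (k%:R == 0 :> C) = (k == 0)%N.
Notation glmod := (glmod C n).
Notation L := (L_mxrep C n).
Notation Ldual := (dual_mxrep L).

Lemma E1_plus_exact : exact_On (E1_plus C n).
Proof.
by apply: famsum_exact => //; apply: translations_exact => // M;
  apply: (sym_inO char0 (@L_weight C n) (@L_strict C n)).
Qed.
Lemma E1_minus_exact : exact_On (E1_minus C n).
Proof.
by apply: famsum_exact => //; apply: translations_exact => // M;
  apply: (alt_inO char0 (@L_weight C n) (@L_strict C n)).
Qed.
Lemma F1_plus_exact : exact_On (F1_plus C n).
Proof.
by apply: famsum_exact => //; apply: translations_exact => // M;
  apply: (sym_inO char0 (@Ldual_weight C n) (@Ldual_strict C n)).
Qed.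
Lemma F1_minus_exact : exact_On (F1_minus C n).
Proof.
by apply: famsum_exact => //; apply: translations_exact => // M;
  apply: (alt_inO char0 (@Ldual_weight C n) (@Ldual_strict C n)).
Qed.
Lemma L_translations_exact i j : exact_On (translations (col_rep L) i j).
Proof.
by apply: translations_exact => // M; apply: (col_inO char0 (@L_weight C n) (@L_strict C n)).
Qed.
Lemma Ldual_translations_exact i j : exact_On (translations (col_rep Ldual) i j).
Proof.
by apply: translations_exact => // M; apply: (col_inO char0 (@Ldual_weight C n) (@Ldual_strict C n)).
Qed.

Variable gamma : KOn C n -> Vsp_tens C n.
Hypothesis Hg : is_gamma gamma.
Implicit Types a : {ffun 'I_n -> 'I_8}.
Notation gcl := (gcl gamma).

Lemma Kmap_verma F (hF : exact_On F) a (Ma : inOn (verma_fam C a)) :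
  gamma (Kmap hF (Kclass (OnObj Ma))) = gcl (F (verma_fam C a)).
Proof. by rewrite Kmap_class (gclE gamma (On_stable hF Ma)). Qed.

Lemma gamma_sub x y : gamma (Ksub x y) = gamma x - gamma y.
Proof. by rewrite (gamma_add Hg) (additive_Kopp _ (gamma_add Hg)). Qed.

Lemma Kmap_leibniz F (hF : exact_On F) X :
  (forall a, gcl (F (verma_fam C a)) = leibniz X (vten C a)) ->
  forall x, gamma (Kmap hF x) = leibniz X (gamma x).
Proof.
move=> FX; apply: (leibniz_ext char0 Hg (Phi := fun x => gamma (Kmap hF x))) => [x y|a Ma].
  by rewrite Kmap_add (gamma_add Hg).
by rewrite Kmap_verma.
Qed.

Lemma Kmap_sub_leibniz F G (hF : exact_On F) (hG : exact_On G) X :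
  (forall a, gcl (F (verma_fam C a)) - gcl (G (verma_fam C a)) = leibniz X (vten C a)) ->
  forall x, gamma (Ksub (Kmap hF x) (Kmap hG x)) = leibniz X (gamma x).
Proof.
move=> FX.
apply: (leibniz_ext char0 Hg (Phi := fun x => gamma (Ksub (Kmap hF x) (Kmap hG x)))) => [x y|a Ma].
  by rewrite !gamma_sub !Kmap_add !(gamma_add Hg) opprD addrACA.
by rewrite gamma_sub !Kmap_verma.
Qed.

(** The Leibniz action on v_a of the elementary matrix sending v_(p.1) to v_(p.2). *)
Definition arrow_sum a (p : nat * nat) : Vsp_tens C n :=
  \sum_(m | a m == p.1 :> nat) vten C (tset a m (inord p.2)).

Lemma leibniz_arrows a (s : seq (nat * nat)) : uniq s -> all (fun p => p.2 < 8)%N s ->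
  leibniz (arrows C s) (vten C a) = \sum_(p <- s) arrow_sum a p.
Proof.
move=> us s8; rewrite leibniz_vten /arrow_sum.
under [RHS]eq_bigr do rewrite big_mkcond; rewrite [RHS]exchange_big; apply: eq_bigr => m _.
have rowE (F : 'I_8 -> Vsp_tens C n) : \sum_(j < 8) (((a m : nat), (j : nat)) \in s)%:R *: F j =
    \sum_(p <- s) (if a m == p.1 :> nat then F (inord p.2) else 0).
  elim: s us s8 => [_ _|[x y] s IH /= /andP[xys us] /andP[y8 s8]].
    by rewrite big_nil big1 // => j _; rewrite scale0r.
  rewrite big_cons -IH //= (bigD1 (inord y)) //= inE inordK //.
  rewrite [X in _ = _ + X](bigD1 (inord y)) //= inordK // addrA; congr (_ + _).
    rewrite xpair_eqE eqxx andbT; case: eqP => [->|_] /=; last by rewrite add0r.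
    by rewrite (negbTE xys) scale1r scale0r addr0.
  apply: eq_bigr => j jy; rewrite inE xpair_eqE.
  by rewrite [(j : nat) == y](negbTE _) ?andbF //; apply: contraNneq jy => <-; rewrite inord_val.
rewrite -(rowE (fun j => vten C (tset a m j))); apply: eq_bigr => j _; congr (_ *: _).
by rewrite mxE.
Qed.

Lemma inord_Ordinal k (k8 : (k < 8)%N) : inord k = Ordinal k8 :> 'I_8.
Proof. by apply: val_inj; rewrite /= inordK. Qed.

Lemma arrow_sum_Ordinal a k k' (k8 : (k < 8)%N) (k8' : (k' < 8)%N) :
  arrow_sum a (k, k') = \sum_(m | a m == Ordinal k8) vten C (tset a m (Ordinal k8')).
Proof. by rewrite /arrow_sum /= inord_Ordinal. Qed.

Lemma L_arrow a k : (k.+1 < 8)%N ->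
  gcl (translations (col_rep L) k k.+1 (verma_fam C a)) = arrow_sum a (k, k.+1).
Proof.
move=> k8; have k8' : (k < 8)%N by exact: ltnW.
rewrite (arrow_sum_Ordinal a k8' k8).
have kk' : Ordinal k8' != Ordinal k8.
  by rewrite -val_eqE /= neq_ltn ltnSn.
have sE : 1 = (Ordinal k8)%:R - (Ordinal k8')%:R :> C.
  by rewrite /= -natr1 addrAC subrr add0r.
exact: (col_translation char0 Hg (@L_weight C n) (@L_strict C n) a kk' sE).
Qed.

Lemma Ldual_arrow a k : (k.+1 < 8)%N ->
  gcl (translations (col_rep Ldual) k.+1 k (verma_fam C a)) = arrow_sum a (k.+1, k).
Proof.
move=> k8; have k8' : (k < 8)%N by exact: ltnW.
rewrite (arrow_sum_Ordinal a k8 k8').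
have kk' : Ordinal k8 != Ordinal k8'.
  by rewrite -val_eqE /= neq_ltn ltnSn orbT.
have sE : -1 = (Ordinal k8')%:R - (Ordinal k8)%:R :> C.
  by rewrite /= -natr1 opprD addrA subrr add0r.
exact: (col_translation char0 Hg (@Ldual_weight C n) (@Ldual_strict C n) a kk' sE).
Qed.

(** The surviving weights 2 eps_m raise one entry by 2, which is the step of the arrows of e_1. *)
Lemma L_square_arrow a k : (k.+2 < 8)%N ->
  gcl (translations (Sym2 L) k k.+2 (verma_fam C a)) -
  gcl (translations (Alt2 L) k k.+2 (verma_fam C a)) = arrow_sum a (k, k.+2).
Proof.
move=> k8; have k8' : (k < 8)%N by exact/ltnW/ltnW.
rewrite (arrow_sum_Ordinal a k8' k8).
have kk' : Ordinal k8' != Ordinal k8.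
  by rewrite -val_eqE /= neq_ltn ltnW.
have sE : 2%:R * 1 = (Ordinal k8)%:R - (Ordinal k8')%:R :> C.
  by rewrite /= -[k.+2]addn2 natrD [k%:R + _]addrC addrK mulr1.
exact: (square_translation char0 Hg (@L_weight C n) (@L_strict C n) a kk' sE).
Qed.

Lemma Ldual_square_arrow a k : (k.+2 < 8)%N ->
  gcl (translations (Sym2 Ldual) k.+2 k (verma_fam C a)) -
  gcl (translations (Alt2 Ldual) k.+2 k (verma_fam C a)) = arrow_sum a (k.+2, k).
Proof.
move=> k8; have k8' : (k < 8)%N by exact/ltnW/ltnW.
rewrite (arrow_sum_Ordinal a k8 k8').
have kk' : Ordinal k8 != Ordinal k8'.
  by rewrite -val_eqE /= neq_ltn orbC ltnW.
have sE : 2%:R * -1 = (Ordinal k8')%:R - (Ordinal k8)%:R :> C.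
  by rewrite /= -[k.+2]addn2 natrD opprD addrA subrr add0r mulrN1.
exact: (square_translation char0 Hg (@Ldual_weight C n) (@Ldual_strict C n) a kk' sE).
Qed.

Lemma gcl_famsum_verma (F G : famfun C n) a : exact_On F -> exact_On G ->
  gcl (famsum F G (verma_fam C a)) = gcl (F (verma_fam C a)) + gcl (G (verma_fam C a)).
Proof.
have Oa := verma_fam_inOn char0 a.
by move=> [Fs _] [Gs _]; apply: gcl_famsum => //; [exact: Fs | exact: Gs].
Qed.

Lemma gcl_copies s k (M : glmod) : inO_ s M -> gcl (conc s (copies k M)) = k%:R *: gcl (conc s M).
Proof.
move=> OM; elim: k => [|k IH].
  rewrite scale0r; apply: gcl_zero => // d; rewrite /conc; case: eqP => _; last exact: zero_mod_eq0.
  by move=> f; apply/ffunP => -[].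
rewrite (gcl_conc_ses char0 Hg OM _ _ (@copies_mses C n k M)); [|exact: copies_inO_..].
by rewrite IH -natr1 scalerDl scale1r addrC.
Qed.

Lemma H_verma a (P : idx -> bool) (k : idx -> nat) :
  gcl (collect id (fun d => if P d then F_copies C n (k d) else F_zero C n) (verma_fam C a)) =
  (if P (content a) then (k (content a))%:R else 0) *: vten C a.
Proof.
have Oa := verma_fam_inOn char0 a.
have va : verma_fam C a (content a) = verma (wt_of C a - rho C n) by rewrite /verma_fam eqxx.
have OV : inO_ (content a) (verma (wt_of C a - rho C n)) by rewrite -va.
have v0 d : d != content a -> forall m : verma_fam C a d, m = 0 by exact: verma_fam_zero.
have -> : vten C a = gcl (conc (content a) (verma (wt_of C a - rho C n))).
  by rewrite -(gcl_verma_fam char0 Hg); apply: gcl_conc.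
case: ifP => Pa.
  rewrite -gcl_copies //; apply: gcl_conc => //; first exact: copies_inO_.
    by rewrite /= /collect_obj Pa va.
  move=> d /v0 d0; rewrite /= /collect_obj; case: ifP => _; last exact: zero_mod_eq0.
  by move=> f; apply/ffunP => i; rewrite (d0 (f i)) ffunE.
rewrite scale0r; apply: gcl_zero => // d; rewrite /= /collect_obj.
have [->|/v0 d0] := eqVneq d (content a); first by rewrite Pa; exact: zero_mod_eq0.
case: ifP => _; last exact: zero_mod_eq0.
by move=> f; apply/ffunP => i; rewrite (d0 (f i)) ffunE.
Qed.

(** At most one term is nonzero, and it contributes |c_i| with the sign of c_i. *)
Lemma H_difference a i : gcl (H_plus C n i (verma_fam C a)) - gcl (H_minus C n i (verma_fam C a)) =
  (c_ i (content a))%:~R *: vten C a.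
Proof.
rewrite !H_verma -scalerBl; congr (_ *: _); set c := c_ i _.
rewrite !inE; case: (ltrgt0P c) => [c0|c0|->]; last by rewrite subr0.
  by rewrite gtr0_sgz //= subr0 -[in RHS](gtz0_abs c0).
by rewrite ltr0_sgz //= sub0r -[in RHS](opprK c) -(ltz0_abs c0) mulrNz.
Qed.

(** A diagonal matrix multiplies v_a by the sum of its eigenvalues over the entries of a; grouping
    equal entries brings in the content, as in the definition of [c_]. *)
Lemma leibniz_signs a p q : leibniz (signs C p q) (vten C a) =
  (\sum_(0 <= k < 8) (entry (content a) k)%:~R * ((k \in p)%:R - (k \in q)%:R)) *: vten C a.
Proof.
rewrite leibniz_vten; pose f (k : 'I_8) : C := ((k : nat) \in p)%:R - ((k : nat) \in q)%:R.
have -> : \sum_(m < n) \sum_(j < 8) signs C p q j (a m) *: vten C (tset a m j) =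
    \sum_(m < n) f (a m) *: vten C a.
  apply: eq_bigr => m _; rewrite (bigD1 (a m)) //= mxE eqxx big1 ?addr0 => [|j /negbTE jm].
    by congr (_ *: vten C _); apply/ffunP => m'; rewrite ffunE; case: eqP => // ->.
  by rewrite mxE jm scale0r.
rewrite -scaler_suml; congr (_ *: _).
have -> : \sum_(m < n) f (a m) = \sum_(k < 8) (content a k)%:~R * f k.
  rewrite (partition_big a predT) //=; apply: eq_bigr => k _.
  rewrite (eq_bigr (fun=> f k)) => [|m /eqP -> //]; rewrite sumr_const ffunE.
  by rewrite -mulr_natl; congr (_%:R * _); apply: eq_card => m; rewrite inE.
transitivity (\sum_(k < 8) (content a (inord k))%:~R * f (inord k)).
  by apply: eq_bigr => k _; rewrite inord_val.
rewrite -(big_mkord predT (fun k => (content a (inord k))%:~R * f (inord k))).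
by apply: eq_big_nat => k k8; rewrite /f inordK.
Qed.

Lemma spin_h_verma a i : (1 <= i <= 3)%N ->
  gcl (H_plus C n i (verma_fam C a)) - gcl (H_minus C n i (verma_fam C a)) =
  leibniz (spin_h C i) (vten C a).
Proof.
rewrite H_difference; case: i => [|[|[|[|i]]]] // _.
all: rewrite leibniz_signs; congr (_ *: _); rewrite /c_ /index_iota /= !big_cons big_nil /=.
all: rewrite !(rmorphD, rmorphN) /= ?subr0 ?sub0r ?mulr0 ?mulr1 ?mulrN1 ?addr0 ?add0r; ring.
Qed.

Lemma spin_e1_verma a : gcl (E1_plus C n (verma_fam C a)) - gcl (E1_minus C n (verma_fam C a)) =
  leibniz (spin_e C 1) (vten C a).
Proof.
have tO (V : vectType C) (rV : rep n V) i j := @translations_exact C n char0 V rV i j.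
have S M : inO M -> inO (tens (Sym2 L) M) by exact: (sym_inO char0 (@L_weight C n) (@L_strict C n)).
have A M : inO M -> inO (tens (Alt2 L) M) by exact: (alt_inO char0 (@L_weight C n) (@L_strict C n)).
rewrite !gcl_famsum_verma; [|exact: tO..].
rewrite leibniz_arrows // !big_cons big_nil addr0 opprD addrACA addrC.
by congr (_ + _); apply: L_square_arrow.
Qed.

Lemma spin_f1_verma a : gcl (F1_plus C n (verma_fam C a)) - gcl (F1_minus C n (verma_fam C a)) =
  leibniz (spin_f C 1) (vten C a).
Proof.
have tO (V : vectType C) (rV : rep n V) i j := @translations_exact C n char0 V rV i j.
have S M : inO M -> inO (tens (Sym2 Ldual) M).
  exact: (sym_inO char0 (@Ldual_weight C n) (@Ldual_strict C n)).
have A M : inO M -> inO (tens (Alt2 Ldual) M).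
  exact: (alt_inO char0 (@Ldual_weight C n) (@Ldual_strict C n)).
rewrite !gcl_famsum_verma; [|exact: tO..].
rewrite leibniz_arrows // !big_cons big_nil addr0 opprD addrACA addrC.
by congr (_ + _); apply: Ldual_square_arrow.
Qed.

Lemma E2_exact : exact_On (E2 C n).
Proof. by apply: famsum_exact => //; exact: L_translations_exact. Qed.
Lemma F2_exact : exact_On (F2 C n).
Proof. by apply: famsum_exact => //; exact: Ldual_translations_exact. Qed.
Lemma E3_exact : exact_On (E3 C n).
Proof. by do 2!apply: famsum_exact => //; exact: L_translations_exact. Qed.
Lemma F3_exact : exact_On (F3 C n).
Proof. by do 2!apply: famsum_exact => //; exact: Ldual_translations_exact. Qed.

Lemma spin_e2_verma a : gcl (E2 C n (verma_fam C a)) = leibniz (spin_e C 2) (vten C a).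
Proof.
rewrite gcl_famsum_verma; [|exact: L_translations_exact..].
by rewrite leibniz_arrows // !big_cons big_nil addr0 !L_arrow // addrC.
Qed.

Lemma spin_f2_verma a : gcl (F2 C n (verma_fam C a)) = leibniz (spin_f C 2) (vten C a).
Proof.
rewrite gcl_famsum_verma; [|exact: Ldual_translations_exact..].
by rewrite leibniz_arrows // !big_cons big_nil addr0 !Ldual_arrow // addrC.
Qed.

Lemma spin_e3_verma a : gcl (E3 C n (verma_fam C a)) = leibniz (spin_e C 3) (vten C a).
Proof.
have ex i j := L_translations_exact i j.
rewrite !gcl_famsum_verma; do ?[by apply: famsum_exact | exact: ex].
rewrite leibniz_arrows // !big_cons big_nil addr0 !L_arrow //.
have swap (x y z t : Vsp_tens C n) : x + y + (z + t) = t + (z + (y + x)).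
  by rewrite addrC (addrC z) -addrA (addrC x).
exact: swap.
Qed.

Lemma spin_f3_verma a : gcl (F3 C n (verma_fam C a)) = leibniz (spin_f C 3) (vten C a).
Proof.
have ex i j := Ldual_translations_exact i j.
rewrite !gcl_famsum_verma; do ?[by apply: famsum_exact | exact: ex].
rewrite leibniz_arrows // !big_cons big_nil addr0 !Ldual_arrow //.
have swap (x y z t : Vsp_tens C n) : x + y + (z + t) = t + (z + (y + x)).
  by rewrite addrC (addrC z) -addrA (addrC x).
exact: swap.
Qed.
End Main.

Theorem theorem3p3 (R : realType) (n : nat) (hn : (0 < n)%N) :
  [/\ (forall a : {ffun 'I_n -> 'I_8}, inOn (verma_fam R[i] a)),
      (forall i, (1 <= i <= 3)%N ->
         exact_On (H_plus R[i] n i) /\ exact_On (H_minus R[i] n i)),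
      [/\ exact_On (E1_plus R[i] n), exact_On (E1_minus R[i] n),
          exact_On (E2 R[i] n) & exact_On (E3 R[i] n)],
      [/\ exact_On (F1_plus R[i] n), exact_On (F1_minus R[i] n),
          exact_On (F2 R[i] n) & exact_On (F3 R[i] n)]
    & forall gamma : KOn R[i] n -> Vsp_tens R[i] n, is_gamma gamma ->
      [/\ (forall i, (1 <= i <= 3)%N ->
             forall (hp : exact_On (H_plus R[i] n i))
                    (hm : exact_On (H_minus R[i] n i)) x,
             gamma (Ksub (Kmap hp x) (Kmap hm x))
               = leibniz (spin_h R[i] i) (gamma x)),
          ((forall (hp : exact_On (E1_plus R[i] n))
                   (hm : exact_On (E1_minus R[i] n)) x,
              gamma (Ksub (Kmap hp x) (Kmap hm x))
                = leibniz (spin_e R[i] 1) (gamma x)) /\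
           (forall (h2 : exact_On (E2 R[i] n)) x,
              gamma (Kmap h2 x) = leibniz (spin_e R[i] 2) (gamma x)) /\
           (forall (h3 : exact_On (E3 R[i] n)) x,
              gamma (Kmap h3 x) = leibniz (spin_e R[i] 3) (gamma x)))
        & ((forall (hp : exact_On (F1_plus R[i] n))
                   (hm : exact_On (F1_minus R[i] n)) x,
              gamma (Ksub (Kmap hp x) (Kmap hm x))
                = leibniz (spin_f R[i] 1) (gamma x)) /\
           (forall (h2 : exact_On (F2 R[i] n)) x,
              gamma (Kmap h2 x) = leibniz (spin_f R[i] 2) (gamma x)) /\
           (forall (h3 : exact_On (F3 R[i] n)) x,
              gamma (Kmap h3 x) = leibniz (spin_f R[i] 3) (gamma x)))]].

Proof.
have char0 k : (k%:R == 0 :> R[i]) = (k == 0)%N by exact: pnatr_eq0.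
split.
- exact: verma_fam_inOn.
- by move=> i _; split; exact: H_exact.
- by split; [exact: E1_plus_exact | exact: E1_minus_exact | exact: E2_exact | exact: E3_exact].
- by split; [exact: F1_plus_exact | exact: F1_minus_exact | exact: F2_exact | exact: F3_exact].
move=> gamma Hg; split.
- by move=> i i3 hp hm; apply: Kmap_sub_leibniz => // a; exact: spin_h_verma.
- split; first by move=> hp hm; apply: Kmap_sub_leibniz => // a; exact: spin_e1_verma.
  by split=> h; apply: Kmap_leibniz => // a; [exact: spin_e2_verma | exact: spin_e3_verma].
split; first by move=> hp hm; apply: Kmap_sub_leibniz => // a; exact: spin_f1_verma.
by split=> h; apply: Kmap_leibniz => // a; [exact: spin_f2_verma | exact: spin_f3_verma].
Qed.
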